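(* Let Assumption 1 (for the problem OGR-2) hold. Consider the closed-loop delayed system consisting of the power system (P), the generation dynamics (GD), the generation input (U), the tie-line controller (CT), and the scattering communication protocol (ST1)--(ST2), all written out in the context, and consider an equilibrium point of this system in which Assumption 2 holds, i.e. $|\eta_{ij}^*|<\pi/2$ for all $(i,j)\in E$. The communication delays ($T_{ij}\ge 0$ for all $(i,j)\in\tilde E$, in both channel directions) are assumed to be constant, and are allowed to take arbitrary bounded values and be heterogeneous. Then there exists an open neighborhood $\Omega$ about this equilibrium point such that the solutions of the closed-loop system with initial conditions in $\Omega$ converge to an equilibrium point that solves the problem OGR-2 with $\omega^*=\mathbf 0_{|N|}$.
   Context: **Network.** $\mathcal G(N,E)$ is a connected graph of buses $N=G\cup L$ (disjoint union of generation buses $G$ and load buses $L$) and transmission lines $E$, each line given an arbitrary orientation $(i,j)$, also written $i\to j$. Its incidence matrix $D\in\mathbb R^{|N|\times|E|}$ has entry $-1$ if the edge leaves the node, $+1$ if it enters the node, $0$ otherwise. $\mathcal G(N,\tilde E)$ is a connected undirected communication graph; $\tilde N_j$ is the set of communication neighbours of bus $j$. Communication weights satisfy $\alpha_{ij}=\alpha_{ji}>0$. **Areas.** $N$ is partitioned into control areas $C_k$, $k\in K=\{1,\dots,|K|\}$. $B_k$ is the set of transmission lines connecting area $k$ to other areas; $\tilde B\subseteq\tilde E$ is the set of communication lines connecting different areas. The graph $\mathcal G(N,\tilde E\setminus\tilde B)$ is assumed to have $|K|$ connected components. $E_K\in\mathbb R^{|K|\times|N|}$ has $(k,j)$ entry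 $1$ if $j\in C_k$ and $0$ otherwise, and $\hat D=[\hat D_{k,ij}]=E_KD\in\mathbb R^{|K|\times|E|}$. For each area $k$ a number $\hat P_k$ (net power injection of area $k$) is given, and only one bus $j_k\in C_k$ has access to it: $J_j=1$ if $j=j_k$ for some $k$, and $J_j=0$ otherwise. **(P) Power system**, with constants $M_j>0$ ($j\in G$), $\Lambda_j>0$ ($j\in N$), $Y_{ij}=Y_{ji}>0$, and constant demands $p_j^L\in\mathbb R$ ($j\in N$): $\dot\eta_{ij}=\omega_i-\omega_j$, $(i,j)\in E$; $M_j\dot\omega_j=-p_j^L+p_j^M-\Lambda_j\omega_j-\sum_{k:j\to k}p_{jk}+\sum_{i:i\to j}p_{ij}$, $j\in G$; $0=-p_j^L-\Lambda_j\omega_j-\sum_{k:j\to k}p_{jk}+\sum_{i:i\to j}p_{ij}$, $j\in L$; $p_{ij}=Y_{ij}\sin\eta_{ij}$, $(i,j)\in E$. **(GD)** with $\tau_j,k_{g,j}>0$: $\tau_j\dot p_j^M=-p_j^M+k_{g,j}u_j$, $j\in G$. Set $p_j^M:=0$ for $j\notin G$. **(U)** with $k_{c,j}>0$: $u_j=k_{c,j}(p_j^c-\omega_j)+\frac{p_j^M}{k_{g,j}}-k_{c,j}Q_j'(p_j^M)$, $j\in G$. **Problem OGR-2:** $\min_{p^M,p}\sum_{j\in G}Q_j(p_j^M)$ subject to $\sum_{j\in G}p_j^M=\sum_{j\in N}p_j^L$ and $\sum_{(i,j)\in B_k}\hat D_{k,ij}p_{ij}=\hat P_k$ for all $k\in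 K$. **Assumption 1.** The functions $Q_j$, $j\in G$, are continuously differentiable and strictly convex, and the considered optimization problem is feasible, i.e. there exists an equilibrium point of (P),(GD) with $\omega=0$ such that the corresponding $p^M$ is a solution to the considered optimization problem. **(CT) Controller**, for $j\in N$, where $k$ is the area with $j\in C_k$: $\dot\rho_j^{\zeta}=-\rho_j^{\zeta}+\sum_{i\in\tilde N_j}\alpha_{ij}(r_{ij}^p-p_j^c)-\sum_{i\in\tilde N_j}\alpha_{ij}(r_{ij}^{\pi'}-\pi_j)$, $\dot\zeta_j=-\rho_j^{\zeta}+2\sum_{i\in\tilde N_j}\alpha_{ij}(r_{ij}^p-p_j^c)-2\sum_{i\in\tilde N_j}\alpha_{ij}(r_{ij}^{\pi'}-\pi_j)$, $\dot\rho_j^p=-\rho_j^p-(p_j^M-p_j^L)-\sum_{i\in\tilde N_j}\alpha_{ij}(r_{ij}^\zeta-\zeta_j)$, $\dot p_j^c=-\rho_j^p-2(p_j^M-p_j^L)-2\sum_{i\in\tilde N_j}\alpha_{ij}(r_{ij}^\zeta-\zeta_j)$, $\dot\rho_j^\pi=-\rho_j^\pi+\sum_{i\in\tilde N_j}\alpha_{ij}(r_{ij}^{\zeta'}-\zeta_j)-\sum_{i\in\tilde N_j\cap C_k}\alpha_{ij}(r_{ij}^{\phi''}-\phi_j)-J_j\hat P_k$, $\dot\pi_j=-\rho_j^\pi+2\sum_{i\in\tilde N_j}\alpha_{ij}(r_{ij}^{\zeta'}-\zeta_j)-2\sum_{i\in\tilde N_j\cap C_k}\alpha_{ij}(r_{ij}^{\phi''}-\phi_j)-2J_j\hat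 P_k$, $\dot\rho_j^\phi=-\rho_j^\phi+\sum_{i\in\tilde N_j\cap C_k}\alpha_{ij}(r_{ij}^{\pi''}-\pi_j)$, $\dot\phi_j=-\rho_j^\phi+2\sum_{i\in\tilde N_j\cap C_k}\alpha_{ij}(r_{ij}^{\pi''}-\pi_j)$. Here the $r_{ij}$-signals are formed at bus $j$ from what it receives from bus $i$. **(ST1) Scattering transformation.** For communicating buses $i,j$ let $\sigma_{ij}=\sigma_{ji}=0$ if the line between them is in $\tilde B$ and $1$ otherwise; $r_{ji}=(r_{ji}^p,r_{ji}^\zeta,r_{ji}^{\zeta'},r_{ji}^{\pi'},\sigma_{ji}r_{ji}^{\pi''},\sigma_{ji}r_{ji}^{\phi''})^T$, $y_{ji}=(\zeta_i,-p_i^c,\pi_i,-\zeta_i,\sigma_{ji}\phi_i,-\sigma_{ji}\pi_i)^T$ (and $r_{ij},y_{ij}$ by exchanging $i$ and $j$). For each $(i,j)\in\tilde E$: $s_{\overrightarrow{ij}}=-\frac1{\sqrt2}(r_{ji}-y_{ji})$, $s_{\overleftarrow{ij}}=-\frac1{\sqrt2}(r_{ji}+y_{ji})$, $s_{\overleftarrow{ji}}=\frac1{\sqrt2}(r_{ij}+y_{ij})$, $s_{\overrightarrow{ji}}=\frac1{\sqrt2}(r_{ij}-y_{ij})$. **(ST2) Delayed transmission**, with $E_s=I_3\otimes\begin{bmatrix}0&-1\\1&0\end{bmatrix}$: $s_{\overleftarrow{ij}}(t)=E_ss_{\overrightarrow{ji}}(t-T_{ji})$, $s_{\overleftarrow{ji}}(t)=E_ss_{\overrightarrow{ij}}(t-T_{ij})$,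 where $T_{ij}$ is the delay of channel $i\to j$ and $T_{ji}$ that of channel $j\to i$. Variables without subscripts denote stacked vectors; the superscript $*$ denotes the value at an equilibrium point. *)

(* Defs.v *)
(* MathComp / MathComp-Analysis, over an arbitrary [R : realType]. *)
From HB Require Import structures.
From mathcomp Require Import all_boot all_order all_algebra.
From mathcomp Require Import mxtens.
From mathcomp Require Import all_classical all_reals all_analysis.

Set Implicit Arguments.
Unset Strict Implicit.
Unset Printing Implicit Defensive.

Import Order.TTheory GRing.Theory Num.Theory.
Import numFieldNormedType.Exports.

Local Open Scope classical_set_scope.
Local Open Scope ring_scope.

(* Finite simple undirected graphs on 'I_n, given with one (arbitrary)
   orientation (i, j) of each edge. *)
Section Graphs.
Variable n : nat.
Implicit Type A : {set 'I_n * 'I_n}.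

Definition simple_oriented A : Prop :=
  forall i j, (i, j) \in A -> i != j /\ (j, i) \notin A.

Definition adj A : rel 'I_n :=
  fun i j => ((i, j) \in A) || ((j, i) \in A).

Definition connected_graph A : Prop := forall i j, connect (adj A) i j.

End Graphs.

(* n buses, q transmission lines, m control areas; the load buses are those
   outside [gen].  [comm] lists the communication lines, one orientation (i, j)
   for each; it fixes the roles of i and j in [scattering] below. *)
Record grid (R : realType) (n q m : nat) := Grid {
  gen : {set 'I_n};
  line : 'I_q -> 'I_n * 'I_n;
  comm : {set 'I_n * 'I_n};
  area : 'I_n -> 'I_m;
  (* the only bus of an area that knows its net injection [Phat] *)
  gate : 'I_m -> 'I_n;
  Phat : 'I_m -> R;
  alpha : 'I_n -> 'I_n -> R;
  M : 'I_n -> R;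
  Lam : 'I_n -> R;
  Y : 'I_n -> 'I_n -> R;
  pL : 'I_n -> R;
  tau : 'I_n -> R;
  kg : 'I_n -> R;
  kc : 'I_n -> R;
  Q : 'I_n -> R -> R
}.

Section Network.
Variables (R : realType) (n q m : nat) (g : grid R n q m).

Definition src (l : 'I_q) : 'I_n := (line g l).1.
Definition dst (l : 'I_q) : 'I_n := (line g l).2.

Definition lines : {set 'I_n * 'I_n} := [set line g l | l : 'I_q]%SET.

Definition nbr : rel 'I_n := adj (comm g).

Definition inter_comm : {set 'I_n * 'I_n} :=
  [set e in comm g | area g e.1 != area g e.2]%SET.

Definition incidence : 'M[R]_(n, q) :=
  \matrix_(j, l) (if src l == j then -1 else if dst l == j then 1 else 0).

Definition area_mx : 'M[R]_(m, n) :=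
  \matrix_(k, j) (if area g j == k then 1 else 0).

Definition Dhat : 'M[R]_(m, q) := area_mx *m incidence.

Definition tie_lines (k : 'I_m) : {set 'I_q} :=
  [set l | (area g (src l) == k) != (area g (dst l) == k)]%SET.

Definition J (j : 'I_n) : R := if [exists k, j == gate g k] then 1 else 0.

Definition sigma (i j : 'I_n) : R := if adj inter_comm i j then 0 else 1.

Definition network_ok : Prop :=
  [/\ [/\ injective (line g), simple_oriented lines & connected_graph lines],
      [/\ simple_oriented (comm g), connected_graph (comm g)
        & n_comp (adj (comm g :\: inter_comm)%SET) 'I_n = m],
      (forall k, area g (gate g k) = k),
      [/\ forall j, j \in gen g ->
            [/\ 0 < M g j, 0 < tau g j, 0 < kg g j & 0 < kc g j],
          forall j, 0 < Lam g j,
          forall i j, Y g i j = Y g j i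
        & forall l, 0 < Y g (src l) (dst l)]
    & forall i j, nbr i j ->
        alpha g i j = alpha g j i /\ 0 < alpha g i j].

Definition ogr2_feasible (pM : 'I_n -> R) (p : 'I_q -> R) : Prop :=
  \sum_(j in gen g) pM j = \sum_j pL g j /\
  forall k, \sum_(l in tie_lines k) Dhat k l * p l = Phat g k.

Definition ogr2_solution (pM : 'I_n -> R) (p : 'I_q -> R) : Prop :=
  ogr2_feasible pM p /\
  forall pM' p', ogr2_feasible pM' p' ->
    \sum_(j in gen g) Q g j (pM j) <= \sum_(j in gen g) Q g j (pM' j).

(* [solves x f] means x' = f on [0, +oo) in the sense of Caratheodory.  The
   right-hand sides below contain delayed signals, which in general jump. *)
Definition solves (x f : R -> R) : Prop :=
  forall t, 0 <= t ->
    (@lebesgue_measure R).-integrable `[0, t] (EFin \o f) /\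
    x t = x 0 + \int[@lebesgue_measure R]_(s in `[0, t]) f s.

Record phys := Phys {
  (* eta, the angle difference across a line *)
  angle : 'I_q -> R;
  omega : 'I_n -> R;
  pM : 'I_n -> R
}.

Definition flow (x : phys) (l : 'I_q) : R :=
  Y g (src l) (dst l) * sin (angle x l).

Definition power_system (x : R -> phys) : Prop :=
  [/\ forall l, solves (fun t => angle (x t) l)
        (fun t => omega (x t) (src l) - omega (x t) (dst l)),
      forall j, j \in gen g -> solves (fun t => M g j * omega (x t) j)
        (fun t => - pL g j + pM (x t) j - Lam g j * omega (x t) j
                  - \sum_(l | src l == j) flow (x t) l
                  + \sum_(l | dst l == j) flow (x t) l)
    & forall j, j \notin gen g -> forall t, 0 <= t ->
        0 = - pL g j - Lam g j * omega (x t) j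
            - \sum_(l | src l == j) flow (x t) l
            + \sum_(l | dst l == j) flow (x t) l].

Definition generation (x : R -> phys) (u : R -> 'I_n -> R) : Prop :=
  (forall j, j \in gen g -> solves (fun t => tau g j * pM (x t) j)
     (fun t => - pM (x t) j + kg g j * u t j)) /\
  (forall j, j \notin gen g -> forall t, 0 <= t -> pM (x t) j = 0).

Definition strictly_convex (f : R -> R) : Prop :=
  forall x y t, x != y -> 0 < t -> t < 1 ->
    f (t * x + (1 - t) * y) < t * f x + (1 - t) * f y.

(* Equilibria are constant solutions.  The pair (p^M, p) of decision variables
   of OGR-2 is the one read off from the equilibrium. *)
Definition assumption1 : Prop :=
  (forall j, j \in gen g ->
     [/\ forall x, derivable (Q g j) x 1, continuous (derive1 (Q g j))
       & strictly_convex (Q g j)]) /\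
  exists (x : phys) (u : 'I_n -> R),
    [/\ power_system (fun=> x), generation (fun=> x) (fun=> u),
        forall j, omega x j = 0
      & ogr2_solution (pM x) (flow x)].

Record state := State {
  ph :> phys;
  rho_zeta : 'I_n -> R;
  zeta : 'I_n -> R;
  rho_p : 'I_n -> R;
  pc : 'I_n -> R;
  rho_pi : 'I_n -> R;
  vpi : 'I_n -> R;
  rho_phi : 'I_n -> R;
  vphi : 'I_n -> R
}.

(* r^p, r^zeta, r^zeta', r^pi', r^pi'', r^phi'' *)
Record rsig := RSig {
  r_p : R;
  r_zeta : R;
  r_zeta1 : R;
  r_pi1 : R;
  r_pi2 : R;
  r_phi2 : R
}.

(* [rs w i j] is r_{ij}, formed at bus j; [s_out w i j] and [s_in w i j] are the
   waves leaving and reaching bus i on its channel with bus j, written s_{ij}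
   with an arrow to the right, respectively to the left. *)
Record signals := Signals {
  st :> state;
  rs : 'I_n -> 'I_n -> rsig;
  s_out : 'I_n -> 'I_n -> 'cV[R]_6;
  s_in : 'I_n -> 'I_n -> 'cV[R]_6
}.

Definition gen_input (w : signals) (j : 'I_n) : R :=
  kc g j * (pc w j - omega w j) + pM w j / kg g j
  - kc g j * derive1 (Q g j) (pM w j).

(* The sums over the communication neighbours of bus j, resp. over those in
   the area of j. *)
Definition nsum (j : 'I_n) (F : 'I_n -> R) : R :=
  \sum_(i | nbr i j) alpha g i j * F i.
Definition asum (j : 'I_n) (F : 'I_n -> R) : R :=
  \sum_(i | nbr i j && (area g i == area g j)) alpha g i j * F i.

Definition controller (w : R -> signals) : Prop :=
  forall j,
  [/\ solves (fun t => rho_zeta (w t) j)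
        (fun t => - rho_zeta (w t) j
                  + nsum j (fun i => r_p (rs (w t) i j) - pc (w t) j)
                  - nsum j (fun i => r_pi1 (rs (w t) i j) - vpi (w t) j))
    & solves (fun t => zeta (w t) j)
        (fun t => - rho_zeta (w t) j
                  + 2 * nsum j (fun i => r_p (rs (w t) i j) - pc (w t) j)
                  - 2 * nsum j (fun i => r_pi1 (rs (w t) i j) - vpi (w t) j))]
  /\
  [/\ solves (fun t => rho_p (w t) j)
        (fun t => - rho_p (w t) j - (pM (w t) j - pL g j)
                  - nsum j (fun i => r_zeta (rs (w t) i j) - zeta (w t) j))
    & solves (fun t => pc (w t) j)
        (fun t => - rho_p (w t) j - 2 * (pM (w t) j - pL g j)
                  - 2 * nsum j (fun i => r_zeta (rs (w t) i j) - zeta (w t) j))]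
  /\
  [/\ solves (fun t => rho_pi (w t) j)
        (fun t => - rho_pi (w t) j
                  + nsum j (fun i => r_zeta1 (rs (w t) i j) - zeta (w t) j)
                  - asum j (fun i => r_phi2 (rs (w t) i j) - vphi (w t) j)
                  - J j * Phat g (area g j))
    & solves (fun t => vpi (w t) j)
        (fun t => - rho_pi (w t) j
                  + 2 * nsum j (fun i => r_zeta1 (rs (w t) i j) - zeta (w t) j)
                  - 2 * asum j (fun i => r_phi2 (rs (w t) i j) - vphi (w t) j)
                  - 2 * J j * Phat g (area g j))]
  /\
  [/\ solves (fun t => rho_phi (w t) j)
        (fun t => - rho_phi (w t) j
                  + asum j (fun i => r_pi2 (rs (w t) i j) - vpi (w t) j))
    & solves (fun t => vphi (w t) j)
        (fun t => - rho_phi (w t) j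
                  + 2 * asum j (fun i => r_pi2 (rs (w t) i j) - vpi (w t) j))].

Definition col6 (a b c d e f : R) : 'cV[R]_6 :=
  \col_i [:: a; b; c; d; e; f]`_i.

Definition rvec (w : signals) (i j : 'I_n) : 'cV[R]_6 :=
  let v := rs w i j in
  col6 (r_p v) (r_zeta v) (r_zeta1 v) (r_pi1 v)
       (sigma i j * r_pi2 v) (sigma i j * r_phi2 v).

(* y_{ij} carries the variables of bus j. *)
Definition yvec (w : signals) (i j : 'I_n) : 'cV[R]_6 :=
  col6 (zeta w j) (- pc w j) (vpi w j) (- zeta w j)
       (sigma i j * vphi w j) (- (sigma i j * vpi w j)).

Definition scattering (w : R -> signals) : Prop :=
  let c := (Num.sqrt (2 : R))^-1 in
  forall i j, (i, j) \in comm g -> forall t, 0 <= t ->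
  [/\ s_out (w t) i j = (- c) *: (rvec (w t) j i - yvec (w t) j i),
      s_in (w t) i j = (- c) *: (rvec (w t) j i + yvec (w t) j i),
      s_in (w t) j i = c *: (rvec (w t) i j + yvec (w t) i j)
    & s_out (w t) j i = c *: (rvec (w t) i j - yvec (w t) i j)].

Definition rot2 : 'M[R]_2 :=
  \matrix_(i, j) (if (i == 0) && (j == 1) then -1
                  else if (i == 1) && (j == 0) then 1 else 0).

Definition Es : 'M[R]_6 := (1%:M : 'M[R]_3) *t rot2.

Variable T : 'I_n -> 'I_n -> R.

Definition transmission (w : R -> signals) : Prop :=
  forall i j, nbr i j -> forall t, 0 <= t ->
    s_in (w t) i j = Es *m s_out (w (t - T j i)) j i.

(* The wave sent from i to j is needed from time - T_{ij} on; it is measurable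
   and bounded on bounded intervals, not necessarily continuous. *)
Definition regular_waves (w : R -> signals) : Prop :=
  forall i j, nbr i j -> forall c : 'I_6,
    measurable_fun `[- T i j, +oo[ (fun t => s_out (w t) i j c ord0) /\
    forall b, exists C, forall t, - T i j <= t -> t <= b ->
      `|s_out (w t) i j c ord0| <= C.

(* Trajectories are functions on the whole of R for convenience: of their values
   at negative times, only those of the wave i -> j on [- T_{ij}, 0[ matter. *)
Definition solution (w : R -> signals) : Prop :=
  [/\ [/\ power_system (fun t => ph (w t)),
          generation (fun t => ph (w t)) (fun t => gen_input (w t))
        & controller w],
      scattering w, transmission w & regular_waves w].

Definition equilibrium (w : signals) : Prop := solution (fun=> w).

Definition all_vars (P : (state -> R) -> Prop) : Prop :=
  (forall l, P (fun x => angle x l)) /\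
  forall j,
  [/\ P (fun x => omega x j), P (fun x => pM x j)
    & [/\ P (fun x => rho_zeta x j), P (fun x => zeta x j),
          P (fun x => rho_p x j) & P (fun x => pc x j)] /\
      [/\ P (fun x => rho_pi x j), P (fun x => vpi x j),
          P (fun x => rho_phi x j) & P (fun x => vphi x j)]].

(* Initial conditions: the state at time 0 and the waves i -> j in
   transit at time 0, i.e. that were sent during [- T_{ij}, 0[. *)
Record init_cond := InitCond {
  init_state : state;
  init_wave : 'I_n -> 'I_n -> R -> 'cV[R]_6
}.

Definition initial_of (w : R -> signals) : init_cond :=
  InitCond (st (w 0)) (fun i j t => s_out (w t) i j).

(* Sup-norm topology on the initial conditions. *)
Definition init_close (e : R) (z z' : init_cond) : Prop :=
  all_vars (fun v => `|v (init_state z) - v (init_state z')| < e) /\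
  forall i j, nbr i j -> forall c : 'I_6, forall t, - T i j <= t -> t < 0 ->
    `|init_wave z i j t c ord0 - init_wave z' i j t c ord0| < e.

Definition init_open (W : set init_cond) : Prop :=
  forall z, W z -> exists2 e, 0 < e & forall z', init_close e z z' -> W z'.

(* Convergence of all the state variables.  The signals r and s are not states;
   they need not converge, as delay channels are lossless: on an even cycle of
   the communication graph they can sustain an oscillation that cancels in
   every sum of the controller. *)
Definition converges_to (w : R -> signals) (winf : signals) : Prop :=
  all_vars (fun v => v (w t) @[t --> +oo] --> v winf).

End Network.

(* Main.v *)
(* In deviations from the given equilibrium, every pair (rho, x) of controller
   variables is a passive cell rho' = - rho + u, x' = - rho + 2 u with storage
   (x - rho)^2 / 2 + rho^2 / 2 and dissipation rho^2, and every scattering channel is a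
   lossless line whose storage is the energy of the waves in transit.  Together
   with the kinetic energy, the angle potential and the generator storage they
   form a Lyapunov function, decreasing whatever the delays, that traps the angles
   near the equilibrium; Barbalat's lemma gives that omega, rho and the deviation
   of p^M tend to 0, hence also that p^c tends to its equilibrium value at the
   generators and that the net flows do.  The angles then converge because the flows
   are strongly monotone functions of them.

   The waves themselves need not converge.  However x' = rho + 2 rho', so x varies
   slowly, and over a window of length H the integrals of the waves agree, up to a
   bound independent of H, with H times the values they would have at rest in the
   current x.  Averaging the controller equations, x approaches the equilibria of
   the undelayed controller.  Averaging the conserved energy inner products with these
   equilibria, x has a limit in every remaining direction, because the energy is
   positive definite. *)

Require Import Defs.
From HB Require Import structures.
From mathcomp Require Import all_boot all_order all_algebra.
From mathcomp Require Import all_classical all_reals all_analysis.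
From mathcomp Require Import measurable_realfun ring lra.

Set Implicit Arguments.
Unset Strict Implicit.
Unset Printing Implicit Defensive.

Import Order.TTheory GRing.Theory Num.Theory.
Import numFieldNormedType.Exports.
Local Open Scope classical_set_scope.
Local Open Scope ring_scope.

(** * Local integrals and primitives *)

(** The equilibria are not isolated. The couplings of the controller see only differences of
    outputs, for instance of zeta, and the angles move only inside a coset fixed by the initial
    condition. The limit therefore depends on the trajectory, and a decreasing Lyapunov function
    alone would give no more than approach to a set. No compactness is at hand for an invariance
    principle either, because waves in transit may jump and the energy bounds them only in mean
    square. Hence every limit is reached through estimates on scalar functions of time: Barbalat for
    what the dissipation controls, slow variation and long windows for the rest, and
    finite-dimensional linear algebra to put the observed directions together. The nonlinearity is
    confined to the power side. In deviations the controller is a linear network whose only outside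
    input is the deviation of p^M, and its energy balance meets that of the power side in one
    product, which cancels. Optimality is a static matter: every state at rest solves OGR-2, so it
    suffices to show that the limit is at rest. *)

Section Integration.
Context {R : realType}.
Implicit Types (f h : R -> R) (a b c t : R).
Local Notation mu := (@lebesgue_measure R).

Definition itg f a b : R := \int[mu]_(s in `[a, b]) f s.

(** Preferred to local integrability because it is stable under products, hence under energies and
    powers. The start [c] is [- T] for a wave sent over a channel of delay [T], and 0 for everything
    else. *)
Definition reg c f :=
  measurable_fun `[c, +oo[ f /\
  forall b, exists C : R, forall t : R, c <= t -> t <= b -> `|f t| <= C.

Lemma itv_sub_ray c a b : c <= a -> (`[a, b] : set R) `<=` `[c, +oo[.
Proof. by move=> ca x /=; rewrite !in_itv/= andbT => /andP[+ _]; exact: le_trans. Qed.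

Lemma reg_integrable c f a b : reg c f -> c <= a ->
  mu.-integrable `[a, b] (EFin \o f).
Proof.
move=> [mf bf] ca; have [C hC] := bf b.
apply: measurable_bounded_integrable => //.
- rewrite /= lebesgue_measure_itv/=; case: ifP => // _; by rewrite -EFinB ltry.
- exact: (measurable_funS _ (itv_sub_ray ca) mf).
- exists C; split; first exact: num_real.
  move=> M CM x /=; rewrite in_itv/= => /andP[ax xb].
  by apply: (le_trans (hC x (le_trans ca ax) xb)); exact: ltW.
Qed.

Lemma reg_weak c c' f : c <= c' -> reg c f -> reg c' f.
Proof.
move=> cc [mf bf]; split.
  apply: (measurable_funS _ _ mf) => // x /=; rewrite !in_itv/= !andbT.
  exact: le_trans.
by move=> b; have [C hC] := bf b; exists C => t ct; apply: hC; exact: le_trans ct.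
Qed.

Lemma reg_ext c f h : (forall t, c <= t -> f t = h t) -> reg c f -> reg c h.
Proof.
move=> e [mf bf]; split.
  apply: eq_measurable_fun mf => x; rewrite inE/= in_itv/= andbT; exact: e.
move=> b; have [C hC] := bf b; exists C => t ct tb; rewrite -e//; exact: hC.
Qed.

Lemma reg_cst c k : reg c (fun=> k).
Proof. by split; [exact: measurable_cst|move=> b; exists `|k|]. Qed.

Lemma regD c f h : reg c f -> reg c h -> reg c (fun t => f t + h t).
Proof.
move=> [mf bf] [mh bh]; split; first exact: measurable_funD.
move=> b; have [C hC] := bf b; have [D hD] := bh b; exists (C + D) => t ct tb.
by apply: (le_trans (ler_normD _ _)); rewrite lerD ?hC ?hD.
Qed.

Lemma regM c f h : reg c f -> reg c h -> reg c (fun t => f t * h t).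
Proof.
move=> [mf bf] [mh bh]; split; first exact: measurable_funM.
move=> b; have [C hC] := bf b; have [D hD] := bh b; exists (C * D) => t ct tb.
by rewrite normrM ler_pM ?hC ?hD.
Qed.

Lemma regZ c k f : reg c f -> reg c (fun t => k * f t).
Proof. by move=> rf; apply: regM => //; exact: reg_cst. Qed.

Lemma regN c f : reg c f -> reg c (fun t => - f t).
Proof.
by move=> /(regZ (-1)) rf; apply: reg_ext rf => t _; rewrite mulN1r.
Qed.

Lemma regB c f h : reg c f -> reg c h -> reg c (fun t => f t - h t).
Proof. by move=> rf /regN rh; exact: regD. Qed.

Lemma reg_sum c (J : finType) (P : pred J) (F : J -> R -> R) :
  (forall i, P i -> reg c (F i)) -> reg c (fun t => \sum_(i | P i) F i t).
Proof.
move=> rF; rewrite -fct_sumE.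
apply: (big_ind (reg c)) => [||i Pi]; [exact: reg_cst|by move=> *; exact: regD|exact: rF].
Qed.

Lemma reg_norm c f : reg c f -> reg c (fun t => `|f t|).
Proof.
move=> [mf bf]; split; first exact: measurableT_comp.
move=> b; have [C hC] := bf b; exists C => t ct tb; rewrite normr_id; exact: hC.
Qed.

Lemma reg_cont c f (phi : R -> R) : continuous phi -> reg c f ->
  reg c (fun t => phi (f t)).
Proof.
move=> cp [mf bf]; split.
  by apply: measurableT_comp => //; exact: continuous_measurable_fun.
move=> b; have [C hC] := bf b.
have /compact_bounded[M [_ hM]] : compact (phi @` `[- C, C]).
  apply: continuous_compact; last exact: segment_compact.
  exact: continuous_subspaceT.
exists (M + 1) => t ct tb; apply: hM; first by rewrite ltrDl.
by exists (f t) => //=; rewrite in_itv/= -ler_norml hC.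
Qed.

Lemma reg_shift c f T : reg c f -> reg (c + T) (fun t => f (t - T)).
Proof.
move=> [mf bf]; split.
  have : measurable_fun ((fun t => t - T) @^-1` `[c, +oo[) (f \o (fun t => t - T)).
    move=> m B mB; rewrite comp_preimage -preimage_setI.
    rewrite -[X in measurable X]setTI.
    by apply: (measurable_funB (@measurable_id _ _ setT) (@measurable_cst _ _ _ _ setT T)) => //; exact: mf.
  rewrite (_ : _ @^-1` _ = `[c + T, +oo[%classic)//.
  by apply/seteqP; split => x /=; rewrite !in_itv/= !andbT lerBrDr.
move=> b; have [C hC] := bf (b - T); exists C => t ct tb.
by apply: hC; [rewrite lerBrDr|rewrite lerB].
Qed.

Lemma itgD c f h a b : reg c f -> reg c h -> c <= a ->
  itg (fun t => f t + h t) a b = itg f a b + itg h a b.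
Proof. by move=> rf rh ca; rewrite /itg RintegralD//; exact: reg_integrable ca. Qed.

Lemma itgZ c k f a b : reg c f -> c <= a ->
  itg (fun t => k * f t) a b = k * itg f a b.
Proof. by move=> rf ca; rewrite /itg RintegralZl//; exact: reg_integrable ca. Qed.

Lemma itgN c f a b : reg c f -> c <= a ->
  itg (fun t => - f t) a b = - itg f a b.
Proof.
move=> rf ca; rewrite -mulN1r -(itgZ _ _ rf ca); apply: eq_Rintegral => x _.
by rewrite mulN1r.
Qed.

Lemma itgB c f h a b : reg c f -> reg c h -> c <= a ->
  itg (fun t => f t - h t) a b = itg f a b - itg h a b.
Proof. by move=> rf rh ca; rewrite /itg RintegralB//; exact: reg_integrable ca. Qed.

Lemma itg0 a b : itg (fun=> 0) a b = 0.
Proof. by rewrite /itg Rintegral_cst// mul0r. Qed.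

Lemma itg_cst k a b : a <= b -> itg (fun=> k) a b = k * (b - a).
Proof.
move=> ab; rewrite /itg Rintegral_cst//= lebesgue_measure_itv/= lte_fin.
by move: ab; rewrite le_eqVlt => /predU1P[->|ab]; rewrite ?ltxx ?subrr ?ab /= ?mulr0 ?mulr1 // mulr0 .
Qed.

Lemma itg_sum c (J : finType) (P : pred J) (F : J -> R -> R) a b :
  (forall i, P i -> reg c (F i)) -> c <= a ->
  itg (fun t => \sum_(i | P i) F i t) a b = \sum_(i | P i) itg (F i) a b.
Proof.
move=> rF ca; rewrite -fct_sumE.
suff [] : reg c (\sum_(i | P i) F i) /\
    itg (\sum_(i | P i) F i) a b = \sum_(i | P i) itg (F i) a b by [].
apply: (big_rec2 (fun f s => reg c f /\ itg f a b = s)) => [|i f s Pi [rf <-]].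
  by split; [exact: reg_cst|exact: itg0].
by split; [exact: regD (rF _ _) rf|exact: itgD (rF _ _) rf _].
Qed.

Lemma itg_ext f h a b : (forall t, a <= t -> t <= b -> f t = h t) ->
  itg f a b = itg h a b.
Proof.
by move=> e; apply: eq_Rintegral => x; rewrite inE/= in_itv/= => /andP[]; exact: e.
Qed.

Lemma itg_le c f h a b : reg c f -> reg c h -> c <= a ->
  (forall t, a <= t -> t <= b -> f t <= h t) -> itg f a b <= itg h a b.
Proof.
move=> rf rh ca le; apply: le_Rintegral => //; try exact: reg_integrable ca.
by move=> x /=; rewrite in_itv/= => /andP[]; exact: le.
Qed.

Lemma itg_ge0 f a b : (forall t, a <= t -> t <= b -> 0 <= f t) -> 0 <= itg f a b.
Proof.
by move=> f0; apply: Rintegral_ge0 => x /=; rewrite in_itv/= => /andP[]; exact: f0.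
Qed.

Lemma itg_norm c f a b : reg c f -> c <= a ->
  `|itg f a b| <= itg (fun t => `|f t|) a b.
Proof. by move=> rf ca; apply: le_normr_Rintegral => //; exact: reg_integrable ca. Qed.

Lemma itg_bound c f a b C : reg c f -> c <= a -> a <= b ->
  (forall t, a <= t -> t <= b -> `|f t| <= C) -> `|itg f a b| <= C * (b - a).
Proof.
move=> rf ca ab hC; apply: (le_trans (itg_norm _ rf ca)).
by rewrite -itg_cst//; apply: itg_le ca hC; [exact: reg_norm|exact: reg_cst].
Qed.

Lemma integrable_itg_cat f a b d : mu.-integrable `[a, d] (EFin \o f) ->
  a <= b -> b <= d -> itg f a d = itg f a b + itg f b d.
Proof.
move=> rf ab bd.
rewrite /itg -[in RHS](@Rintegral_itv_obnd_cbnd _ b); last first.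
  apply: integrableS rf => // x /=; rewrite !in_itv/= => /andP[bx ->]; rewrite andbT; apply: (le_trans ab); exact: ltW.
rewrite -(@Rintegral_itvB _ f (BLeft a) (BRight d) b) ?bnd_simp //.
by rewrite addrC subrK.
Qed.

Lemma itg_cat c f a b d : reg c f -> c <= a -> a <= b -> b <= d ->
  itg f a d = itg f a b + itg f b d.
Proof. by move=> rf ca; apply: integrable_itg_cat; exact: reg_integrable ca. Qed.

Lemma itgxx f a : itg f a a = 0.
Proof. by rewrite /itg set_itv1 Rintegral_set1. Qed.

Lemma lebesgue_measure_shift (T : R) (A : set R) : measurable A ->
  pushforward mu ((fun t => t - T) : _ -> measurableTypeR R) A = mu A.
Proof.
move=> mA; have mT : measurable_fun [set: measurableTypeR R] (fun t : R => t - T).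
  by apply: measurable_funB.
apply/esym/(@lebesgue_measure_unique R
  (pushforward mu ((fun t => t - T) : _ -> measurableTypeR R))) => //= _ [[a b]] _ <-.
rewrite /pushforward/=.
rewrite (_ : (fun t => t - T) @^-1` `]a, b] = `]a + T, b + T]%classic); last first.
  by apply/seteqP; split => x /=; rewrite !in_itv/= ltrBrDr lerBlDr.
rewrite !lebesgue_measure_itv/= !lte_fin ltrD2r.
by case: ifP => // _; congr (_%:E); rewrite /=; lra.
Qed.

Lemma itg_shift c f T a b : reg c f -> c <= a ->
  itg (fun t => f (t - T)) (a + T) (b + T) = itg f a b.
Proof.
move=> rf ca; rewrite /itg; congr fine.
have fi := reg_integrable b rf ca.
(* Extension by zero: the change of variables needs an integrand measurable on the whole line, while
   [f] is controlled only from [c] on. *)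
pose g := (EFin \o f) \_ `[a, b].
have gE x : a <= x <= b -> g x = (f x)%:E by move=> h; rewrite /g/= patchE mem_setE in_itv/= h.
pose sh : measurableTypeR R -> measurableTypeR R := fun t : R => t - T.
have mg : measurable_fun [set: measurableTypeR R] g.
  by apply/(measurable_restrictT _ _).1 => //; exact: (measurable_int mu).
have mT : measurable_fun [set: measurableTypeR R] sh by apply: measurable_funB.
have ES : (fun t => t - T) @^-1` `[a, b] = `[a + T, b + T]%classic.
  by apply/seteqP; split => x /=; rewrite !in_itv/= lerBrDr lerBlDr.
have rs := reg_shift T rf.
have shi := reg_integrable (b + T) rs (_ : c + T <= a + T).
rewrite lerD2r in shi.
transitivity (\int[pushforward mu sh]_(y in `[a, b]) g y)%E.
  rewrite (@integral_pushforward _ _ _ _ _ sh mT mu _ _ mg) //=.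
    rewrite ES; apply: eq_integral => x; rewrite inE/= in_itv/= => h.
    by rewrite gE// lerBrDr lerBlDr.
  rewrite ES; move: (shi ca); apply: eq_integrable => //= x; rewrite inE/= in_itv/= => h.
  by rewrite gE// lerBrDr lerBlDr.
transitivity (\int[mu]_(x in `[a, b]) g x)%E.
  by apply: eq_measure_integral => A mA _; exact: lebesgue_measure_shift.
by apply: eq_integral => x; rewrite inE/= in_itv/=; exact: gE.
Qed.

End Integration.

(** * Caratheodory primitives and their calculus *)

Section Primitives.
Context {R : realType}.
Implicit Types (f h F G x : R -> R) (a b c t : R).

(** Stronger than [solves]: a regular derivative makes [F] locally Lipschitz, hence regular in turn,
    so that products and compositions stay in the class. *)
Definition prim F f := reg 0 f /\ forall t, 0 <= t -> F t = F 0 + itg f 0 t.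

Lemma prim_itg F f a b : prim F f -> 0 <= a -> a <= b -> F b - F a = itg f a b.
Proof.
move=> [rf eF] a0 ab; rewrite (eF b) ?(le_trans a0)// (eF a)//.
by rewrite (itg_cat rf (lexx 0) a0 ab); ring.
Qed.

Lemma prim_lip F f B : prim F f -> exists2 C, 0 <= C &
  forall a b, 0 <= a -> a <= b -> b <= B -> `|F b - F a| <= C * (b - a).
Proof.
move=> pF; have [rf _] := pF; have [C hC] := rf.2 B.
exists `|C| => // a b a0 ab bB; rewrite (prim_itg pF)//.
apply: (itg_bound rf) => // t ta tb; apply: (le_trans _ (ler_norm C)).
by apply: hC; [exact: le_trans ta|exact: le_trans bB].
Qed.

(** Nothing is known of [F] before time 0. Freezing the argument there gives a function continuous
    on the whole line, fit for measurability and for the intermediate value theorem. *)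
Lemma loclip_continuous F :
  (forall B, exists2 C, 0 <= C &
    forall a b, 0 <= a -> a <= b -> b <= B -> `|F b - F a| <= C * (b - a)) ->
  continuous (fun t => F (Num.max 0 t)).
Proof.
move=> lipF t; have [C C0 hC] := lipF (`|t| + 1).
have hC' u v : 0 <= u -> 0 <= v -> u <= `|t| + 1 -> v <= `|t| + 1 ->
    `|F u - F v| <= C * `|u - v|.
  move=> u0 v0 uB vB; case: (leP u v) => [uv|/ltW vu].
    by rewrite distrC (le_trans (hC _ _ _ uv _))// distrC ger0_norm// subr_ge0.
  by rewrite (le_trans (hC _ _ _ vu _))// ger0_norm// subr_ge0.
apply/cvgrPdist_le => e e0.
have d0 : 0 < Num.min 1 (e / (C + 1)) by rewrite lt_min ltr01 divr_gt0// ltr_wpDl.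
near=> s.
have : `|t - s| < Num.min 1 (e / (C + 1)).
  by near: s; exact: cvgr_dist_lt.
rewrite lt_min => /andP[ts1 tse].
have tB : Num.max 0 t <= `|t| + 1.
  by rewrite ge_max addr_ge0//= (le_trans (ler_norm t))// lerDl.
have sB : Num.max 0 s <= `|t| + 1.
  rewrite ge_max addr_ge0//=.
  have := ler_norm t; move: ts1; rewrite ltr_norml => /andP[]; lra.
apply: (le_trans (hC' _ _ _ _ tB sB)); rewrite ?le_max ?lexx//.
have le1 : `|Num.max 0 t - Num.max 0 s| <= `|t - s|.
  rewrite /Num.max; case: ifPn; case: ifPn => // h1 h2.
  - rewrite subr0 ger0_norm ?(ltW h2)//; apply: le_trans (ler_norm _); lra.
  - rewrite sub0r normrN ger0_norm ?(ltW h1)// distrC; apply: le_trans (ler_norm _); lra.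
  - by rewrite subrr normr0.
apply: (@le_trans _ _ (C * (e / (C + 1)))).
  by apply: ler_wpM2l => //; apply: (le_trans le1); exact: ltW.
by rewrite mulrA ler_pdivrMr ?ltr_wpDl// mulrC ler_pM2l// lerDl.
Unshelve. all: by end_near.
Qed.

Lemma loclip_reg F :
  (forall B, exists2 C, 0 <= C &
    forall a b, 0 <= a -> a <= b -> b <= B -> `|F b - F a| <= C * (b - a)) ->
  reg 0 F.
Proof.
move=> lipF; have cF := loclip_continuous lipF.
apply: (@reg_ext _ _ (fun t => F (Num.max 0 t))).
  by move=> t t0; rewrite max_r.
apply: (reg_cont cF (f := idfun)); split; first exact: measurable_id.
by move=> b; exists b => t t0 tb; rewrite ger0_norm.
Qed.

Lemma prim_reg F f : prim F f -> reg 0 F.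
Proof. by move=> pF; apply: loclip_reg => B; exact: prim_lip pF. Qed.

Lemma prim_ext F f G h : (forall t, 0 <= t -> F t = G t) ->
  (forall t, 0 <= t -> f t = h t) -> prim F f -> prim G h.
Proof.
move=> eF ef [rf hF]; split; first exact: reg_ext rf.
move=> t t0; rewrite -eF// hF// eF//; congr (_ + _).
by apply: itg_ext => s s0 _; exact: ef.
Qed.

Lemma primD F f G h : prim F f -> prim G h ->
  prim (fun t => F t + G t) (fun t => f t + h t).
Proof.
move=> [rf eF] [rh eG]; split; first exact: regD.
by move=> t t0; rewrite eF// eG// (itgD _ rf rh)//; ring.
Qed.

Lemma primZ k F f : prim F f -> prim (fun t => k * F t) (fun t => k * f t).
Proof.
move=> [rf eF]; split; first exact: regZ.
by move=> t t0; rewrite eF// (itgZ _ _ rf)//; ring.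
Qed.

Lemma primB F f G h : prim F f -> prim G h ->
  prim (fun t => F t - G t) (fun t => f t - h t).
Proof.
move=> pF /(primZ (-1)) pG; apply: prim_ext (primD pF pG) => t _ /=; ring.
Qed.

Lemma prim_cst k : prim (fun=> k) (fun=> 0).
Proof. by split; [exact: reg_cst|move=> t t0; rewrite itg0 addr0]. Qed.

Lemma prim_sum (J : finType) (P : pred J) (F f : J -> R -> R) :
  (forall i, P i -> prim (F i) (f i)) ->
  prim (fun t => \sum_(i | P i) F i t) (fun t => \sum_(i | P i) f i t).
Proof.
move=> pF; split; first by apply: reg_sum => i /pF[].
move=> t t0; rewrite (itg_sum (c := 0))//; last by move=> i /pF[].
by rewrite -big_split/=; apply: eq_bigr => i /pF[_ ->].
Qed.

(** Cutting the interval into [n.+1] equal steps bounds the total increment by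
    [K * B ^+ 2 / n.+1%:R], which vanishes as n grows. *)
Lemma quad_const G K B : 0 <= B ->
  (forall a b, 0 <= a -> a <= b -> b <= B -> `|G b - G a| <= K * (b - a) ^+ 2) ->
  G B = G 0.
Proof.
move=> B0 hG.
have step (n : nat) : `|G B - G 0| <= K * B ^+ 2 / n.+1%:R.
  pose d := B / n.+1%:R.
  have d0 : 0 <= d by rewrite divr_ge0.
  have dB : n.+1%:R * d = B by rewrite /d mulrC divfK.
  have main k : (k <= n.+1)%N -> `|G (k%:R * d) - G 0| <= k%:R * (K * d ^+ 2).
    elim: k => [|k IH] kn; first by rewrite !mul0r subrr normr0.
    have kd : k.+1%:R * d = k%:R * d + d by rewrite -natr1; ring.
    have kB : k.+1%:R * d <= B by rewrite -dB ler_wpM2r// ler_nat.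
    have h : `|G (k.+1%:R * d) - G (k%:R * d)| <= K * d ^+ 2.
      have := hG (k%:R * d) (k.+1%:R * d); rewrite (_ : k.+1%:R * d - k%:R * d = d); last by rewrite kd addrC addKr.
      by apply => //; [rewrite mulr_ge0|rewrite kd lerDl].
    rewrite (_ : _ - G 0 = (G (k.+1%:R * d) - G (k%:R * d)) + (G (k%:R * d) - G 0)); last by ring.
    apply: (le_trans (ler_normD _ _)).
    have := lerD h (IH (ltnW kn)); move/le_trans; apply.
    by rewrite -natr1; lra.
  have := main n.+1 (leqnn _); rewrite dB => /le_trans; apply.
  rewrite le_eqVlt; apply/orP; left; apply/eqP; rewrite /d.
  have : n.+1%:R != 0 :> R by rewrite pnatr_eq0.
  by set N := n.+1%:R => N0; field.
apply/eqP; rewrite -subr_eq0 -normr_eq0; apply/eqP/le_anti; rewrite normr_ge0 andbT.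
apply/ler_addgt0Pr => e e0; rewrite add0r.
pose n := Num.bound (`|K * B ^+ 2| / e).
have : `|K * B ^+ 2| / e < n.+1%:R.
  apply: (lt_le_trans (archi_boundP _)); first by rewrite divr_ge0// ltW.
  by rewrite ler_nat.
rewrite ltr_pdivrMr// => hn.
apply: (le_trans (step n)); rewrite ler_pdivrMr//.
by rewrite [leRHS]mulrC; apply: (le_trans (ler_norm _)); exact: ltW.
Qed.

(* The increments of [Phi (x t)] and of the integral agree up to a multiple of
   the square of the step, hence exactly. *)
Lemma prim_chain x f (Phi phi : R -> R) K : prim x f -> 0 <= K ->
  (forall a b, `|Phi b - Phi a - phi a * (b - a)| <= K * (b - a) ^+ 2) ->
  (forall a b, `|phi b - phi a| <= K * `|b - a|) ->
  prim (fun t => Phi (x t)) (fun t => phi (x t) * f t).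
Proof.
move=> px K0 hPhi hphi; have [rf _] := px.
have rx := prim_reg px.
have cphi : continuous phi.
  move=> u; apply/cvgrPdist_le => e e0; near=> s.
  apply: (le_trans (hphi _ _)).
  have : `|u - s| < e / (K + 1).
    by near: s; apply: cvgr_dist_lt => //; rewrite divr_gt0// ltr_wpDl.
  rewrite ltr_pdivlMr ?ltr_wpDl// => h.
  have := normr_ge0 (u - s); nra.
have rphi := reg_cont cphi rx.
have rp : reg 0 (fun t => phi (x t) * f t) by exact: regM.
split => // t t0.
suff : Phi (x t) - itg (fun t => phi (x t) * f t) 0 t =
   Phi (x 0) - itg (fun t => phi (x t) * f t) 0 0.
  by rewrite itgxx subr0 => <-; rewrite subrK.
have [C hC] := rf.2 t; have [L L0 hL] := prim_lip t px.
apply: (@quad_const (fun t => Phi (x t) - itg (fun t => phi (x t) * f t) 0 t)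
  (K * L ^+ 2 + K * L * `|C|) _ t0) => a b a0 ab bt.
have b0 : 0 <= b by exact: le_trans ab.
have -> : Phi (x b) - itg (fun t => phi (x t) * f t) 0 b -
   (Phi (x a) - itg (fun t => phi (x t) * f t) 0 a) =
   (Phi (x b) - Phi (x a) - phi (x a) * (x b - x a))
   - itg (fun s => phi (x s) * f s - phi (x a) * f s) a b.
  rewrite (itgB _ rp (regZ _ rf))// (itgZ _ _ rf)// -(prim_itg px)//.
  by rewrite (itg_cat rp (lexx 0) a0 ab); ring.
apply: (le_trans (ler_normB _ _)); rewrite [leRHS]mulrDl; apply: lerD.
  apply: (le_trans (hPhi _ _)); rewrite -mulrA; apply: ler_wpM2l => //.
  rewrite -exprMn -real_normK ?num_real//.
  by rewrite lerXn2r ?nnegrE ?mulr_ge0 ?subr_ge0// hL.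
rewrite expr2 mulrA; apply: (@itg_bound R 0) => //.
  by apply: regB => //; exact: regZ.
move=> s sa sb; rewrite -mulrBl normrM.
have Cs : `|f s| <= `|C|.
  apply: (le_trans _ (ler_norm C)); apply: hC; first exact: le_trans sa.
  exact: le_trans bt.
rewrite [leRHS](_ : _ = K * (L * (b - a)) * `|C|); last by ring.
apply: ler_pM => //; apply: (le_trans (hphi _ _)); apply: ler_wpM2l => //.
apply: (le_trans (hL _ _ a0 sa (le_trans sb bt))); apply: ler_wpM2l => //.
by rewrite lerB.
Unshelve. all: by end_near.
Qed.

Lemma prim_sqr x f : prim x f -> prim (fun t => x t ^+ 2 / 2) (fun t => x t * f t).
Proof.
move=> px; apply: (@prim_chain x f (fun u => u ^+ 2 / 2) id 1 px) => // a b.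
  rewrite mul1r (_ : _ - _ - _ = (b - a) ^+ 2 / 2); last by field.
  have := sqr_ge0 (b - a); set q := _ ^+ 2 => q0.
  by rewrite ger0_norm; lra.
by rewrite mul1r.
Qed.

Lemma solves_itg x f a b : solves x f -> 0 <= a -> a <= b ->
  x b - x a = itg f a b.
Proof.
move=> sx a0 ab; have [ia ea] := sx _ a0; have [ib eb] := sx b (le_trans a0 ab).
rewrite ea eb -!/(itg f _ _) (integrable_itg_cat ib a0 ab); ring.
Qed.

Definition locbdd f := forall b, exists C : R, forall t, 0 <= t -> t <= b -> `|f t| <= C.

Lemma solves_locbdd x f : solves x f -> locbdd x.
Proof.
move=> sx b; exists (`|x 0| + itg (fun t => `|f t|) 0 `|b|) => t t0 tb.
have [it ->] := sx _ t0; have [ib _] := sx _ (normr_ge0 b).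
apply: (le_trans (ler_normD _ _)); rewrite lerD2l.
apply: (le_trans (le_normr_Rintegral _ it)) => //.
rewrite -!/(itg (fun t => `|f t|) _ _).
have tb' : t <= `|b| by rewrite (le_trans tb)// ler_norm.
rewrite (@integrable_itg_cat _ _ 0 t `|b|)// ?lerDl ?itg_ge0//.
exact: integrable_norm.
Qed.

(** Measurability on the ray is glued from the intervals [[0, k]]; local boundedness is what
    integrability on each interval cannot provide. *)
Lemma solves_prim x f : solves x f -> locbdd f -> prim x f.
Proof.
move=> sx bf; split; last by move=> t t0; have [_ ->] := sx _ t0.
split; last exact: bf.
have -> : (`[0, +oo[%classic : set R) = \bigcup_(k : nat) `[0, k%:R]%classic.
  apply/seteqP; split => t /=; rewrite in_itv/= ?andbT.
    move=> t0; exists (Num.bound t) => //=; rewrite in_itv/= t0/= ltW//.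
    exact: archi_boundP.
  by move=> [k _] /=; rewrite in_itv/= => /andP[].
apply/measurable_fun_bigcup => // k.
have [ik _] := sx k%:R (ler0n _ _).
by apply/measurable_EFinP; exact: (measurable_int (@lebesgue_measure R)).
Qed.

Lemma solves_cst (x0 f0 : R) : solves (fun=> x0) (fun=> f0) -> f0 = 0.
Proof.
move=> sx; have := solves_itg sx (lexx 0) ler01.
by rewrite itg_cst// subrr subr0 mulr1.
Qed.

Lemma cst_solves (x0 : R) f : (forall t, 0 <= t -> f t = 0) -> solves (fun=> x0) f.
Proof.
move=> f0 t t0; split.
  apply: reg_integrable (lexx 0); apply: reg_ext (reg_cst 0 0) => s s0.
  by rewrite f0.
rewrite -/(itg f 0 t) (@itg_ext _ f (fun=> 0)) ?itg0 ?addr0// => s s0 _.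
exact: f0.
Qed.

End Primitives.

(** * Asymptotics *)

Section Asymptotics.
Context {R : realType}.
Implicit Types (f h F x : R -> R) (P Q : R -> Prop) (a b c t l : R).

Definition ev P := exists2 t0 : R, 0 <= t0 & forall t : R, t0 <= t -> P t.

Lemma evW P Q : (forall t, 0 <= t -> P t -> Q t) -> ev P -> ev Q.
Proof.
move=> PQ [t0 t00 h]; exists t0 => // t tt; apply: PQ; last exact: h.
exact: le_trans tt.
Qed.

Lemma evT P : (forall t, 0 <= t -> P t) -> ev P.
Proof. by move=> h; exists 0. Qed.

Lemma evI P Q : ev P -> ev Q -> ev (fun t => P t /\ Q t).
Proof.
move=> [t0 h0 hP] [t1 h1 hQ]; exists (Num.max t0 t1); first by rewrite le_max h0.
by move=> t; rewrite ge_max => /andP[? ?]; split; [exact: hP|exact: hQ].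
Qed.

Lemma ev_all (J : finType) (P : J -> R -> Prop) :
  (forall i, ev (P i)) -> ev (fun t => forall i, P i t).
Proof.
move=> h.
suff : ev (fun t => forall i, i \in enum J -> P i t).
  by apply: evW => t _ H i; apply: H; rewrite mem_enum.
elim: (enum J) => [|i s IH]; first exact: evT.
apply: evW (evI (h i) IH) => t _ [Pi Ps] k; rewrite inE => /predU1P[->//|]; exact: Ps.
Qed.

Lemma ev_back P T : ev P -> ev (fun t => forall s, t - T <= s -> P s).
Proof.
move=> [t0 h0 hP]; exists (Num.max 0 (t0 + T)); first by rewrite le_max lexx.
move=> t; rewrite ge_max => /andP[_ tt] s ts; apply: hP; lra.
Qed.

Lemma ev_fwd P : ev P -> ev (fun t => forall s, t <= s -> P s).
Proof.
by move=> [t0 h0 hP]; exists t0 => // t tt s ts; apply: hP; exact: le_trans ts.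
Qed.

Definition tends f l := forall e : R, 0 < e -> ev (fun t => `|f t - l| <= e).

Lemma tends_cvg f l : tends f l -> f t @[t --> +oo] --> l.
Proof.
move=> h; apply/cvgrPdist_le => e e0; have [t0 t00 ht] := h _ e0.
near=> t; rewrite distrC; apply: ht; near: t; exact: nbhs_pinfty_ge (num_real _).
Unshelve. all: by end_near.
Qed.

Lemma tends_ext f h l : (forall t, 0 <= t -> f t = h t) -> tends f l -> tends h l.
Proof. by move=> e hf d d0; apply: evW (hf d d0) => t t0; rewrite e. Qed.

Lemma tends_cst l : tends (fun=> l) l.
Proof. by move=> e e0; apply: evT => t _; rewrite subrr normr0 ltW. Qed.

Lemma tendsD f h l k : tends f l -> tends h k -> tends (fun t => f t + h t) (l + k).
Proof.
move=> hf hh e e0; have e2 : 0 < e / 2 by rewrite divr_gt0.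
apply: evW (evI (hf _ e2) (hh _ e2)) => t _ [h1 h2].
rewrite opprD addrACA [leRHS](splitr e).
by apply: (le_trans (ler_normD _ _)); exact: lerD.
Qed.

Lemma tendsZ k f l : tends f l -> tends (fun t => k * f t) (k * l).
Proof.
move=> hf e e0; have d0 : 0 < e / (`|k| + 1) by rewrite divr_gt0// ltr_wpDl.
apply: evW (hf _ d0) => t _; rewrite -mulrBr normrM ler_pdivlMr ?ltr_wpDl// => h.
have := normr_ge0 (f t - l); nra.
Qed.

Lemma tendsB f h l k : tends f l -> tends h k -> tends (fun t => f t - h t) (l - k).
Proof.
move=> hf /(tendsZ (-1)) hh; rewrite -(mulN1r k).
by apply: tends_ext (tendsD hf hh) => t _; rewrite mulN1r.
Qed.

Lemma tends_sum (J : finType) (P : pred J) (F : J -> R -> R) (L : J -> R) :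
  (forall i, P i -> tends (F i) (L i)) ->
  tends (fun t => \sum_(i | P i) F i t) (\sum_(i | P i) L i).
Proof.
move=> hF; rewrite -fct_sumE.
apply: (big_rec2 (fun f l => tends f l)) => [|i f s Pi h].
  exact: tends_cst.
by apply: (@tendsD (F i) f) => //; exact: hF.
Qed.

Lemma tends_cont f l (phi : R -> R) : {for l, continuous phi} -> tends f l ->
  tends (fun t => phi (f t)) (phi l).
Proof.
move=> /cvgrPdist_le cp hf e e0; have /nbhs_ballP[d /= d0 hd] := cp _ e0.
have d2 : 0 < d / 2 by rewrite divr_gt0.
apply: evW (hf _ d2) => t _ h; rewrite distrC; apply: hd.
by rewrite /ball/= distrC (le_lt_trans h)// ltr_pdivrMr// ltr_pMr// ltr1n.
Qed.

Lemma tends_uniq f l k : tends f l -> tends f k -> l = k.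
Proof.
move=> h1 h2; apply/eqP; rewrite -subr_eq0 -normr_eq0; apply/eqP/le_anti.
rewrite normr_ge0 andbT; apply/ler_addgt0Pr => e e0; rewrite add0r.
have e2 : 0 < e / 2 by rewrite divr_gt0.
have [t t0 /(_ t (lexx _))[a1 a2]] := evI (h1 _ e2) (h2 _ e2).
rewrite (_ : l - k = - (f t - l) + (f t - k)); last by ring.
by apply: (le_trans (ler_normD _ _)); rewrite normrN [leRHS](splitr e) lerD.
Qed.

Lemma tends_shift f l : tends (fun t => f t - l) 0 -> tends f l.
Proof. by move=> h e e0; apply: evW (h e e0) => t _; rewrite subr0. Qed.

Lemma tends_cauchy f :
  (forall e : R, 0 < e -> ev (fun t => forall s : R, t <= s -> `|f s - f t| <= e)) ->
  exists l, tends f l.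
Proof.
move=> h.
have cf : cvg (f t @[t --> +oo]).
  apply/cauchy_cvgP/cauchyP => e e0.
  have e2 : 0 < e / 2 by rewrite divr_gt0.
  have [t0 t00 ht] := h _ e2; exists (f t0) => /=.
  near=> t; rewrite /= /ball/= distrC.
  apply: (@le_lt_trans _ _ (e / 2)); last by rewrite ltr_pdivrMr// ltr_pMr// ltr1n.
  apply: ht => //; near: t; exact: nbhs_pinfty_ge (num_real _).
exists (lim (f t @[t --> +oo])) => e e0.
have e2 : 0 < e / 2 by rewrite divr_gt0.
apply: evW (h _ e2) => t t0 ht.
move: cf => /cvgrPdist_le /(_ _ e2) [M [_ hM]].
pose s := Num.max t (M + 1).
have h1 : `|lim (f t @[t --> +oo]) - f s| <= e / 2.
  by apply: hM; rewrite lt_max ltrDl ltr01 orbT.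
have h2 : `|f s - f t| <= e / 2 by apply: ht; rewrite le_max lexx.
rewrite distrC (_ : _ - f t = (lim (f t @[t --> +oo]) - f s) + (f s - f t)); last by ring.
by rewrite [leRHS](splitr e); apply: (le_trans (ler_normD _ _)); exact: lerD.
Unshelve. all: by end_near.
Qed.

(** Slowly varying functions, such as log (1 + t). They need not converge, but over a window of
    fixed length they may be replaced by their initial value. *)
Definition slow f := forall H e : R, 0 < e ->
  ev (fun t => forall s : R, t <= s -> s <= t + H -> `|f s - f t| <= e).

Lemma tends_slow f l : tends f l -> slow f.
Proof.
move=> hf H e e0; have e2 : 0 < e / 2 by rewrite divr_gt0.
apply: evW (ev_fwd (hf _ e2)) => t _ h s ts _.
rewrite (_ : f s - f t = (f s - l) - (f t - l)); last by ring.
by rewrite [leRHS](splitr e); apply: (le_trans (ler_normB _ _)); rewrite lerD// h.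
Qed.

Lemma slow_cst l : slow (fun=> l).
Proof. exact: tends_slow (tends_cst l). Qed.

Lemma slowD f h : slow f -> slow h -> slow (fun t => f t + h t).
Proof.
move=> hf hh H e e0; have e2 : 0 < e / 2 by rewrite divr_gt0.
apply: evW (evI (hf H _ e2) (hh H _ e2)) => t _ [h1 h2] s ts sH.
rewrite opprD addrACA [leRHS](splitr e).
by apply: (le_trans (ler_normD _ _)); rewrite lerD ?h1 ?h2.
Qed.

Lemma slow_lip f (phi : R -> R) K : (forall a b, `|phi b - phi a| <= K * `|b - a|) ->
  slow f -> slow (fun t => phi (f t)).
Proof.
move=> hK hf H e e0; have d0 : 0 < e / (`|K| + 1) by rewrite divr_gt0// ltr_wpDl.
apply: evW (hf H _ d0) => t _ h s ts sH; apply: (le_trans (hK _ _)).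
have := h s ts sH; rewrite ler_pdivlMr ?ltr_wpDl// => h1.
have := normr_ge0 (f s - f t); have := ler_norm K; nra.
Qed.

Lemma slowZ k f : slow f -> slow (fun t => k * f t).
Proof. by apply: (@slow_lip _ _ `|k|) => a b; rewrite -mulrBr normrM. Qed.

Lemma slowB f h : slow f -> slow h -> slow (fun t => f t - h t).
Proof.
move=> sf /(slowZ (-1)) sh; have := slowD sf sh.
by rewrite [X in slow X -> _](_ : _ = fun t => f t - h t)//; apply/funext => t; rewrite mulN1r.
Qed.

Lemma slow_ext f h : (forall t, 0 <= t -> f t = h t) -> slow f -> slow h.
Proof.
move=> e sf H d d0; apply: evW (sf H d d0) => t t0 h1 s ts sH.
by rewrite -!e// ?h1// (le_trans t0).
Qed.

Lemma slow_sum (J : finType) (P : pred J) (F : J -> R -> R) :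
  (forall i, P i -> slow (F i)) -> slow (fun t => \sum_(i | P i) F i t).
Proof.
move=> sF; rewrite -fct_sumE.
by apply: (big_ind slow) => [||//]; [exact: slow_cst|move=> *; exact: slowD].
Qed.

Lemma tends0_scaled f (C : R) : (forall H, 0 < H -> ev (fun t => `|H * f t| <= C)) ->
  tends f 0.
Proof.
move=> h e e0.
have C0 : 0 < `|C| + 1 by rewrite ltr_wpDl.
have H0 : 0 < (`|C| + 1) / e by rewrite divr_gt0.
apply: evW (h _ H0) => t _; rewrite subr0 normrM (gtr0_norm H0) => h1.
have h2 : (`|C| + 1) / e * `|f t| <= `|C| + 1.
  by apply: (le_trans h1); apply: (le_trans (ler_norm _)); rewrite lerDl.
by move: h2; rewrite mulrAC ler_pdivrMr// ler_pM2l.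
Qed.

Lemma slow_itg f H e : reg 0 f -> slow f -> 0 <= H -> 0 < e ->
  ev (fun t => `|itg f t (t + H) - H * f t| <= e).
Proof.
move=> rf sf H0 e0; have d0 : 0 < e / (H + 1) by rewrite divr_gt0// ltr_wpDl.
apply: evW (sf H _ d0) => t t0 h.
have tH : t <= t + H by rewrite lerDl.
have -> : itg f t (t + H) - H * f t = itg (fun s => f s - f t) t (t + H).
  by rewrite (itgB _ rf (reg_cst 0 _))// itg_cst// addrAC subrr add0r mulrC.
apply: (@le_trans _ _ (e / (H + 1) * (t + H - t))).
  by apply: (@itg_bound _ 0) => //; apply: regB => //; exact: reg_cst.
rewrite addrAC subrr add0r mulrAC ler_pdivrMr ?ltr_wpDl//.
by rewrite ler_pM2l// lerDl.
Qed.

(** Over a unit window a slow derivative is nearly constant, so its value is nearly the increment of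
    [F], which is small. This needs no bound on the variation of [f] at small scales. *)
Lemma prim_slow_tends0 F f : prim F f -> slow F -> slow f -> tends f 0.
Proof.
move=> pF sF sf e e0; have e2 : 0 < e / 2 by rewrite divr_gt0.
have [rf _] := pF.
apply: evW (evI (sF 1 _ e2) (slow_itg rf sf ler01 e2)) => t t0 [h1].
have t1 : t <= t + 1 by rewrite lerDl.
have := h1 _ t1 (lexx _); rewrite (prim_itg pF)// mul1r subr0 => h2 h3.
rewrite (_ : f t = itg f t (t + 1) - (itg f t (t + 1) - f t)); last by ring.
by rewrite [leRHS](splitr e); apply: (le_trans (ler_normB _ _)); exact: lerD.
Qed.

Definition unicont f := forall e : R, 0 < e -> exists2 d : R, 0 < d &
  forall s t : R, 0 <= s -> s <= t -> t <= s + d -> `|f t - f s| <= e.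

Lemma unicont_lip f C : (forall a b, 0 <= a -> a <= b -> `|f b - f a| <= C * (b - a)) ->
  unicont f.
Proof.
move=> hC e e0; have C1 : 0 < `|C| + 1 by rewrite ltr_wpDl.
exists (e / (`|C| + 1)) => [|s t s0 st td]; first by rewrite divr_gt0.
apply: (le_trans (hC _ _ s0 st)).
have : t - s <= e / (`|C| + 1) by lra.
rewrite ler_pdivlMr// => h; have := ler_norm C; have : 0 <= t - s by lra.
nra.
Qed.

Lemma prim_unicont F f C : prim F f -> (forall t, 0 <= t -> `|f t| <= C) -> unicont F.
Proof.
move=> pF hC; apply: (@unicont_lip _ C) => a b a0 ab.
rewrite (prim_itg pF)//; have [rf _] := pF.
by apply: (itg_bound rf) => // t ta _; apply: hC; exact: le_trans ta.
Qed.

(** Were [|f|] at least [e] at a late time, uniform continuity would keep it above [e / 2] for a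
    duration [d], and the integral of [psi] would grow by [m * d], more than its tail allows.
    Splitting [f] from [psi] lets one dissipation serve several variables. *)
Lemma barbalat f psi C : reg 0 psi -> (forall t, 0 <= t -> 0 <= psi t) ->
  (forall t, 0 <= t -> itg psi 0 t <= C) -> unicont f ->
  (forall e : R, 0 < e -> exists2 m : R, 0 < m & forall t, 0 <= t -> e <= `|f t| -> m <= psi t) ->
  tends f 0.
Proof.
move=> rpsi psi0 hC uf hm e e0.
have e2 : 0 < e / 2 by rewrite divr_gt0.
have [d d0 hd] := uf _ e2; have [m m0 hm'] := hm _ e2.
pose S : set R := [set itg psi 0 t | t in [set t | 0 <= t]].
have supS : has_sup S.
  split; first by exists (itg psi 0 0), 0 => /=.
  by exists C => _ [t /= t0 <-]; exact: hC.
have md : 0 < m * d by exact: mulr_gt0.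
have [_ [t0 /= t00 <-] ht0] := sup_adherent md supS.
exists t0 => // t tt; rewrite subr0 leNgt; apply/negP => ft.
have t0' : 0 <= t by exact: le_trans tt.
have td : t <= t + d by rewrite lerDl ltW.
have h1 : m * d <= itg psi t (t + d).
  rewrite -[X in m * X](addrK t) [d + t]addrC -itg_cst//; apply: (itg_le (c := 0)) => //.
    exact: reg_cst.
  move=> s ts sd; apply: hm'; first exact: le_trans ts.
  have := hd _ _ t0' ts sd.
  have := ler_normB (f s) (f s - f t); rewrite subKr; lra.
have h2 : itg psi 0 (t + d) <= sup S.
  by apply: ub_le_sup; [case: supS|exists (t + d) => //=; lra].
have h3 : itg psi 0 t0 <= itg psi 0 t.
  rewrite (itg_cat rpsi (lexx 0) t00 tt) lerDl; apply: itg_ge0 => s s0 _.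
  by apply: psi0; exact: le_trans s0.
have := itg_cat rpsi (lexx 0) t0' td; lra.
Qed.

End Asymptotics.

(** * Convergence of a vector from convergence of linear observables *)

Section Observers.
Context {R : realType} {I K : finType}.
Implicit Types (y z : I -> R) (A : (I -> R) -> R).

Definition linform A := forall a y z, A (fun i => a * y i + z i) = a * A y + A z.

Definition dirac_fun (i : I) : I -> R := fun k => (k == i)%:R.

Lemma linform0 A : linform A -> A (fun=> 0) = 0.
Proof.
move=> lA; have := lA (-1) (fun=> 0) (fun=> 0).
rewrite (_ : (fun _ => _) = (fun _ : I => 0 : R)); last by apply/funext => i; rewrite mulr0 addr0.
by rewrite mulN1r addNr.
Qed.

Lemma linform_sum A y : linform A -> A y = \sum_i y i * A (dirac_fun i).
Proof.
move=> lA.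
have h (s : seq I) : A (fun k => \sum_(i <- s) y i * dirac_fun i k) =
    \sum_(i <- s) y i * A (dirac_fun i).
  elim: s => [|i s IH].
    rewrite big_nil -[RHS](linform0 lA); congr A; apply/funext => k.
    by rewrite big_nil.
  rewrite big_cons -IH -lA; congr A; apply/funext => k.
  by rewrite big_cons.
rewrite -h; congr A; apply/funext => k.
rewrite (bigD1 k)//= /dirac_fun eqxx mulr1 big1 ?addr0// => i ik.
by rewrite eq_sym (negPf ik) mulr0.
Qed.

(** The observables [A k], together with the products against a spanning set of their common kernel,
    determine the vector, because [G] is definite on that kernel. A linear left inverse then
    transfers the limits to the coordinates. *)
Lemma observers_converge (x : R -> I -> R) (A : K -> (I -> R) -> R)
    (G : (I -> R) -> (I -> R) -> R) :
  (forall k, linform (A k)) -> (forall y, linform (G^~ y)) ->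
  (forall y, linform (G y)) ->
  (forall k, exists l, tends (fun t => A k (x t)) l) ->
  (forall y, (forall k, A k y = 0) -> exists l, tends (fun t => G (x t) y) l) ->
  (forall y, (forall k, A k y = 0) -> G y y = 0 -> forall i, y i = 0) ->
  forall i, exists l, tends (fun t => x t i) l.
Proof.
move=> lA lGl lGr cA cG pG.
have sumE (F : I -> R) : \sum_i F i = \sum_(j < #|I|) F (enum_val j).
  by rewrite (reindex (@enum_val I I))//; exact: onW_bij (enum_val_bij I).
pose vec y : 'rV[R]_#|I| := \row_i y (enum_val i).
pose unv (v : 'rV[R]_#|I|) : I -> R := fun i => v 0 (enum_rank i).
have unvK v : vec (unv v) = v by apply/rowP => i; rewrite mxE /unv enum_valK.
pose Am : 'M[R]_(#|I|, #|K|) := \matrix_(i, k) A (enum_val k) (dirac_fun (enum_val i)).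
have AmE y k : (vec y *m Am) 0 k = A (enum_val k) y.
  rewrite mxE (linform_sum y (lA _)) sumE.
  by apply: eq_bigr => j _; rewrite !mxE.
pose Gm : 'M[R]_#|I| := \matrix_(i, j) G (dirac_fun (enum_val i)) (dirac_fun (enum_val j)).
have GmE y z : (vec y *m Gm *m (vec z)^T) 0 0 = G y z.
  rewrite mxE (linform_sum z (lGr _)) sumE.
  apply: eq_bigr => j _; rewrite !mxE mulrC; congr (_ * _).
  by rewrite (linform_sum y (lGl _)) sumE; apply: eq_bigr => i _; rewrite !mxE.
pose Z := kermx Am.
pose B := row_mx Am (Gm *m Z^T).
(* If [v *m B] vanishes, then [v] lies in the kernel spanned by the rows of [Z], say v = w Z, and v
   G v^T = (v G Z^T) w^T = 0. *)
have fB : row_free B.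
  apply: inj_row_free => v vB.
  move: vB; rewrite /B mul_mx_row -[0]row_mx0 => /eq_row_mx[vA vG].
  have : (v <= Z)%MS by apply/sub_kermxP.
  move=> /submxP[w vw].
  have Av k : A k (unv v) = 0.
    by rewrite -(enum_rankK k) -AmE unvK vA mxE.
  have Gv : G (unv v) (unv v) = 0.
    rewrite -GmE unvK {2}vw trmx_mul mulmxA.
    by rewrite -(mulmxA v) vG mul0mx mxE.
  have := pG _ Av Gv => v0.
  by apply/rowP => i; rewrite mxE -(enum_valK i); exact: v0.
move=> i.
have xE t : x t i = \sum_j (vec (x t) *m B) 0 j * pinvmx B j (enum_rank i).
  have := congr1 (fun M : 'rV_ _ => M 0 (enum_rank i)) (mulmxKp fB (vec (x t))).
  by rewrite mxE [RHS]mxE enum_rankK => <-.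
have cB j : exists l, tends (fun t => (vec (x t) *m B) 0 j) l.
  have [k ->|k ->] := split_ordP j.
    have [l hl] := cA (enum_val k); exists l; apply: (tends_ext _ hl) => t _.
    by rewrite /B mul_mx_row row_mxEl AmE.
  have Ak k' : A k' (unv (row k Z)) = 0.
    rewrite -(enum_rankK k') -AmE unvK -row_mul.
    by rewrite /Z mulmx_ker !mxE.
  have [l hl] := cG _ Ak; exists l; apply: (tends_ext _ hl) => t _.
  rewrite /B mul_mx_row row_mxEr -GmE unvK mulmxA !mxE.
  by apply: eq_bigr => j' _; rewrite !mxE.
have [l hl] : exists l : _ -> R, forall j, tends (fun t => (vec (x t) *m B) 0 j) (l j).
  by exists (fun j => projT1 (cid (cB j))) => j; case: (cid (cB j)).
exists (\sum_j l j * pinvmx B j (enum_rank i)).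
apply: (@tends_ext _ (fun t => \sum_j (vec (x t) *m B) 0 j * pinvmx B j (enum_rank i))).
  by move=> t _; rewrite xE.
apply: tends_sum => j _; rewrite mulrC.
by apply: (tends_ext _ (tendsZ _ (hl j))) => t _; rewrite mulrC.
Qed.

End Observers.

(** * Averages over long windows with an error independent of their length *)

Section WindowBounds.
Context {R : realType}.
Implicit Types (f F : R -> R) (Z W : R -> R -> R).

Lemma slow_back f T e : slow f -> 0 < e ->
  ev (fun t => forall s, t - T <= s -> s <= t -> `|f s - f t| <= e).
Proof.
move=> sf e0; have e2 : 0 < e / 2 by rewrite divr_gt0.
have := ev_back `|T| (sf `|T| _ e2); apply: evW => t t0 h s ts st.
have hT := ler_norm T.
have h0 := h (t - `|T|) (lexx _).
have h1 : `|f s - f (t - `|T|)| <= e / 2 by apply: h0; lra.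
have h2 : `|f t - f (t - `|T|)| <= e / 2 by apply: h0; lra.
rewrite (_ : f s - f t = (f s - f (t - `|T|)) - (f t - f (t - `|T|))); last by ring.
by rewrite [leRHS](splitr e); apply: (le_trans (ler_normB _ _)); exact: lerD.
Qed.

Lemma prim_tends0_slow F f : prim F f -> tends f 0 -> slow F.
Proof.
move=> pF hf H e e0; have d0 : 0 < e / (`|H| + 1) by rewrite divr_gt0// ltr_wpDl.
have [rf _] := pF.
apply: evW (ev_fwd (hf _ d0)) => t t0 h s ts sH; rewrite (prim_itg pF)//.
apply: (@le_trans _ _ (e / (`|H| + 1) * (s - t))).
  apply: (itg_bound rf) => // r tr _; rewrite -[f r]subr0; exact: h.
rewrite mulrAC ler_pdivrMr ?ltr_wpDl// ler_pM2l//.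
by have := ler_norm H; lra.
Qed.

(* [t] is the start and [H] the length of an averaging window; the bound must not
   depend on [H], so that it disappears after division by [H]. *)
Definition bal Z := exists C : R, forall H, 0 < H -> ev (fun t => `|Z H t| <= C).

Lemma balD Z W : bal Z -> bal W -> bal (fun H t => Z H t + W H t).
Proof.
move=> [C hC] [D hD]; exists (C + D) => H H0.
apply: evW (evI (hC _ H0) (hD _ H0)) => t _ [h1 h2].
by apply: (le_trans (ler_normD _ _)); exact: lerD.
Qed.

Lemma balZ k Z : bal Z -> bal (fun H t => k * Z H t).
Proof.
move=> [C hC]; exists (`|k| * C) => H H0; apply: evW (hC _ H0) => t _ h.
by rewrite normrM ler_wpM2l.
Qed.

Lemma balB Z W : bal Z -> bal W -> bal (fun H t => Z H t - W H t).
Proof.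
move=> hZ /(balZ (-1)) hW; have [C hC] := balD hZ hW; exists C => H H0.
by apply: evW (hC _ H0) => t _; rewrite mulN1r.
Qed.

Lemma bal_ext Z W : (forall H, 0 < H -> ev (fun t => Z H t = W H t)) -> bal Z -> bal W.
Proof.
move=> e [C hC]; exists C => H H0.
by apply: evW (evI (hC _ H0) (e _ H0)) => t _ [h <-].
Qed.

Lemma bal0 : bal (fun _ _ => 0).
Proof. by exists 0 => H _; apply: evT => t _; rewrite normr0. Qed.

Lemma bal_sum (J : finType) (P : pred J) (Z : J -> R -> R -> R) :
  (forall i, P i -> bal (Z i)) -> bal (fun H t => \sum_(i | P i) Z i H t).
Proof.
move=> hZ.
have h (s : seq J) : bal (fun H t => \sum_(i <- s | P i) Z i H t).
  elim: s => [|i s IH].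
    by apply: bal_ext bal0 => H _; apply: evT => t _; rewrite big_nil.
  have [Pi|Pi] := boolP (P i).
    apply: bal_ext (balD (hZ _ Pi) IH) => H _; apply: evT => t _.
    by rewrite big_cons Pi.
  apply: bal_ext IH => H _; apply: evT => t _.
  by rewrite big_cons (negPf Pi).
by apply: bal_ext (h (index_enum J)) => H _; exact: evT.
Qed.

Lemma tends0_bal f : bal (fun H t => H * f t) -> tends f 0.
Proof. by move=> [C]; exact: tends0_scaled. Qed.

Lemma bal_tends0 f : tends f 0 -> bal (fun H t => H * f t).
Proof.
move=> hf; exists 1 => H H0.
by apply: evW (tendsZ H hf ltr01) => t _; rewrite mulr0 subr0.
Qed.

Lemma bal_slow_itg f : reg 0 f -> slow f -> bal (fun H t => itg f t (t + H) - H * f t).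
Proof. by move=> rf sf; exists 1 => H H0; apply: slow_itg => //; exact: ltW. Qed.

Lemma bal_slow_diff f : slow f -> bal (fun H t => f (t + H) - f t).
Proof.
move=> sf; exists 1 => H H0; apply: evW (sf H _ ltr01) => t _; apply => //.
by rewrite lerDl ltW.
Qed.

Lemma unicontD f F : unicont f -> unicont F -> unicont (fun t => f t + F t).
Proof.
move=> hf hF e e0; have e2 : 0 < e / 2 by rewrite divr_gt0.
have [d d0 hd] := hf _ e2; have [d' d'0 hd'] := hF _ e2.
exists (Num.min d d'); first by rewrite lt_min d0.
move=> s t s0 st; rewrite addr_minr le_min => /andP[h1 h2].
rewrite opprD addrACA [leRHS](splitr e).
by apply: (le_trans (ler_normD _ _)); rewrite lerD ?hd ?hd'.
Qed.

Lemma unicontZ k f : unicont f -> unicont (fun t => k * f t).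
Proof.
move=> hf e e0; have d0 : 0 < e / (`|k| + 1) by rewrite divr_gt0// ltr_wpDl.
have [d dd hd] := hf _ d0; exists d => // s t s0 st td.
rewrite -mulrBr normrM; have := hd _ _ s0 st td.
rewrite ler_pdivlMr ?ltr_wpDl// => h.
have := normr_ge0 (f t - f s); nra.
Qed.

Lemma unicont_ext f F : (forall t, 0 <= t -> f t = F t) -> unicont f -> unicont F.
Proof.
move=> e hf d d0; have [k k0 hk] := hf _ d0; exists k => // s t s0 st td.
by rewrite -!e ?hk//; exact: le_trans st.
Qed.

Lemma unicont_cst (k : R) : unicont (fun=> k).
Proof. by move=> e e0; exists 1 => // *; rewrite subrr normr0 ltW. Qed.

Lemma unicont_sum (J : finType) (P : pred J) (F : J -> R -> R) :
  (forall i, P i -> unicont (F i)) -> unicont (fun t => \sum_(i | P i) F i t).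
Proof.
move=> hF; rewrite -fct_sumE.
by apply: (big_ind (@unicont R)) => [||//]; [exact: unicont_cst|move=> *; exact: unicontD].
Qed.

End WindowBounds.

(** * Sliding windows of the length of a delay *)

Section Windows.
Context {R : realType}.
Implicit Types (f h : R -> R) (T t : R).

Definition window f T t := itg f (t - T) t.

Lemma reg_delay f T : reg (- T) f -> reg 0 (fun t => f (t - T)).
Proof. by move=> /(reg_shift T); rewrite addNr. Qed.

Lemma reg_past f T : 0 <= T -> reg (- T) f -> reg 0 f.
Proof. by move=> T0; apply: reg_weak; rewrite oppr_le0. Qed.

Lemma itg_delay f T a b : reg (- T) f -> 0 <= a ->
  itg (fun t => f (t - T)) a b = itg f (a - T) (b - T).
Proof.
move=> rf a0; rewrite -(itg_shift T (b - T) rf (a := a - T)) ?subrK//.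
by rewrite -subr_ge0 opprK subrK.
Qed.

Lemma window_prim f T : 0 <= T -> reg (- T) f ->
  prim (window f T) (fun t => f t - f (t - T)).
Proof.
move=> T0 rf; have r0 := reg_past T0 rf; have rT := reg_delay rf.
split=> [|t t0]; first exact: regB.
rewrite /window (itgB _ r0 rT)// itg_delay// !sub0r.
have mT : - T <= 0 by rewrite oppr_le0.
have h1 := itg_cat rf (lexx _) mT t0.
have h2 : itg f (- T) t = itg f (- T) (t - T) + itg f (t - T) t.
  by apply: (itg_cat rf); lra.
by lra.
Qed.

Lemma itg_delay_window f T t H : 0 <= T -> reg (- T) f -> 0 <= t -> 0 <= H ->
  itg (fun s => f (s - T)) t (t + H) = itg f t (t + H) + window f T t - window f T (t + H).
Proof.
move=> T0 rf t0 H0; rewrite itg_delay// /window.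
have h1 : itg f (t - T) (t + H) = itg f (t - T) (t + H - T) + itg f (t + H - T) (t + H).
  by apply: (itg_cat rf); lra.
have h2 : itg f (t - T) (t + H) = itg f (t - T) t + itg f t (t + H).
  by apply: (itg_cat rf); lra.
by lra.
Qed.

Lemma norm_le_sqr (y : R) : `|y| <= (1 + y ^+ 2) / 2.
Proof.
rewrite ler_pdivlMr// -[in leRHS](real_normK (num_real y)).
by have := sqr_ge0 (`|y| - 1); nra.
Qed.

Lemma window_bound f T t E : 0 <= T -> reg (- T) f -> 0 <= t ->
  window (fun s => f s ^+ 2) T t <= E -> `|window f T t| <= (T + E) / 2.
Proof.
move=> T0 rf t0 hE; have tT : - T <= t - T by lra.
apply: (le_trans (itg_norm _ rf tT)).
have rf2 : reg (- T) (fun s => f s ^+ 2) by apply: regM.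
have r1 : reg (- T) (fun s => 2^-1 * (1 + f s ^+ 2)).
  by apply: regZ; apply: regD => //; exact: reg_cst.
apply: (@le_trans _ _ (itg (fun s => 2^-1 * (1 + f s ^+ 2)) (t - T) t)).
  apply: (itg_le (reg_norm rf) r1) => // s _ _.
  by rewrite mulrC; exact: norm_le_sqr.
rewrite (itgZ _ _ (regD (reg_cst _ _) rf2))//.
rewrite (itgD _ (reg_cst _ _) rf2)// itg_cst ?lerBlDr ?lerDl//.
by rewrite subKr mul1r [leRHS]mulrC ler_pM2l ?invr_gt0// lerD2l; exact: hE.
Qed.

(** The energy controls the wave in mean square over windows of length [T] only. With [T] positive,
    a short increment of the delayed integral fits into the window ending at the earlier time
    [s]. *)
Lemma delay_unicont f T E : 0 < T -> reg (- T) f ->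
  (forall t, 0 <= t -> window (fun s => f s ^+ 2) T t <= E) ->
  unicont (fun t => itg (fun s => f (s - T)) 0 t).
Proof.
move=> T0 rf hE e e0.
have T0' := ltW T0.
have E0 : 0 <= E by apply: le_trans (hE 0 (lexx _)); apply: itg_ge0 => s _ _; exact: sqr_ge0.
pose K := (E + 1) / e.
have K0 : 0 < K by rewrite divr_gt0// ltr_wpDl.
exists (Num.min T (e / K)); first by rewrite lt_min T0 divr_gt0.
move=> s t s0 st; rewrite addr_minr le_min => /andP[tT tK].
have rT := reg_delay rf.
have -> : itg (fun s => f (s - T)) 0 t - itg (fun s => f (s - T)) 0 s =
   itg f (s - T) (t - T).
  by rewrite (itg_cat rT (lexx 0) s0 st) addrC addKr itg_delay.
have sT : - T <= s - T by lra.
apply: (le_trans (itg_norm _ rf sT)).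
have rf2 : reg (- T) (fun s => f s ^+ 2) by apply: regM.
have r1 : reg (- T) (fun s => K / 2 + (2 * K)^-1 * f s ^+ 2).
  by apply: regD; [exact: reg_cst|exact: regZ].
(* AM-GM: [|f| <= K / 2 + f ^ 2 / (2 K)], where a large [K] tames the energy. *)
apply: (@le_trans _ _ (itg (fun s => K / 2 + (2 * K)^-1 * f s ^+ 2) (s - T) (t - T))).
  apply: (itg_le (reg_norm rf) r1) => // r _ _.
  rewrite -[in leRHS](real_normK (num_real (f r))).
  set y := `|f r|; rewrite -subr_ge0.
  rewrite (_ : _ - y = (2 * K)^-1 * (y - K) ^+ 2); last by field; rewrite gt_eqF.
  by rewrite mulr_ge0 ?sqr_ge0// invr_ge0 mulr_ge0// ltW.
rewrite (itgD _ (reg_cst _ _) (regZ _ rf2))// itg_cst; last by lra.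
rewrite (itgZ _ _ rf2)//.
have h1 : itg (fun r => f r ^+ 2) (s - T) (t - T) <= E.
  apply: (le_trans _ (hE _ s0)); rewrite /window.
  have -> : itg (fun r => f r ^+ 2) (s - T) s = itg (fun r => f r ^+ 2) (s - T) (t - T)
      + itg (fun r => f r ^+ 2) (t - T) s by apply: (itg_cat rf2); lra.
  by rewrite lerDl; apply: itg_ge0 => r _ _; exact: sqr_ge0.
have h2 : K / 2 * (t - T - (s - T)) <= e / 2.
  have : t - s <= e / K by lra.
  by rewrite ler_pdivlMr// => h; nra.
have h3 : (2 * K)^-1 * itg (fun r => f r ^+ 2) (s - T) (t - T) <= e / 2.
  rewrite ler_pdivrMl; last by rewrite mulr_gt0.
  have -> : 2 * K * (e / 2) = E + 1 by rewrite /K; field; rewrite gt_eqF.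
  by lra.
by rewrite [leRHS](splitr e); exact: lerD.
Qed.

(* The iterated integral over a sliding window, rearranged so that windows of
   length [H] appear. *)
Lemma itg_window f T t H : 0 <= T -> reg 0 f -> T <= t -> 0 <= H ->
  itg (window f T) t (t + H) = itg (fun s => itg f s (s + H)) (t - T) t.
Proof.
move=> T0 rf Tt H0.
pose Phi s := itg f 0 s.
have pPhi : prim Phi f by split => // s s0; rewrite /Phi itgxx add0r.
have rPhi := prim_reg pPhi.
have rT : reg T (fun s => Phi (s - T)) by rewrite -[X in reg X]add0r; exact: reg_shift.
have rH : reg 0 (fun s => Phi (s - - H)).
  by apply: (reg_weak _ (reg_shift (- H) rPhi)); rewrite add0r oppr_le0.
rewrite (@itg_ext _ _ (fun s => Phi s - Phi (s - T))); last first.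
  by move=> s ts _; rewrite /window -(prim_itg pPhi)//; lra.
rewrite [RHS](@itg_ext _ _ (fun s => Phi (s - - H) - Phi s)); last first.
  by move=> s ts _; rewrite -(prim_itg pPhi) ?opprK//; lra.
rewrite (itgB _ (reg_weak T0 rPhi) rT)// (itgB _ rH rPhi); last by lra.
have -> : itg (fun s => Phi (s - T)) t (t + H) = itg Phi (t - T) (t + H - T).
  by rewrite -(itg_shift T (t + H - T) rPhi (a := t - T)) ?subrK//; lra.
have -> : itg (fun s => Phi (s - - H)) (t - T) t = itg Phi (t - T + H) (t + H).
  rewrite -(itg_shift (- H) (t + H) rPhi (a := t - T + H)); last by lra.
  by rewrite !addrK.
have h1 : itg Phi (t - T) (t + H) = itg Phi (t - T) t + itg Phi t (t + H).
  by apply: (itg_cat rPhi); lra.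
have h2 : itg Phi (t - T) (t + H) =
    itg Phi (t - T) (t + H - T) + itg Phi (t + H - T) (t + H).
  by apply: (itg_cat rPhi); lra.
have -> : t - T + H = t + H - T by ring.
by lra.
Qed.

(** After the interchange of [itg_window], the left side is an integral over the last [T] units of
    time of windows of length [H], each known up to [C]; hence a bound of order [T], free of [H]. *)
Lemma bal_window f T g : 0 <= T -> reg 0 f -> reg 0 g -> slow g ->
  bal (fun H t => itg f t (t + H) - H * g t) ->
  bal (fun H t => itg (window f T) t (t + H) - H * (T * g t)).
Proof.
move=> T0 rf rg sg [C hC]; exists (T * (C + 1)) => H H0.
(* This tolerance for the variation of [g] during the last [T] keeps [H * (g s - g t)] below 1. *)
have e0 : 0 < H^-1 by rewrite invr_gt0.
have hT : ev (fun t => T <= t) by exists T.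
apply: evW (evI hT (evI (ev_back T (hC _ H0)) (slow_back T sg e0))) => t t0 [Tt [h1 h2]].
have H0' := ltW H0.
rewrite itg_window//.
have tT : t - T <= t by lra.
have tT0 : 0 <= t - T by lra.
pose Phi s := itg f 0 s.
have pPhi : prim Phi f by split => // s s0; rewrite /Phi itgxx add0r.
have rPhi := prim_reg pPhi.
have rH : reg 0 (fun s => Phi (s - - H) - Phi s).
  apply: regB => //.
  by apply: (reg_weak _ (reg_shift (- H) rPhi)); rewrite add0r oppr_le0.
have ri : reg 0 (fun s => itg f s (s + H)).
  by apply: reg_ext rH => s s0; rewrite opprK -(prim_itg pPhi)// lerDl.
have -> : H * (T * g t) = itg (fun=> H * g t) (t - T) t.
  by rewrite itg_cst//; ring.
rewrite -(itgB _ ri (reg_cst _ _))//.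
apply: (@le_trans _ _ ((C + 1) * (t - (t - T)))); last by lra.
apply: (@itg_bound _ 0) => //; first by apply: regB => //; exact: reg_cst.
move=> s ts st.
rewrite (_ : _ - _ = (itg f s (s + H) - H * g s) + H * (g s - g t)); last by ring.
apply: (le_trans (ler_normD _ _)); apply: lerD; first exact: h1.
rewrite normrM (gtr0_norm H0) -ler_pdivlMl// mulr1; exact: h2.
Qed.

End Windows.

(** * Scattering links *)

Section Link.
Context {R : realType}.
Variables (P Q xA xB : R -> R) (T1 T2 : R).

Definition recvA t := - Q (t - T2) - xA t.
Definition recvB t := P (t - T1) + xB t.

(* A scattering line joining a cell with output [xA] to a cell with output
   [xB]: [P] and [Q] are the waves entering it at the two ends, up to scaling. *)
Record link : Prop := Link {
  delay1_ge0 : 0 <= T1;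
  delay2_ge0 : 0 <= T2;
  regP : reg (- T1) P;
  regQ : reg (- T2) Q;
  reg_xA : reg 0 xA;
  reg_xB : reg 0 xB;
  waveP : forall t, 0 <= t -> P t = 2 * xA t + Q (t - T2);
  waveQ : forall t, 0 <= t -> Q t = - (2 * xB t) - P (t - T1) }.

(** The factor 1/4 makes the rate of change equal to the power that the two ends exchange with the
    line, see [link_energy_prim]. *)
Definition link_energy t :=
  (window (fun s => P s ^+ 2) T1 t + window (fun s => Q s ^+ 2) T2 t) / 4.

(* Polarization of [2 * link_energy] against the equilibrium with [xA = a] and
   [xB = b], whose waves are the constants [a - b] and [- (a + b)]. *)
Definition link_cross (a b t : R) :=
  ((a - b) * window P T1 t - (a + b) * window Q T2 t) / 2.

Hypothesis lk : link.

Let rP0 : reg 0 P := reg_past (delay1_ge0 lk) (regP lk).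
Let rQ0 : reg 0 Q := reg_past (delay2_ge0 lk) (regQ lk).

Lemma recvA_reg : reg 0 recvA.
Proof. by apply: regB (reg_xA lk); apply: regN; exact: reg_delay (regQ lk). Qed.

Lemma recvB_reg : reg 0 recvB.
Proof. by apply: regD (reg_xB lk); exact: reg_delay (regP lk). Qed.

Lemma link_energy_prim :
  prim link_energy (fun t => - (xA t * recvA t) + xB t * recvB t).
Proof.
have p1 := window_prim (delay1_ge0 lk) (regM (regP lk) (regP lk)).
have p2 := window_prim (delay2_ge0 lk) (regM (regQ lk) (regQ lk)).
apply: prim_ext (primZ 4^-1 (primD p1 p2)) => t t0.
  by rewrite /link_energy mulrC.
rewrite /recvA /recvB (waveP lk t0) (waveQ lk t0).
by set q := Q _; set p := P _; field.
Qed.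

Lemma link_cross_prim a b : prim (link_cross a b)
  (fun t => - (a * recvA t) + b * recvB t - xA t * b + xB t * a).
Proof.
have p1 := window_prim (delay1_ge0 lk) (regP lk).
have p2 := window_prim (delay2_ge0 lk) (regQ lk).
apply: prim_ext (primZ 2^-1 (primB (primZ (a - b) p1) (primZ (a + b) p2))) => t t0.
  by rewrite /link_cross mulrC.
rewrite /recvA /recvB (waveP lk t0) (waveQ lk t0).
by set q := Q _; set p := P _; field.
Qed.

Lemma link_energy_ge0 t : 0 <= window (fun s => P s ^+ 2) T1 t /\
  0 <= window (fun s => Q s ^+ 2) T2 t.
Proof. by split; apply: itg_ge0 => s _ _; exact: sqr_ge0. Qed.

Lemma link_window_le t : window (fun s => P s ^+ 2) T1 t <= 4 * link_energy t /\
  window (fun s => Q s ^+ 2) T2 t <= 4 * link_energy t.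
Proof. by have [] := link_energy_ge0 t; rewrite /link_energy; split; lra. Qed.

Hypothesis (E : R) (hE : forall t, 0 <= t -> link_energy t <= E).

Let hP t : 0 <= t -> window (fun s => P s ^+ 2) T1 t <= 4 * E.
Proof. by move=> t0; have [h _] := link_window_le t; have := hE t0; lra. Qed.

Let hQ t : 0 <= t -> window (fun s => Q s ^+ 2) T2 t <= 4 * E.
Proof. by move=> t0; have [_ h] := link_window_le t; have := hE t0; lra. Qed.

(** A positive delay is covered by [delay_unicont]. When one delay is zero, its wave equation
    expresses that wave by an output and the other delayed wave; when both are zero, the two
    equations are solved for the waves. *)
Lemma link_unicont X : (forall t, 0 <= t -> `|xA t| <= X) ->
  (forall t, 0 <= t -> `|xB t| <= X) ->
  unicont (fun t => itg recvA 0 t) /\ unicont (fun t => itg recvB 0 t).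
Proof.
move=> bA bB.
have uxA : unicont (fun t => itg xA 0 t).
  apply: (@prim_unicont _ _ xA X) => //.
  by split; [exact: reg_xA lk|move=> t t0; rewrite itgxx add0r].
have uxB : unicont (fun t => itg xB 0 t).
  apply: (@prim_unicont _ _ xB X) => //.
  by split; [exact: reg_xB lk|move=> t t0; rewrite itgxx add0r].
have rQd := reg_delay (regQ lk); have rPd := reg_delay (regP lk).
have [rA rB] := (reg_xA lk, reg_xB lk).
suff [uQ uP] : unicont (fun t => itg (fun s => Q (s - T2)) 0 t) /\
    unicont (fun t => itg (fun s => P (s - T1)) 0 t).
  split.
    apply: unicont_ext (unicontD (unicontZ (-1) uQ) (unicontZ (-1) uxA)) => t t0.
    by rewrite (itgB _ (regN rQd) rA)// (itgN _ rQd)// !mulN1r.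
  apply: unicont_ext (unicontD uP uxB) => t t0.
  by rewrite (itgD _ rPd rB).
have caseP : 0 < T1 -> unicont (fun t => itg (fun s => P (s - T1)) 0 t).
  by move=> h; apply: delay_unicont hP => //; exact: regP lk.
have caseQ : 0 < T2 -> unicont (fun t => itg (fun s => Q (s - T2)) 0 t).
  by move=> h; apply: delay_unicont hQ => //; exact: regQ lk.
have [T10|] := ltP 0 T1; have [T20|] := ltP 0 T2; first by split; auto.
- move=> T20; have T2E : T2 = 0 by apply: le_anti; rewrite T20 (delay2_ge0 lk).
  split; last exact: caseP.
  apply: unicont_ext (unicontD (unicontZ (-2) uxB) (unicontZ (-1) (caseP T10))) => t t0.
  rewrite -(itgZ _ _ rB)// -(itgZ _ _ rPd)// -(itgD _ (regZ _ rB) (regZ _ rPd))//.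
  apply: itg_ext => s s0 _; rewrite T2E subr0 (waveQ lk s0); ring.
- move=> T1n; have T1E : T1 = 0 by apply: le_anti; rewrite T1n (delay1_ge0 lk).
  split; first exact: caseQ.
  apply: unicont_ext (unicontD (unicontZ 2 uxA) (unicontZ 1 (caseQ T20))) => t t0.
  rewrite -(itgZ _ _ rA)// -(itgZ _ _ rQd)// -(itgD _ (regZ _ rA) (regZ _ rQd))//.
  apply: itg_ext => s s0 _; rewrite T1E subr0 (waveP lk s0); ring.
- move=> T20 T1n; have T1E : T1 = 0 by apply: le_anti; rewrite T1n (delay1_ge0 lk).
  have T2E : T2 = 0 by apply: le_anti; rewrite T20 (delay2_ge0 lk).
  split.
    apply: unicont_ext (unicontD (unicontZ (-1) uxB) (unicontZ (-1) uxA)) => t t0.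
    rewrite -(itgZ _ _ rB)// -(itgZ _ _ rA)// -(itgD _ (regZ _ rB) (regZ _ rA))//.
    apply: itg_ext => s s0 _; rewrite T2E subr0.
    have := waveQ lk s0; have := waveP lk s0; rewrite T1E T2E !subr0; lra.
  apply: unicont_ext (unicontD (unicontZ (-1) uxB) (unicontZ 1 uxA)) => t t0.
  rewrite -(itgZ _ _ rB)// -(itgZ _ _ rA)// -(itgD _ (regZ _ rB) (regZ _ rA))//.
  apply: itg_ext => s s0 _; rewrite T1E subr0.
  have := waveQ lk s0; have := waveP lk s0; rewrite T1E T2E !subr0; lra.
Qed.

(* Solving the two wave equations for the integrals of [P] and [Q]: delays only
   contribute windows of fixed length, which the energy bounds. *)
Lemma link_mean : slow xA -> slow xB ->
  [/\ bal (fun H t => itg P t (t + H) - H * (xA t - xB t)),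
      bal (fun H t => itg Q t (t + H) - H * (- (xA t + xB t))),
      bal (fun H t => itg recvA t (t + H) - H * xB t)
    & bal (fun H t => itg recvB t (t + H) - H * xA t)].
Proof.
move=> sA sB.
have [rA rB] := (reg_xA lk, reg_xB lk).
have [rP rQ] := (regP lk, regQ lk).
have rQd := reg_delay rQ; have rPd := reg_delay rP.
have [T10 T20] := (delay1_ge0 lk, delay2_ge0 lk).
have wbal f T : 0 <= T -> reg (- T) f ->
    (forall t, 0 <= t -> window (fun s => f s ^+ 2) T t <= 4 * E) ->
    bal (fun H t => window f T (t + H) - window f T t).
  move=> T0 rf hf; exists (T + 4 * E) => H H0; apply: evT => t t0.
  have tH : 0 <= t + H by rewrite addr_ge0// ltW.
  have := window_bound T0 rf t0 (hf _ t0); have := window_bound T0 rf tH (hf _ tH).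
  have := ler_normB (window f T (t + H)) (window f T t).
  lra.
have bP := wbal _ _ T10 rP hP; have bQ := wbal _ _ T20 rQ hQ.
have mA := bal_slow_itg rA sA; have mB := bal_slow_itg rB sB.
have eqP H t : 0 < H -> 0 <= t -> itg P t (t + H) =
   2 * itg xA t (t + H) + itg Q t (t + H) - (window Q T2 (t + H) - window Q T2 t).
  move=> H0 t0; rewrite -(itgZ _ _ rA)//.
  have h := itg_delay_window T20 rQ t0 (ltW H0).
  transitivity (itg (fun s => 2 * xA s) t (t + H) + itg (fun s => Q (s - T2)) t (t + H)).
    rewrite -(itgD _ (regZ 2 rA) rQd)//.
    by apply: itg_ext => s ts _; apply: (waveP lk); exact: le_trans ts.
  by rewrite h; lra.
have eqQ H t : 0 < H -> 0 <= t -> itg Q t (t + H) =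
   - (2 * itg xB t (t + H)) - itg P t (t + H) + (window P T1 (t + H) - window P T1 t).
  move=> H0 t0; rewrite -(itgZ _ _ rB)//.
  have h := itg_delay_window T10 rP t0 (ltW H0).
  transitivity (itg (fun s => - (2 * xB s)) t (t + H) - itg (fun s => P (s - T1)) t (t + H)).
    rewrite -(itgB _ (regN (regZ 2 rB)) rPd)//.
    by apply: itg_ext => s ts _; apply: (waveQ lk); exact: le_trans ts.
  by rewrite h (itgN _ (regZ 2 rB))//; lra.
have b1 : bal (fun H t => itg P t (t + H) - H * (xA t - xB t)).
  apply: bal_ext (balD (balB mA mB) (balZ 2^-1 (balB bP bQ))) => H H0.
  apply: evT => t t0; have := eqP H t H0 t0; have := eqQ H t H0 t0; lra.
have b2 : bal (fun H t => itg Q t (t + H) - H * (- (xA t + xB t))).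
  apply: bal_ext (balD (balZ (-1) (balD mA mB)) (balZ 2^-1 (balD bP bQ))) => H H0.
  apply: evT => t t0; have := eqP H t H0 t0; have := eqQ H t H0 t0; lra.
split => //.
  apply: bal_ext (balD (balB (balZ (-1) b2) mA) bQ) => H H0.
  apply: evT => t t0; rewrite (itgB _ (regN rQd) rA)// (itgN _ rQd)//.
  by rewrite (itg_delay_window T20 rQ t0 (ltW H0)); lra.
apply: bal_ext (balB (balD b1 mB) bP) => H H0.
apply: evT => t t0; rewrite (itgD _ rPd rB)//.
by rewrite (itg_delay_window T10 rP t0 (ltW H0)); lra.
Qed.

Lemma link_cross_mean a b : slow xA -> slow xB ->
  bal (fun H t => itg (link_cross a b) t (t + H) -
    H * ((T1 * (a - b) * (xA t - xB t) + T2 * (a + b) * (xA t + xB t)) / 2)).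
Proof.
move=> sA sB; have [b1 b2 _ _] := link_mean sA sB.
have [rA rB] := (reg_xA lk, reg_xB lk).
have [rP rQ] := (regP lk, regQ lk).
have [T10 T20] := (delay1_ge0 lk, delay2_ge0 lk).
have h1 := bal_window T10 rP0 (regB rA rB) (slowB sA sB) b1.
have sN : slow (fun t => - (xA t + xB t)).
  by have := slowZ (-1) (slowD sA sB); apply: slow_ext => t _; rewrite mulN1r.
have h2 := bal_window T20 rQ0 (regN (regD rA rB)) sN b2.
have w1 := prim_reg (window_prim T10 rP); have w2 := prim_reg (window_prim T20 rQ).
apply: bal_ext (balB (balZ ((a - b) / 2) h1) (balZ ((a + b) / 2) h2)) => H H0.
apply: evT => t t0.
have -> : itg (link_cross a b) t (t + H) =
   (a - b) / 2 * itg (window P T1) t (t + H) - (a + b) / 2 * itg (window Q T2) t (t + H).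
  rewrite -(itgZ _ _ w1)// -(itgZ _ _ w2)// -(itgB _ (regZ _ w1) (regZ _ w2))//.
  by apply: itg_ext => s _ _; rewrite /link_cross; field.
by field.
Qed.

End Link.

(** * Passive networks of cells *)

Section PassiveNetwork.
Context {R : realType} {S L : finType}.
Variables (lk : pred L) (eA eB fA fB : L -> S) (al T1 T2 : L -> R).
Variables (x rho u d : S -> R -> R) (P Q : L -> R -> R).

Let rA l := recvA (Q l) (x (eA l)) (T2 l).
Let rB l := recvB (P l) (x (eB l)) (T1 l).

(** The power delivered against [y] when the outputs are [z] and each end receives the output of the
    other without delay, i.e. the undelayed controller as a bilinear form. The cells [fA] and [fB]
    give the values subtracted on reception. *)
Definition coupling (y z : S -> R) :=
  \sum_(l | lk l) al l * (y (eA l) * (z (eB l) - z (fB l))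
                          - y (eB l) * (z (eA l) - z (fA l))).

Definition localform (y z : S -> R) :=
  \sum_(l | lk l) al l * (y (eA l) * z (fB l) - y (eB l) * z (fA l)).

(* Cells [rho' = - rho + u], [x' = - rho + 2 u] driven by the signals received
   through scattering links, given through their power [\sum_s y s * u s]; the
   terms in [fA], [fB] exchange no net power.  *)
Record network : Prop := Network {
  al_gt0 : forall l, lk l -> 0 < al l;
  rho_prim : forall s, prim (rho s) (fun t => - rho s t + u s t);
  x_prim : forall s, prim (x s) (fun t => - rho s t + 2 * u s t);
  u_reg : forall s, reg 0 (u s);
  d_reg : forall s, reg 0 (d s);
  links : forall l, lk l ->
    link (P l) (Q l) (x (eA l)) (x (eB l)) (T1 l) (T2 l);
  localform_skew : forall y z, localform y z = - localform z y;
  power_balance : forall (y : S -> R) t, 0 <= t -> \sum_s y s * u s t =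
    \sum_(l | lk l) al l * (y (eA l) * (rA l t - x (fB l) t)
                            - y (eB l) * (rB l t - x (fA l) t))
    + \sum_s y s * d s t }.

Hypothesis nw : network.

Lemma z_prim s : prim (fun t => x s t - rho s t) (u s).
Proof.
by apply: prim_ext (primB (x_prim nw s) (rho_prim nw s)) => t t0 //; ring.
Qed.

Definition net_energy t :=
  \sum_s ((x s t - rho s t) ^+ 2 / 2 + rho s t ^+ 2 / 2) +
  \sum_(l | lk l) al l * link_energy (P l) (Q l) (T1 l) (T2 l) t.

(** A cell contributes x u - rho^2. The links absorb what the received signals deliver, the
    subtracted outputs cancel by skewness of [localform], and only the outside power and the
    dissipation remain. *)
Lemma net_energy_prim : prim net_energy
  (fun t => \sum_s x s t * d s t - \sum_s rho s t ^+ 2).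
Proof.
have p1 : prim (fun t => \sum_s ((x s t - rho s t) ^+ 2 / 2 + rho s t ^+ 2 / 2))
  (fun t => \sum_s ((x s t - rho s t) * u s t + rho s t * (- rho s t + u s t))).
  apply: prim_sum => s _; apply: primD; apply: prim_sqr; first exact: z_prim.
  exact: rho_prim.
have p2 : prim
    (fun t => \sum_(l | lk l) al l * link_energy (P l) (Q l) (T1 l) (T2 l) t)
    (fun t => \sum_(l | lk l) al l *
       (- (x (eA l) t * rA l t) + x (eB l) t * rB l t)).
  by apply: prim_sum => l kl; apply: primZ; exact: link_energy_prim (links nw kl).
apply: prim_ext (primD p1 p2) => // t t0.
have -> : \sum_s ((x s t - rho s t) * u s t + rho s t * (- rho s t + u s t)) =
    \sum_s x s t * u s t - \sum_s rho s t ^+ 2.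
  by rewrite -sumrB; apply: eq_bigr => s _; ring.
have -> := power_balance nw (x^~ t) t0.
have h0 : localform (x^~ t) (x^~ t) = 0.
  have := localform_skew nw (x^~ t) (x^~ t); lra.
have -> : \sum_(l | lk l) al l * (x (eA l) t * (rA l t - x (fB l) t) -
       x (eB l) t * (rB l t - x (fA l) t)) =
   - \sum_(l | lk l) al l * (- (x (eA l) t * rA l t) + x (eB l) t * rB l t)
   - localform (x^~ t) (x^~ t).
  rewrite /localform -sumrN -sumrB; apply: eq_bigr => l _; ring.
by rewrite h0; ring.
Qed.

Lemma link_energy_nonneg l t : lk l -> 0 <= link_energy (P l) (Q l) (T1 l) (T2 l) t.
Proof.
move=> kl; have [h1 h2] := link_energy_ge0 (P l) (Q l) (T1 l) (T2 l) t.
by rewrite divr_ge0// addr_ge0.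
Qed.

Lemma net_energy_ge s t :
  (x s t - rho s t) ^+ 2 / 2 + rho s t ^+ 2 / 2 <= net_energy t.
Proof.
rewrite /net_energy (bigD1 s)//= -addrA lerDl; apply: addr_ge0.
  apply: sumr_ge0 => i _; have := sqr_ge0 (x i t - rho i t).
  by have := sqr_ge0 (rho i t); lra.
apply: sumr_ge0 => l kl; rewrite mulr_ge0 ?link_energy_nonneg//.
by rewrite ltW// (al_gt0 nw).
Qed.

Lemma net_energy_link l t : lk l ->
  al l * link_energy (P l) (Q l) (T1 l) (T2 l) t <= net_energy t.
Proof.
move=> kl; rewrite /net_energy (bigD1 l)//= addrCA lerDl; apply: addr_ge0.
  apply: sumr_ge0 => i _; have := sqr_ge0 (x i t - rho i t).
  by have := sqr_ge0 (rho i t); lra.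
apply: sumr_ge0 => k /andP[kl' _]; rewrite mulr_ge0 ?link_energy_nonneg//.
by rewrite ltW// (al_gt0 nw).
Qed.

Lemma net_energy_ge0 t : 0 <= net_energy t.
Proof.
apply: addr_ge0; apply: sumr_ge0 => i h.
  have := sqr_ge0 (x i t - rho i t); have := sqr_ge0 (rho i t); lra.
by rewrite mulr_ge0 ?link_energy_nonneg// ltW// (al_gt0 nw).
Qed.

Lemma coupling_linr y : linform (coupling y).
Proof.
move=> a z z'; rewrite /coupling mulr_sumr -big_split/=.
by apply: eq_bigr => l _; ring.
Qed.

Lemma coupling_linl z : linform (coupling^~ z).
Proof.
move=> a y y'; rewrite /coupling mulr_sumr -big_split/=.
by apply: eq_bigr => l _; ring.
Qed.

Lemma coupling_skew y z : coupling y z = - coupling z y.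
Proof.
have e y' z' : coupling y' z' =
    \sum_(l | lk l) al l * (y' (eA l) * z' (eB l) - y' (eB l) * z' (eA l)) -
    localform y' z'.
  by rewrite /coupling /localform -sumrB; apply: eq_bigr => l _; ring.
rewrite !e (localform_skew nw y z) opprB opprK addrC; congr (_ + _).
by rewrite -sumrN; apply: eq_bigr => l _; ring.
Qed.

Variable E : R.
Hypothesis hE : forall t, 0 <= t -> net_energy t <= E.

Lemma rho_bounded s t : 0 <= t -> `|rho s t| <= (1 + 2 * E) / 2.
Proof.
move=> t0; apply: (le_trans (norm_le_sqr _)).
have := net_energy_ge s t; have := hE t0; have := sqr_ge0 (x s t - rho s t); lra.
Qed.

Lemma x_bounded s t : 0 <= t -> `|x s t| <= 1 + 2 * E.
Proof.
move=> t0; have -> : x s t = (x s t - rho s t) + rho s t by ring.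
apply: (le_trans (ler_normD _ _)); have := rho_bounded s t0.
have := norm_le_sqr (x s t - rho s t).
have := net_energy_ge s t; have := hE t0; have := sqr_ge0 (rho s t); lra.
Qed.

Lemma link_energy_bounded l : lk l -> forall t, 0 <= t ->
  link_energy (P l) (Q l) (T1 l) (T2 l) t <= E / al l.
Proof.
move=> kl t t0; rewrite ler_pdivlMr ?(al_gt0 nw)// mulrC.
by apply: (le_trans (net_energy_link _ kl)); exact: hE.
Qed.

(** The input contains waves that have no uniform pointwise bound, so [rho] has no bounded
    derivative to rely on. Its uniform continuity has to come from the integral of [u]. *)
Lemma itg_u_unicont s : (forall s, unicont (fun t => itg (d s) 0 t)) ->
  unicont (fun t => itg (u s) 0 t).
Proof.
move=> ud.
have ux i : unicont (fun t => itg (x i) 0 t).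
  apply: (@prim_unicont _ _ (x i) (1 + 2 * E)); last exact: x_bounded.
  split; first exact: prim_reg (x_prim nw i).
  by move=> t t0; rewrite itgxx add0r.
have rx i : reg 0 (x i) := prim_reg (x_prim nw i).
(* Against this weight the power balance yields the single input [u s]. *)
pose y := @dirac_fun R S s.
have uE t : 0 <= t -> itg (u s) 0 t =
    \sum_(l | lk l) al l * (y (eA l) * (itg (rA l) 0 t - itg (x (fB l)) 0 t)
                            - y (eB l) * (itg (rB l) 0 t - itg (x (fA l)) 0 t))
    + \sum_i y i * itg (d i) 0 t.
  move=> t0.
  have rAr l : lk l -> reg 0 (rA l) by move=> kl; exact: recvA_reg (links nw kl).
  have rBr l : lk l -> reg 0 (rB l) by move=> kl; exact: recvB_reg (links nw kl).
  have rl l : lk l -> reg 0 (fun t => al l * (y (eA l) * (rA l t - x (fB l) t)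
                            - y (eB l) * (rB l t - x (fA l) t))).
    by move=> kl; apply: regZ; apply: regB; apply: regZ; apply: regB; auto.
  have rd i : reg 0 (fun t => y i * d i t) by apply: regZ; exact: d_reg nw i.
  transitivity (itg (fun t => \sum_(l | lk l) al l * (y (eA l) * (rA l t - x (fB l) t)
                            - y (eB l) * (rB l t - x (fA l) t))
    + \sum_i y i * d i t) 0 t).
    apply: itg_ext => r r0 _; rewrite -(power_balance nw y r0).
    rewrite (bigD1 s)//= /y /dirac_fun eqxx mul1r big1 ?addr0// => i /negPf is_.
    by rewrite is_ mul0r.
  rewrite (itgD _ (reg_sum rl) (reg_sum (fun i _ => rd i)))//.
  rewrite (itg_sum _ rl)// (itg_sum _ (fun i _ => rd i))//.
  congr (_ + _); last by apply: eq_bigr => i _; rewrite (itgZ _ _ (d_reg nw i)).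
  apply: eq_bigr => l kl; have [ra rb] := (rAr _ kl, rBr _ kl).
  rewrite (itgZ _ _ (regB (regZ _ (regB ra (rx _))) (regZ _ (regB rb (rx _)))))//.
  rewrite (itgB _ (regZ _ (regB ra (rx _))) (regZ _ (regB rb (rx _))))//.
  rewrite !(itgZ _ _ (regB ra (rx _)))// !(itgZ _ _ (regB rb (rx _)))//.
  by rewrite (itgB _ ra (rx _))// (itgB _ rb (rx _)).
apply: (@unicont_ext _ _ _ (fun t t0 => esym (uE t t0))).
apply: unicontD; apply: unicont_sum; last by move=> i _; exact: unicontZ.
move=> l kl.
have [ua ub] := link_unicont (links nw kl) (link_energy_bounded kl)
  (x_bounded (eA l)) (x_bounded (eB l)).
have uB (f h : R -> R) : unicont f -> unicont h -> unicont (fun t => f t - h t).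
  move=> uf /(unicontZ (-1)) uh; apply: unicont_ext (unicontD uf uh) => t _.
  by rewrite mulN1r.
by apply: unicontZ; apply: (uB _ _); apply: unicontZ; apply: (uB _ _).
Qed.

Lemma rho_unicont s : (forall s, unicont (fun t => itg (d s) 0 t)) -> unicont (rho s).
Proof.
move=> ud; have [ru hu] := rho_prim nw s.
have rr := prim_reg (rho_prim nw s).
have ur : unicont (fun t => itg (rho s) 0 t).
  apply: (@prim_unicont _ _ (rho s)); last exact: rho_bounded.
  by split => // t t0; rewrite itgxx add0r.
apply: unicont_ext (unicontD (unicont_cst (rho s 0))
  (unicontD (unicontZ (-1) ur) (itg_u_unicont s ud))) => t t0.
by rewrite [RHS]hu// (itgD _ (regN rr) (u_reg nw s))// (itgN _ rr)// mulN1r.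
Qed.

Variable pin : pred S.
Hypotheses (rho0 : forall s, tends (rho s) 0) (d0 : forall s, tends (d s) 0)
  (x_pin : forall s, pin s -> tends (x s) 0)
  (d_pin : forall s, ~~ pin s -> forall t, 0 <= t -> d s t = 0).

Lemma x_slow s : slow (x s).
Proof.
have p : prim (fun t => x s t - 2 * rho s t) (rho s).
  by apply: prim_ext (primB (x_prim nw s) (primZ 2 (rho_prim nw s))) => t t0 //; ring.
have := slowD (prim_tends0_slow p (rho0 s)) (slowZ 2 (tends_slow (rho0 s))).
by apply: slow_ext => t t0; ring.
Qed.

Let rx s : reg 0 (x s) := prim_reg (x_prim nw s).

(** The weighted sum of the x - rho is slow, so its increment over a window is bounded independently
    of [H]. The same increment is the integral of the inputs, that is, [H] times the coupling up to
    such a bound. *)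
Lemma coupling_tends0 y : tends (fun t => coupling y (x^~ t)) 0.
Proof.
apply: tends0_bal.
have zs : slow (fun t => \sum_s y s * (x s t - rho s t)).
  by apply: slow_sum => s _; apply: slowZ; apply: slowB (x_slow s) (tends_slow (rho0 s)).
have pz : prim (fun t => \sum_s y s * (x s t - rho s t)) (fun t => \sum_s y s * u s t).
  by apply: prim_sum => s _; apply: primZ; exact: z_prim.
have bz := bal_slow_diff zs.
have bd : bal (fun H t => \sum_s y s * itg (d s) t (t + H)).
  apply: bal_sum => s _; apply: balZ.
  have := balD (bal_slow_itg (d_reg nw s) (tends_slow (d0 s))) (bal_tends0 (d0 s)).
  by apply: bal_ext => H _; apply: evT => t _; ring.
have bx s := bal_slow_itg (rx s) (x_slow s).
have bl : bal (fun H t => \sum_(l | lk l) al l *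
   (y (eA l) * ((itg (rA l) t (t + H) - H * x (eB l) t)
                - (itg (x (fB l)) t (t + H) - H * x (fB l) t))
    - y (eB l) * ((itg (rB l) t (t + H) - H * x (eA l) t)
                - (itg (x (fA l)) t (t + H) - H * x (fA l) t)))).
  apply: bal_sum => l kl.
  have [_ _ b1 b2] := link_mean (links nw kl) (link_energy_bounded kl)
    (x_slow (eA l)) (x_slow (eB l)).
  by apply: balZ; apply: balB; apply: balZ; apply: balB.
apply: bal_ext (balB (balB bz bd) bl) => H H0; apply: evT => t t0.
have H0' := ltW H0.
have rAr l : lk l -> reg 0 (rA l) by move=> kl; exact: recvA_reg (links nw kl).
have rBr l : lk l -> reg 0 (rB l) by move=> kl; exact: recvB_reg (links nw kl).
have rl l : lk l -> reg 0 (fun t => al l * (y (eA l) * (rA l t - x (fB l) t)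
                          - y (eB l) * (rB l t - x (fA l) t))).
  by move=> kl; apply: regZ; apply: regB; apply: regZ; apply: regB; auto.
have rd i : reg 0 (fun t => y i * d i t) by apply: regZ; exact: d_reg nw i.
rewrite (prim_itg pz) ?lerDl//.
rewrite (@itg_ext _ _ (fun t => \sum_(l | lk l) al l * (y (eA l) * (rA l t - x (fB l) t)
                          - y (eB l) * (rB l t - x (fA l) t))
  + \sum_i y i * d i t)); last first.
  by move=> r tr _; apply: (power_balance nw); exact: le_trans tr.
rewrite (itgD _ (reg_sum rl) (reg_sum (fun i _ => rd i)))//.
rewrite (itg_sum _ rl)// (itg_sum _ (fun i _ => rd i))//.
rewrite (eq_bigr (fun s => y s * itg (d s) t (t + H)) (P := xpredT)
  (F1 := fun s => itg (fun t => y s * d s t) t (t + H))); last first.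
  by move=> i _; rewrite (itgZ _ _ (d_reg nw i)).
rewrite addrK -sumrB /coupling mulr_sumr.
apply: eq_bigr => l kl; have [ra rb] := (rAr _ kl, rBr _ kl).
rewrite (itgZ _ _ (regB (regZ _ (regB ra (rx _))) (regZ _ (regB rb (rx _)))))//.
rewrite (itgB _ (regZ _ (regB ra (rx _))) (regZ _ (regB rb (rx _))))//.
rewrite !(itgZ _ _ (regB ra (rx _)))// !(itgZ _ _ (regB rb (rx _)))//.
by rewrite (itgB _ ra (rx _))// (itgB _ rb (rx _))//; ring.
Qed.

(* The energy inner product of a state at rest with an equilibrium. *)
Definition rest_form (z y : S -> R) :=
  \sum_s y s * z s + \sum_(l | lk l) al l *
    ((T1 l * (y (eA l) - y (eB l)) * (z (eA l) - z (eB l))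
      + T2 l * (y (eA l) + y (eB l)) * (z (eA l) + z (eB l))) / 2).

Lemma rest_form_linl y : linform (rest_form^~ y).
Proof.
move=> a z z'; rewrite /rest_form mulrDr !mulr_sumr addrACA -!big_split/=.
by congr (_ + _); apply: eq_bigr => l _; ring.
Qed.

Lemma rest_form_linr z : linform (rest_form z).
Proof.
move=> a y y'; rewrite /rest_form mulrDr !mulr_sumr addrACA -!big_split/=.
by congr (_ + _); apply: eq_bigr => l _; ring.
Qed.

Lemma rest_form_def y : rest_form y y = 0 -> forall s, y s = 0.
Proof.
move=> h s; apply/eqP; rewrite -sqrf_eq0; apply/eqP/le_anti; rewrite sqr_ge0 andbT.
rewrite -h /rest_form (bigD1 s)//= expr2 -addrA lerDl; apply: addr_ge0.
  by apply: sumr_ge0 => i _; rewrite -expr2 sqr_ge0.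
apply: sumr_ge0 => l kl; have lkl := links nw kl.
rewrite mulr_ge0 ?(ltW (al_gt0 nw kl))// divr_ge0//.
by rewrite addr_ge0// -mulrA mulr_ge0 ?(delay1_ge0 lkl) ?(delay2_ge0 lkl)// -expr2 sqr_ge0.
Qed.

(* The energy inner product with an equilibrium is conserved; averaging it over
   long windows removes the waves that keep travelling on the links. *)
Lemma rest_form_tends y : (forall z, coupling z y = 0) -> (forall s, pin s -> y s = 0) ->
  exists l, tends (fun t => rest_form (x^~ t) y) l.
Proof.
move=> cy py.
pose K t := \sum_s y s * (x s t - rho s t) + \sum_(l | lk l) al l *
  link_cross (P l) (Q l) (T1 l) (T2 l) (y (eA l)) (y (eB l)) t.
have p1 : prim (fun t => \sum_s y s * (x s t - rho s t)) (fun t => \sum_s y s * u s t).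
  by apply: prim_sum => s _; apply: primZ; exact: z_prim.
have p2 : prim (fun t => \sum_(l | lk l) al l *
      link_cross (P l) (Q l) (T1 l) (T2 l) (y (eA l)) (y (eB l)) t)
    (fun t => \sum_(l | lk l) al l * (- (y (eA l) * rA l t) + y (eB l) * rB l t
       - x (eA l) t * y (eB l) + x (eB l) t * y (eA l))).
  by apply: prim_sum => l kl; apply: primZ; exact: link_cross_prim (links nw kl) _ _.
(* The derivative reduces to the coupling of [y] with the current outputs, zero by skewness. The
   outside power vanishes as well: [y] is zero on pinned cells and [d] is zero on the others. *)
have K0 t : 0 <= t -> K t = K 0.
  have : prim K (fun=> 0).
    apply: prim_ext (primD p1 p2) => // t' t0.
    rewrite (power_balance nw y t0).
    have -> : \sum_s y s * d s t' = 0.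
      apply: big1 => s _; have [ps|ps] := boolP (pin s).
        by rewrite py// mul0r.
      by rewrite d_pin// mulr0.
    rewrite addr0 -big_split/=.
    transitivity (coupling y (x^~ t')); last by rewrite coupling_skew cy oppr0.
    by apply: eq_bigr => l _; ring.
  by move=> [_ h] t0; rewrite h// itg0 addr0.
exists (K 0); apply: tends_shift; apply: tends0_bal.
have zs s : slow (fun t => x s t - rho s t).
  exact: slowB (x_slow s) (tends_slow (rho0 s)).
have rz s : reg 0 (fun t => x s t - rho s t) := prim_reg (z_prim s).
have b1 : bal (fun H t => \sum_s y s *
    ((itg (fun t => x s t - rho s t) t (t + H) - H * (x s t - rho s t))
     - H * rho s t)).
  apply: bal_sum => s _; apply: balZ; apply: balB; last exact: bal_tends0.
  exact: bal_slow_itg.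
have b2 : bal (fun H t => \sum_(l | lk l) al l *
   (itg (link_cross (P l) (Q l) (T1 l) (T2 l) (y (eA l)) (y (eB l))) t (t + H) -
    H * ((T1 l * (y (eA l) - y (eB l)) * (x (eA l) t - x (eB l) t) +
          T2 l * (y (eA l) + y (eB l)) * (x (eA l) t + x (eB l) t)) / 2))).
  apply: bal_sum => l kl; apply: balZ.
  refine (link_cross_mean (links nw kl) (link_energy_bounded kl) _ _ (x_slow _) (x_slow _)).
apply: bal_ext (balZ (-1) (balD b1 b2)) => H H0; apply: evT => t t0.
have rc l : lk l -> reg 0 (link_cross (P l) (Q l) (T1 l) (T2 l) (y (eA l)) (y (eB l))).
  by move=> kl; exact: prim_reg (link_cross_prim (links nw kl) _ _).
have e1 : H * K 0 = itg K t (t + H).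
  rewrite (@itg_ext _ _ (fun=> K 0)); last first.
    by move=> s ts _; rewrite K0//; exact: le_trans ts.
  by rewrite itg_cst ?lerDl ?ltW// addrAC subrr add0r mulrC.
rewrite mulrBr e1 /K.
rewrite (itgD _ (reg_sum (fun s _ => regZ (y s) (rz s)))
   (reg_sum (fun l kl => regZ (al l) (rc l kl))))//.
rewrite (itg_sum _ (fun s _ => regZ (y s) (rz s)))//.
rewrite (itg_sum _ (fun l kl => regZ (al l) (rc l kl)))//.
rewrite /rest_form !mulrDr opprD [RHS]addrACA !mulr_sumr -!sumrB.
congr (_ + _); apply: eq_bigr => s ks.
  by rewrite (itgZ _ _ (rz s))//; ring.
by rewrite (itgZ _ _ (rc s ks))//; ring.
Qed.

(** The observers are the couplings with unit vectors and the outputs of pinned cells, all tending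
    to 0. Their common kernel consists of equilibria that vanish on pinned cells, where
    [rest_form_tends] applies. *)
Theorem network_converges : exists xinf : S -> R,
  (forall s, tends (x s) (xinf s)) /\ forall y, coupling y xinf = 0.
Proof.
pose A (k : S + S) (z : S -> R) : R := match k with
  | inl s => coupling (@dirac_fun R S s) z
  | inr s => if pin s then z s else 0 end.
have Acoup y : (forall k, A k y = 0) -> forall z, coupling z y = 0.
  move=> h z; rewrite (linform_sum z (coupling_linl y)) big1// => s _.
  by have /= -> := h (inl s); rewrite mulr0.
have cx : forall s, exists l, tends (fun t => x s t) l.
  apply: (@observers_converge R S (S + S)%type (fun t s => x s t) A rest_form).
  - move=> [s|s]; first exact: coupling_linr.
    by move=> a y z /=; case: ifP => _ //; rewrite mulr0 addr0.
  - exact: rest_form_linl.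
  - exact: rest_form_linr.
  - move=> [s|s] /=; exists 0; first exact: coupling_tends0.
    by case ps : (pin s); [exact: x_pin|exact: tends_cst].
  - move=> y hy; apply: rest_form_tends; first exact: Acoup.
    by move=> s ps; have := hy (inr s); rewrite /= ps.
  - by move=> y _ h; exact: rest_form_def h.
exists (fun s => projT1 (cid (cx s))); split => [s|y]; first by case: (cid (cx s)).
set xi := fun s => projT1 _.
have hxi s : tends (x s) (xi s) by rewrite /xi; case: (cid (cx s)).
apply: (tends_uniq (f := fun t => coupling y (x^~ t))); last exact: coupling_tends0.
apply: tends_sum => l _; apply: tendsZ.
by apply: tendsB; apply: tendsZ; apply: tendsB; exact: hxi.
Qed.

End PassiveNetwork.

(** * The controller as a passive network *)

Section Cells.
Context {R : realType} {n q m : nat}.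
Variable g : grid R n q m.
Local Notation cell := ('I_4 * 'I_n)%type.
Local Notation line := ('I_3 * ('I_n * 'I_n))%type.

(* The cell [(k, j)] is the [k]-th of the variables zeta, pc, pi, phi of bus [j].
   The line [(c, (i, j))] joins the cell [(endA c, i)] to the cell [(endB c, j)]:
   the six signals of (ST1) form three such pairings, two per communication
   line, plus a third one inside the areas. *)
Definition k_zeta : 'I_4 := @Ordinal 4 0 isT.
Definition k_pc : 'I_4 := @Ordinal 4 1 isT.
Definition k_pi : 'I_4 := @Ordinal 4 2 isT.
Definition k_phi : 'I_4 := @Ordinal 4 3 isT.

Definition endA (c : 'I_3) : 'I_4 := nth k_zeta [:: k_zeta; k_pi; k_phi] c.
Definition endB (c : 'I_3) : 'I_4 := nth k_zeta [:: k_pc; k_zeta; k_pi] c.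

Definition lA (l : line) : cell := (endA l.1, l.2.1).
Definition lB (l : line) : cell := (endB l.1, l.2.2).
Definition lA' (l : line) : cell := (endA l.1, l.2.2).
Definition lB' (l : line) : cell := (endB l.1, l.2.1).

Definition nbr_in_area (i j : 'I_n) : bool := nbr g i j && (area g i == area g j).

Definition active (l : line) : bool :=
  nbr g l.2.1 l.2.2 && ((l.1 < 2)%N || (area g l.2.1 == area g l.2.2)).

Definition lweight (l : line) : R := alpha g l.2.1 l.2.2.

(** Tables indexed by the kind of cell merge the eight families of controller equations into one
    pair of equations per cell. *)
Definition output (x : state R n q) (s : cell) : R :=
  nth 0 [:: zeta x s.2; pc x s.2; vpi x s.2; vphi x s.2] s.1.

Definition inner (x : state R n q) (s : cell) : R :=
  nth 0 [:: rho_zeta x s.2; rho_p x s.2; rho_pi x s.2; rho_phi x s.2] s.1.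

Definition load_input (x : state R n q) (s : cell) : R :=
  nth 0 [:: 0; - (pM x s.2 - pL g s.2); - (J g s.2 * Phat g (area g s.2)); 0] s.1.

Definition rcv1 (c : 'I_3) (v : rsig R) : R := nth 0 [:: r_p v; r_zeta1 v; r_pi2 v] c.
Definition rcv2 (c : 'I_3) (v : rsig R) : R := nth 0 [:: r_zeta v; r_pi1 v; r_phi2 v] c.

Definition cell_input (w : signals R n q) (s : cell) : R :=
  let j := s.2 in
  nth 0 [:: nsum g j (fun i => r_p (rs w i j) - pc w j)
              - nsum g j (fun i => r_pi1 (rs w i j) - vpi w j);
            - (pM w j - pL g j) - nsum g j (fun i => r_zeta (rs w i j) - zeta w j);
            nsum g j (fun i => r_zeta1 (rs w i j) - zeta w j)
              - asum g j (fun i => r_phi2 (rs w i j) - vphi w j)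
              - J g j * Phat g (area g j);
            asum g j (fun i => r_pi2 (rs w i j) - vpi w j)] s.1.

Lemma sum_ord3 (F : 'I_3 -> R) : \sum_c F c =
  F (@Ordinal 3 0 isT) + F (@Ordinal 3 1 isT) + F (@Ordinal 3 2 isT).
Proof.
rewrite !big_ord_recl big_ord0 addr0 addrA.
by congr (F _ + F _ + F _); exact: val_inj.
Qed.

Lemma sum_ord4 (F : 'I_4 -> R) : \sum_k F k = F k_zeta + F k_pc + F k_pi + F k_phi.
Proof.
rewrite !big_ord_recl big_ord0 addr0 !addrA.
by congr (F _ + F _ + F _ + F _); exact: val_inj.
Qed.

Lemma sum_cells (F : cell -> R) : \sum_s F s =
  \sum_j F (k_zeta, j) + \sum_j F (k_pc, j) + \sum_j F (k_pi, j) + \sum_j F (k_phi, j).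
Proof.
rewrite (eq_bigr (fun s => F (s.1, s.2))); last by case.
by rewrite -(pair_bigA _ (fun k j => F (k, j)))/= sum_ord4.
Qed.

Lemma sum_links (F : 'I_3 -> 'I_n -> 'I_n -> R) :
  \sum_(l | active l) F l.1 l.2.1 l.2.2 =
  \sum_i \sum_(j | nbr g i j) F (@Ordinal 3 0 isT) i j +
  \sum_i \sum_(j | nbr g i j) F (@Ordinal 3 1 isT) i j +
  \sum_i \sum_(j | nbr_in_area i j) F (@Ordinal 3 2 isT) i j.
Proof.
rewrite big_mkcond/=.
rewrite (eq_bigr (fun l : line => (fun c p => if active (c, p) then F c p.1 p.2 else 0) l.1 l.2)); last by case.
rewrite -(pair_bigA _ (fun c (p : 'I_n * 'I_n) => if active (c, p) then F c p.1 p.2 else 0))/=.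
rewrite sum_ord3; congr (_ + _ + _).
- rewrite (eq_bigr (fun p : 'I_n * 'I_n => (fun i j => if nbr g i j then F (@Ordinal 3 0 isT) i j else 0) p.1 p.2)).
    rewrite -(pair_bigA _ (fun i j => if nbr g i j then F (@Ordinal 3 0 isT) i j else 0)).
    by apply: eq_bigr => i _; rewrite -big_mkcond.
  by move=> p _; rewrite /active/= andbT.
- rewrite (eq_bigr (fun p : 'I_n * 'I_n => (fun i j => if nbr g i j then F (@Ordinal 3 1 isT) i j else 0) p.1 p.2)).
    rewrite -(pair_bigA _ (fun i j => if nbr g i j then F (@Ordinal 3 1 isT) i j else 0)).
    by apply: eq_bigr => i _; rewrite -big_mkcond.
  by move=> p _; rewrite /active/= andbT.
- rewrite (eq_bigr (fun p : 'I_n * 'I_n => (fun i j => if nbr_in_area i j then F (@Ordinal 3 2 isT) i j else 0) p.1 p.2)).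
    rewrite -(pair_bigA _ (fun i j => if nbr_in_area i j then F (@Ordinal 3 2 isT) i j else 0)).
    by apply: eq_bigr => i _; rewrite -big_mkcond.
  by [].
Qed.

Lemma nbrC i j : nbr g i j = nbr g j i.
Proof. by rewrite /nbr /adj orbC. Qed.

Lemma nbr_in_areaC i j : nbr_in_area i j = nbr_in_area j i.
Proof. by rewrite /nbr_in_area nbrC eq_sym. Qed.

Hypothesis alphaC : forall i j, nbr g i j -> alpha g i j = alpha g j i.

(** Collects the terms by receiving bus. Every line occurs in both orientations, and the symmetry of
    the weights makes up for the exchange of the end points. *)
Lemma edge_sum (e : rel 'I_n) (ya yb : 'I_n -> R) (F G : 'I_n -> 'I_n -> R) :
  (forall i j, e i j = e j i) -> (forall i j, e i j -> nbr g i j) ->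
  \sum_i \sum_(j | e i j) alpha g i j * (ya i * F j i - yb j * G i j) =
  \sum_j ya j * (\sum_(i | e i j) alpha g i j * F i j) -
  \sum_j yb j * (\sum_(i | e i j) alpha g i j * G i j).
Proof.
move=> eC en.
transitivity (\sum_i \sum_(j | e i j) (ya i * (alpha g i j * F j i)) -
    \sum_i \sum_(j | e i j) (yb j * (alpha g i j * G i j))).
  rewrite -sumrB; apply: eq_bigr => i _; rewrite -sumrB; apply: eq_bigr => j _; ring.
congr (_ - _).
  apply: eq_bigr => i _; rewrite mulr_sumr.
  by apply: eq_big => [j|j eij]; [exact: eC|rewrite alphaC//; exact: en].
rewrite (exchange_big_dep xpredT)//=.
by apply: eq_bigr => j _; rewrite mulr_sumr.
Qed.

Lemma cell_input_power (w : signals R n q) (y : cell -> R) :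
  \sum_s y s * cell_input w s =
  \sum_(l | active l) lweight l *
    (y (lA l) * (rcv1 l.1 (rs w l.2.2 l.2.1) - output w (lB' l))
     - y (lB l) * (rcv2 l.1 (rs w l.2.1 l.2.2) - output w (lA' l)))
  + \sum_s y s * load_input w s.
Proof.
rewrite (@sum_links (fun c i j => alpha g i j *
    (y (endA c, i) * (rcv1 c (rs w j i) - output w (endB c, i))
     - y (endB c, j) * (rcv2 c (rs w i j) - output w (endA c, j))))).
have e0 : \sum_i \sum_(j | nbr g i j) alpha g i j *
    (y (k_zeta, i) * (r_p (rs w j i) - pc w i) - y (k_pc, j) * (r_zeta (rs w i j) - zeta w j)) =
    \sum_j y (k_zeta, j) * nsum g j (fun i => r_p (rs w i j) - pc w j) -
    \sum_j y (k_pc, j) * nsum g j (fun i => r_zeta (rs w i j) - zeta w j).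
  exact: (@edge_sum (nbr g) (fun i => y (k_zeta, i)) (fun j => y (k_pc, j))
    (fun i j => r_p (rs w i j) - pc w j) (fun i j => r_zeta (rs w i j) - zeta w j)
    nbrC (fun _ _ h => h)).
have e1 : \sum_i \sum_(j | nbr g i j) alpha g i j *
    (y (k_pi, i) * (r_zeta1 (rs w j i) - zeta w i) - y (k_zeta, j) * (r_pi1 (rs w i j) - vpi w j)) =
    \sum_j y (k_pi, j) * nsum g j (fun i => r_zeta1 (rs w i j) - zeta w j) -
    \sum_j y (k_zeta, j) * nsum g j (fun i => r_pi1 (rs w i j) - vpi w j).
  exact: (@edge_sum (nbr g) (fun i => y (k_pi, i)) (fun j => y (k_zeta, j))
    (fun i j => r_zeta1 (rs w i j) - zeta w j) (fun i j => r_pi1 (rs w i j) - vpi w j)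
    nbrC (fun _ _ h => h)).
have e2 : \sum_i \sum_(j | nbr_in_area i j) alpha g i j *
    (y (k_phi, i) * (r_pi2 (rs w j i) - vpi w i) - y (k_pi, j) * (r_phi2 (rs w i j) - vphi w j)) =
    \sum_j y (k_phi, j) * asum g j (fun i => r_pi2 (rs w i j) - vpi w j) -
    \sum_j y (k_pi, j) * asum g j (fun i => r_phi2 (rs w i j) - vphi w j).
  exact: (@edge_sum nbr_in_area (fun i => y (k_phi, i)) (fun j => y (k_pi, j))
    (fun i j => r_pi2 (rs w i j) - vpi w j) (fun i j => r_phi2 (rs w i j) - vphi w j)
    nbr_in_areaC (fun _ _ => @proj1 _ _ \o elimT andP)).
move: e0 e1 e2.
set b0 := \sum_i _; set b1 := \sum_i _; set b2 := \sum_i _ => e0 e1 e2.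
rewrite [X in _ = X + _](_ : _ = b0 + b1 + b2)// e0 e1 e2 {b0 b1 b2 e0 e1 e2}.
rewrite !sum_cells /cell_input /load_input/=.
have split2 (a b c : 'I_n -> R) : \sum_j a j * (b j - c j) = \sum_j a j * b j - \sum_j a j * c j.
  by rewrite -sumrB; apply: eq_bigr => j _; rewrite mulrBr.
rewrite !split2.
have s0 k : \sum_j y (k, j) * 0 = 0 by apply: big1 => j _; rewrite mulr0.
rewrite !s0.
have -> : \sum_j y (k_pi, j) * - (J g j * Phat g (area g j)) =
   - \sum_j y (k_pi, j) * (J g j * Phat g (area g j)).
  by rewrite -sumrN; apply: eq_bigr => j _; rewrite mulrN.
set a1 := \sum_j y (k_zeta, j) * nsum g j (fun i => r_p (rs w i j) - pc w j).
set a2 := \sum_j y (k_pc, j) * nsum g j (fun i => r_zeta (rs w i j) - zeta w j).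
set a3 := \sum_j y (k_pi, j) * nsum g j (fun i => r_zeta1 (rs w i j) - zeta w j).
set a4 := \sum_j y (k_zeta, j) * nsum g j (fun i => r_pi1 (rs w i j) - vpi w j).
set a5 := \sum_j y (k_phi, j) * asum g j (fun i => r_pi2 (rs w i j) - vpi w j).
set a6 := \sum_j y (k_pi, j) * asum g j (fun i => r_phi2 (rs w i j) - vphi w j).
set a7 := \sum_j y (k_pc, j) * - (pM w j - pL g j).
set a8 := \sum_j y (k_pi, j) * (J g j * Phat g (area g j)).
move: a1 a2 a3 a4 a5 a6 a7 a8 => a1 a2 a3 a4 a5 a6 a7 a8; ring.
Qed.

End Cells.

(** * From the scattering transformation to the link equations *)

Section Waves.
Context {R : realType} {n q m : nat}.
Variable g : grid R n q m.

Lemma even6_subproof (c : 'I_3) : ((c : nat).*2 < 6)%N.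
Proof. by case: c => [[|[|[|]]]]. Qed.
Lemma odd6_subproof (c : 'I_3) : ((c : nat).*2.+1 < 6)%N.
Proof. by case: c => [[|[|[|]]]]. Qed.
Definition even6 c : 'I_6 := Ordinal (even6_subproof c).
Definition odd6 c : 'I_6 := Ordinal (odd6_subproof c).

(** [Es] is block diagonal with quarter turns as blocks, so each of the three pairings travels on
    its own. *)
Lemma Es_even (v : 'cV[R]_6) c : (Es R *m v) (even6 c) 0 = - v (odd6 c) 0.
Proof.
rewrite mxE (bigD1 (odd6 c))//= big1 => [|k kc].
  rewrite /Es !mxE/=.
  by case: c => [[|[|[|]]]]//= i; rewrite ?eqxx/= ?mulr1 ?mul1r ?mulN1r ?addr0.
rewrite /Es !mxE.
move: kc; case: c => [[|[|[|]]]]//= i; case: k => [[|[|[|[|[|[|]]]]]]]//= j kc;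
  by rewrite ?mul0r ?mulr0 ?mul0r.
Qed.

Lemma Es_odd (v : 'cV[R]_6) c : (Es R *m v) (odd6 c) 0 = v (even6 c) 0.
Proof.
rewrite mxE (bigD1 (even6 c))//= big1 => [|k kc].
  rewrite /Es !mxE/=.
  by case: c => [[|[|[|]]]]//= i; rewrite ?eqxx/= ?mulr1 ?mul1r ?mulN1r ?addr0.
rewrite /Es !mxE.
move: kc; case: c => [[|[|[|]]]]//= i; case: k => [[|[|[|[|[|[|]]]]]]]//= j kc;
  by rewrite ?mul0r ?mulr0 ?mul0r.
Qed.


Definition eps (i j : 'I_n) : R := if (i, j) \in comm g then 1 else -1.

(* The factor absorbs the normalization of (ST1) and its dependence on the
   orientation of the line: both ends then obey the equations of [link]. *)
Definition wave1 (v : signals R n q) (c : 'I_3) i j : R :=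
  Num.sqrt 2 * eps i j * s_out v i j (even6 c) 0.
Definition wave2 (v : signals R n q) (c : 'I_3) i j : R :=
  Num.sqrt 2 * eps i j * s_out v i j (odd6 c) 0.

Lemma sigma_in_area i j : area g i == area g j -> sigma g i j = 1.
Proof.
by move=> ij; rewrite /sigma /adj !inE/= (eqP ij) eqxx !andbF.
Qed.

Lemma sigmaC i j : sigma g i j = sigma g j i.
Proof. by rewrite /sigma /adj orbC. Qed.

Lemma rvec_comp v c i j : active g (c, (i, j)) ->
  rvec g v i j (even6 c) 0 = rcv1 c (rs v i j) /\
  rvec g v i j (odd6 c) 0 = rcv2 c (rs v i j).
Proof.
rewrite /active/= => /andP[_]; rewrite !mxE.
case: c => [[|[|[|]]]]//= i0 sij.
by rewrite sigma_in_area// !mul1r.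
Qed.

Lemma yvec_comp v c i j : active g (c, (i, j)) ->
  yvec g v i j (even6 c) 0 = output v (endA c, j) /\
  yvec g v i j (odd6 c) 0 = - output v (endB c, j).
Proof.
rewrite /active/= => /andP[_]; rewrite !mxE.
case: c => [[|[|[|]]]]//= i0 sij.
by rewrite sigma_in_area// !mul1r.
Qed.

Hypothesis hcomm : simple_oriented (comm g).

Lemma sqrt2_neq0 : Num.sqrt (2 : R) != 0.
Proof. by rewrite sqrtr_eq0 -ltNge. Qed.

Lemma wave_vec (w : R -> signals R n q) (T : 'I_n -> 'I_n -> R) i j t :
  scattering g w -> transmission g T w -> nbr g i j -> 0 <= t ->
  rvec g (w t) i j =
    (Num.sqrt 2 * eps i j) *: (Es R *m s_out (w (t - T i j)) i j) - yvec g (w t) i j /\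
  (Num.sqrt 2 * eps j i) *: s_out (w t) j i = yvec g (w t) i j - rvec g (w t) i j.
Proof.
move=> sc tr nij t0.
have nji : nbr g j i by rewrite nbrC.
have := tr _ _ nji _ t0; set s := Es R *m _ => hs.
have s2 := sqrt2_neq0.
have [cij|cij] := boolP ((i, j) \in comm g).
  have [_ cji] := hcomm cij.
  have [_ _ h3 h4] := sc _ _ cij _ t0.
  rewrite /eps cij (negPf cji) mulr1 mulrN1; split.
    by rewrite -hs h3 scalerA divff// scale1r addrK.
  by rewrite h4 scalerA mulNr divff// scaleN1r opprB.
have cji : (j, i) \in comm g by move: nij; rewrite /nbr /adj (negPf cij).
have [h1 h2 _ _] := sc _ _ cji _ t0.
rewrite /eps (negPf cij) cji mulr1 mulrN1; split.
  by rewrite -hs h2 scalerA mulrNN divff// scale1r addrK.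
by rewrite h1 scalerA mulrN divff// scaleN1r opprB.
Qed.

Lemma wave_eqs (w : R -> signals R n q) (T : 'I_n -> 'I_n -> R) c i j t :
  scattering g w -> transmission g T w -> active g (c, (i, j)) -> 0 <= t ->
  [/\ rcv1 c (rs (w t) i j) = - wave2 (w (t - T i j)) c i j - output (w t) (endA c, j),
      rcv2 c (rs (w t) i j) = wave1 (w (t - T i j)) c i j + output (w t) (endB c, j),
      wave1 (w t) c j i = 2 * output (w t) (endA c, j) + wave2 (w (t - T i j)) c i j
    & wave2 (w t) c j i = - (2 * output (w t) (endB c, j)) - wave1 (w (t - T i j)) c i j].
Proof.
move=> sc tr aij t0; have nij : nbr g i j by case/andP: aij.
have [hr hv] := wave_vec sc tr nij t0.
have [r1 r2] := rvec_comp (w t) aij; have [y1 y2] := yvec_comp (w t) aij.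
have E (A B C : 'cV[R]_6) a k : A = a *: B - C -> A k 0 = a * B k 0 - C k 0.
  by move=> ->; rewrite !mxE.
have E' (A B C : 'cV[R]_6) a k : a *: A = B - C -> a * A k 0 = B k 0 - C k 0.
  by move=> h; have := congr1 (fun D : 'cV_6 => D k 0) h; rewrite !mxE.
have := E _ _ _ _ (even6 c) hr; have := E _ _ _ _ (odd6 c) hr.
have := E' _ _ _ _ (even6 c) hv; have := E' _ _ _ _ (odd6 c) hv.
rewrite Es_even Es_odd r1 r2 y1 y2 /wave1 /wave2.
set s1 := s_out (w t) j i _ _; set s2 := s_out (w t) j i _ _.
set s3 := s_out _ i j _ _; set s4 := s_out _ i j _ _.
by move=> -> -> -> ->; split; ring.
Qed.

End Waves.

(** * Equilibria and OGR-2 *)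

Section Rest.
Context {R : realType} {n q m : nat}.
Variable g : grid R n q m.
Variable T : 'I_n -> 'I_n -> R.

Lemma solves_ext (x y f h : R -> R) : (forall t, x t = y t) -> (forall t, f t = h t) ->
  solves x f -> solves y h.
Proof. by move=> /funext-> /funext->. Qed.

Lemma controllerP (w : R -> signals R n q) : controller g w <-> forall s,
  solves (fun t => inner (w t) s) (fun t => - inner (w t) s + cell_input g (w t) s) /\
  solves (fun t => output (w t) s) (fun t => - inner (w t) s + 2 * cell_input g (w t) s).
Proof.
split=> [h [[k kp] j]|h j].
  have [[h1 h2] [[h3 h4] [[h5 h6] [h7 h8]]]] := h j.
  case: k kp => [|[|[|[|//]]]] kp; split.
  - by move: h1; apply: solves_ext => t //=; rewrite /inner /cell_input/=; ring.
  - by move: h2; apply: solves_ext => t //=; rewrite /inner /cell_input/=; ring.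
  - by move: h3; apply: solves_ext => t //=; rewrite /inner /cell_input/=; ring.
  - by move: h4; apply: solves_ext => t //=; rewrite /inner /cell_input/=; ring.
  - by move: h5; apply: solves_ext => t //=; rewrite /inner /cell_input/=; ring.
  - by move: h6; apply: solves_ext => t //=; rewrite /inner /cell_input/=; ring.
  - by move: h7; apply: solves_ext => t //=; rewrite /inner /cell_input/=; ring.
  - by move: h8; apply: solves_ext => t //=; rewrite /inner /cell_input/=; ring.
have [h1 h2] := h (k_zeta, j); have [h3 h4] := h (k_pc, j).
have [h5 h6] := h (k_pi, j); have [h7 h8] := h (k_phi, j).
split; last split; last split; split.
- by move: h1; apply: solves_ext => t //=; rewrite /inner /cell_input/=; ring.
- by move: h2; apply: solves_ext => t //=; rewrite /inner /cell_input/=; ring.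
- by move: h3; apply: solves_ext => t //=; rewrite /inner /cell_input/=; ring.
- by move: h4; apply: solves_ext => t //=; rewrite /inner /cell_input/=; ring.
- by move: h5; apply: solves_ext => t //=; rewrite /inner /cell_input/=; ring.
- by move: h6; apply: solves_ext => t //=; rewrite /inner /cell_input/=; ring.
- by move: h7; apply: solves_ext => t //=; rewrite /inner /cell_input/=; ring.
- by move: h8; apply: solves_ext => t //=; rewrite /inner /cell_input/=; ring.
Qed.

Definition rest_rs (x : state R n q) (i : 'I_n) : rsig R :=
  RSig (pc x i) (zeta x i) (zeta x i) (vpi x i) (vpi x i) (vphi x i).

(** [rvec] and [yvec] do not look at the waves, so the zeros are placeholders; [rest_sig] then
    computes the actual waves from these vectors. *)
Definition base_sig (x : state R n q) : signals R n q :=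
  Signals x (fun i _ => rest_rs x i) (fun _ _ => 0) (fun _ _ => 0).

(* The signals that circulate when the state [x] is kept constant. *)
Definition rest_sig (x : state R n q) : signals R n q :=
  let c := (Num.sqrt (2 : R))^-1 in
  let sg i j := if (i, j) \in comm g then - c else c in
  Signals x (fun i _ => rest_rs x i)
    (fun i j => sg i j *: (rvec g (base_sig x) j i - yvec g (base_sig x) j i))
    (fun i j => sg i j *: (rvec g (base_sig x) j i + yvec g (base_sig x) j i)).

(** Equilibria with delays and waves eliminated. [equilibrium_rest] and [rest_equilibrium] pass
    between the two descriptions. *)
Record rest (x : state R n q) : Prop := Rest {
  rest_omega : forall j, omega x j = 0;
  rest_load : forall j, j \notin gen g -> pM x j = 0;
  rest_gen : forall j, j \in gen g -> pc x j = derive1 (Q g j) (pM x j);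
  rest_flow : forall j, - pL g j + pM x j
    - \sum_(l | src g l == j) flow g x l + \sum_(l | dst g l == j) flow g x l = 0;
  rest_inner : forall s, inner x s = 0;
  rest_input : forall s, cell_input g (rest_sig x) s = 0 }.

Lemma activeC c i j : active g (c, (i, j)) = active g (c, (j, i)).
Proof. by rewrite /active/= nbrC [area g i == _]eq_sym. Qed.

Hypothesis hcomm : simple_oriented (comm g).
Hypothesis hT : forall i j, nbr g i j -> 0 <= T i j.

Lemma rest_sig_rcv x c i j : rcv1 c (rs (rest_sig x) i j) = output x (endB c, i) /\
  rcv2 c (rs (rest_sig x) i j) = output x (endA c, i).
Proof. by case: c => [[|[|[|]]]]. Qed.

Lemma cell_input_rest w s : (forall c i j, active g (c, (i, j)) ->
    rcv1 c (rs w i j) = output w (endB c, i) /\ rcv2 c (rs w i j) = output w (endA c, i)) ->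
  cell_input g w s = cell_input g (rest_sig w) s.
Proof.
move=> h.
have h0 i j : nbr g i j -> r_p (rs w i j) = pc w i /\ r_zeta (rs w i j) = zeta w i.
  by move=> nij; have := h (@Ordinal 3 0 isT) i j; rewrite /active/= nij; exact.
have h1 i j : nbr g i j -> r_zeta1 (rs w i j) = zeta w i /\ r_pi1 (rs w i j) = vpi w i.
  by move=> nij; have := h (@Ordinal 3 1 isT) i j; rewrite /active/= nij; exact.
have h2 i j : nbr g i j && (area g i == area g j) ->
    r_pi2 (rs w i j) = vpi w i /\ r_phi2 (rs w i j) = vphi w i.
  by move=> nij; have := h (@Ordinal 3 2 isT) i j; rewrite /active/= nij; exact.
have e0 F G j : (forall i, nbr g i j -> F i = G i) -> nsum g j F = nsum g j G.
  by move=> FG; apply: eq_bigr => i nij; rewrite FG.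
have e1 F G j : (forall i, nbr g i j && (area g i == area g j) -> F i = G i) ->
    asum g j F = asum g j G.
  by move=> FG; apply: eq_bigr => i nij; rewrite FG.
case: s => [[[|[|[|[|//]]]] kp] j]; rewrite /cell_input/=.
- congr (_ - _); apply: e0 => i /= nij; first by have [-> _] := h0 _ _ nij.
  by have [_ ->] := h1 _ _ nij.
- by congr (_ - _); apply: e0 => i /= nij; have [_ ->] := h0 _ _ nij.
- congr (_ - _ - _); first by apply: e0 => i /= nij; have [-> _] := h1 _ _ nij.
  by apply: e1 => i /= nij; have [_ ->] := h2 _ _ nij.
- by apply: e1 => i /= nij; have [-> _] := h2 _ _ nij.
Qed.

(** A constant trajectory does not feel the delays, and the wave equations of both directions form a
    linear system that determines the waves from the outputs. *)
Lemma equilibrium_rcv w c i j : equilibrium g T w -> active g (c, (i, j)) ->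
  rcv1 c (rs w i j) = output w (endB c, i) /\ rcv2 c (rs w i j) = output w (endA c, i).
Proof.
move=> [_ sc tr _] aij; have aji : active g (c, (j, i)) by rewrite activeC.
have [a1 a2 a3 a4] := wave_eqs hcomm sc tr aij (lexx 0).
have [b1 b2 b3 b4] := wave_eqs hcomm sc tr aji (lexx 0).
by split; lra.
Qed.

Lemma flow_balance (x : phys R n q) :
  \sum_j (- \sum_(l | src g l == j) flow g x l + \sum_(l | dst g l == j) flow g x l) = 0.
Proof.
have e (f : 'I_q -> 'I_n) : \sum_j \sum_(l | f l == j) flow g x l = \sum_l flow g x l.
  rewrite (exchange_big_dep xpredT)//=; apply: eq_bigr => l _.
  by rewrite (eq_bigl (fun j => j == f l)) ?big_pred1_eq// => j; rewrite eq_sym.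
by rewrite big_split/= sumrN !e addNr.
Qed.

Lemma connected_const (A : {set 'I_n * 'I_n}) (f : 'I_n -> R) : connected_graph A ->
  (forall i j, (i, j) \in A -> f i = f j) -> forall i j, f i = f j.
Proof.
move=> cA hA i j; have /connectP[p pp ->] := cA i j.
elim: p i pp => [//|k p IH] i /= /andP[ik pp]; rewrite -(IH _ pp).
by case/orP: ik => [/hA //|/hA ->].
Qed.

(** Summation by parts; the factor 1/2 compensates for counting each edge twice. *)
Lemma laplacian_form (e : rel 'I_n) (f h : 'I_n -> R) :
  (forall i j, e i j = e j i) -> (forall i j, e i j -> alpha g i j = alpha g j i) ->
  \sum_j h j * \sum_(i | e i j) alpha g i j * (f i - f j) =
  - (\sum_j \sum_(i | e i j) alpha g i j * ((f i - f j) * (h i - h j)) / 2).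
Proof.
move=> eC aC.
pose A := \sum_j \sum_(i | e i j) alpha g i j * (h j * (f i - f j)).
pose B := \sum_j \sum_(i | e i j) alpha g i j * (h i * (f i - f j)).
have e1 : \sum_j h j * \sum_(i | e i j) alpha g i j * (f i - f j) = A.
  by apply: eq_bigr => j _; rewrite mulr_sumr; apply: eq_bigr => i _; ring.
have e2 : \sum_j \sum_(i | e i j) alpha g i j * ((f i - f j) * (h i - h j)) / 2 = (B - A) / 2.
  rewrite /A /B -sumrB mulr_suml; apply: eq_bigr => j _.
  by rewrite -sumrB mulr_suml; apply: eq_bigr => i _; ring.
have e3 : B = - A.
  rewrite /A /B (exchange_big_dep xpredT)//= -sumrN; apply: eq_bigr => i _.
  rewrite -sumrN; apply: eq_big => [j|j eij]; first exact: eC.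
  by rewrite aC//; ring.
by rewrite e1 e2 e3; field.
Qed.

Hypothesis hnet : network_ok g.

Let alphaC i j : nbr g i j -> alpha g i j = alpha g j i.
Proof. by move=> nij; have [_ _ _ _ h] := hnet; have [] := h _ _ nij. Qed.

Lemma laplacian_sum (e : rel 'I_n) (f h : 'I_n -> R) :
  (forall i j, e i j = e j i) -> (forall i j, e i j -> nbr g i j) ->
  (forall i j, e i j -> h i = h j) ->
  \sum_j h j * \sum_(i | e i j) alpha g i j * (f i - f j) = 0.
Proof.
move=> eC en hh; rewrite laplacian_form//; last by move=> i j /en; exact: alphaC.
rewrite big1 ?oppr0// => j _; rewrite big1// => i eij.
by rewrite (hh _ _ eij) subrr !mulr0 mul0r.
Qed.

Lemma laplacian_kernel (e : rel 'I_n) (f : 'I_n -> R) :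
  (forall i j, e i j = e j i) -> (forall i j, e i j -> nbr g i j) ->
  (forall j, \sum_(i | e i j) alpha g i j * (f i - f j) = 0) ->
  forall i j, e i j -> f i = f j.
Proof.
move=> eC en h i j eij.
have ag k l : e k l -> 0 < alpha g k l.
  by move=> /en nkl; have [_ _ _ _ ha] := hnet; have [] := ha _ _ nkl.
have h0 k l : e k l -> 0 <= alpha g k l * ((f k - f l) * (f k - f l)) / 2.
  by move=> ekl; rewrite divr_ge0// mulr_ge0 ?(ltW (ag _ _ ekl))// -expr2 sqr_ge0.
have := laplacian_form f f eC (fun k l ekl => alphaC (en _ _ ekl)).
rewrite big1 => [|k _]; last by rewrite h mulr0.
move=> /esym/eqP; rewrite oppr_eq0 psumr_eq0; last first.
  by move=> k _; apply: sumr_ge0 => l; exact: h0.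
move=> /allP/(_ j (mem_index_enum _)) /=; rewrite psumr_eq0; last by move=> l; exact: h0.
move=> /allP/(_ i (mem_index_enum _)) /=; rewrite eij/=.
rewrite mulf_eq0 invr_eq0 pnatr_eq0 orbF mulf_eq0 (gt_eqF (ag _ _ eij))/= -expr2.
by rewrite sqrf_eq0 subr_eq0 => /eqP.
Qed.

(** Constant angles make [omega] constant on the connected grid. In the sum of the power balances
    over all buses the flows cancel, and the pc cells force the injections to balance the loads, so
    [omega] times the total damping is zero. *)
Lemma equilibrium_rest w : equilibrium g T w -> rest w.
Proof.
move=> eqw; have [[[pA pG pL'] [gG gL] ct] sc tr _] := eqw.
have [[_ _ cl] _ _ [hG hLam _ _] _] := hnet.
have inp s : inner w s = 0 /\ cell_input g w s = 0.
  have [/solves_cst h1 /solves_cst h2] := (controllerP _).1 ct s.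
  by split; lra.
have inp' s : cell_input g (rest_sig w) s = 0.
  by rewrite -cell_input_rest ?(inp s).2// => c i j; exact: equilibrium_rcv.
have wconst i j : omega w i = omega w j.
  apply: (connected_const (f := omega w) cl) => {}i {}j /imsetP[l _ e].
  have /solves_cst h := pA l; move: h; rewrite /src /dst -e/=; lra.
have bal j : - pL g j + pM w j - Lam g j * omega w j
    - \sum_(l | src g l == j) flow g w l + \sum_(l | dst g l == j) flow g w l = 0.
  have [jG|jG] := boolP (j \in gen g).
    by have /solves_cst := pG j jG.
  by have := pL' j jG 0 (lexx 0); rewrite (gL j jG 0 (lexx 0)) addr0 => <-.
have sumP : \sum_j (pM w j - pL g j) = 0.
  have h := laplacian_sum (e := nbr g) (zeta w) (h := fun=> 1) (@nbrC _ _ _ _ g)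
    (fun _ _ h => h) (fun _ _ _ => erefl).
  rewrite (eq_bigr (fun j => - (1 * \sum_(i | nbr g i j) alpha g i j * (zeta w i - zeta w j)))).
    by rewrite sumrN h oppr0.
  move=> j _; have := inp' (k_pc, j); rewrite /cell_input/= -/(nsum g j _); lra.
have w0 j : omega w j = 0.
  have : \sum_k Lam g k * omega w j = 0.
    rewrite (eq_bigr (fun k => (pM w k - pL g k) + (- \sum_(l | src g l == k) flow g w l
      + \sum_(l | dst g l == k) flow g w l))).
      by rewrite big_split/= sumP flow_balance addr0.
    by move=> k _; have := bal k; rewrite (wconst k j); lra.
  rewrite -mulr_suml => /eqP; rewrite mulf_eq0 => /orP[|/eqP //].
  rewrite psumr_eq0; last by move=> k _; rewrite ltW.
  by move=> /allP/(_ j (mem_index_enum _)) /=; rewrite gt_eqF.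
split => //.
- by move=> j jG; exact: gL jG 0 (lexx 0).
- move=> j jG; have /solves_cst := gG j jG; have [Mp tp kgp kcp] := hG _ jG.
  rewrite /gen_input w0 subr0 => h.
  have e : kg g j * (pM w j / kg g j) = pM w j by rewrite mulrC divfK// gt_eqF.
  have : kg g j * kc g j * (pc w j - derive1 (Q g j) (pM w j)) = 0.
    by move: h; move: e; set X := pM w j / _ => e h; lra.
  by move/eqP; rewrite mulf_eq0 mulf_eq0 (gt_eqF kgp) (gt_eqF kcp) subr_eq0 => /eqP.
- by move=> j; have := bal j; rewrite w0 mulr0 subr0.
- by move=> s; exact: (inp s).1.
Qed.


(** At rest the received signals are a quarter turn of the outputs sent by the neighbour, and the
    square of [Es] is minus the identity. This makes the waves of [rest_sig] satisfy the
    transmission law for every delay. *)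
Lemma base_Es x i j : Es R *m yvec g (base_sig x) j i = rvec g (base_sig x) i j /\
  Es R *m rvec g (base_sig x) i j = - yvec g (base_sig x) j i.
Proof.
have half (k : 'I_6) : (exists c, k = even6 c) \/ (exists c, k = odd6 c).
  case: k => [[|[|[|[|[|[|//]]]]]] kp]; [left|right|left|right|left|right];
    [exists (@Ordinal 3 0 isT)|exists (@Ordinal 3 0 isT)|exists (@Ordinal 3 1 isT)
    |exists (@Ordinal 3 1 isT)|exists (@Ordinal 3 2 isT)|exists (@Ordinal 3 2 isT)];
    exact: val_inj.
have sC := sigmaC g i j.
split; apply/colP => k; have [[c ->]|[c ->]] := half k; rewrite ?Es_even ?Es_odd !mxE;
  case: c => [[|[|[|]]]]//= _; rewrite ?sC ?opprK//.
Qed.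

Lemma rest_equilibrium x : rest x -> equilibrium g T (rest_sig x).
Proof.
move=> rx; have s2 := @sqrt2_neq0 R.
split.
- split.
  + split => [l|j jG|j jG t _] /=.
    * by apply: cst_solves => t _; rewrite !rest_omega// subrr.
    * apply: cst_solves => t _; have := rest_flow rx j.
      by rewrite rest_omega// mulr0 subr0.
    * have := rest_flow rx j; rewrite (rest_omega rx) (rest_load rx)// mulr0 subr0.
      by rewrite addr0.
  + split => [j jG|j jG t _] /=; last exact: rest_load.
    apply: cst_solves => t _; have [_ _ _ [hG _ _ _] _] := hnet.
    have [_ _ kgp _] := hG _ jG.
    rewrite /gen_input/= (rest_omega rx) (rest_gen rx jG) subr0 addrAC subrr add0r.
    by rewrite mulrC divfK ?gt_eqF// addNr.
  + apply/controllerP => s; split; apply: cst_solves => t _;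
    by rewrite (rest_input rx) (rest_inner rx) ?mulr0 oppr0 addr0.
- move=> i j cij t _ /=; have [_ cji] := hcomm cij.
  by rewrite cij (negPf cji).
- move=> i j nij t _ /=.
  have [h1 h2] := base_Es x i j; have [h3 h4] := base_Es x j i.
  rewrite -scalemxAr mulmxBr h2 h3 -opprD scalerN -scaleNr [in RHS]addrC.
  have [cij|cij] := boolP ((i, j) \in comm g).
    by have [_ /negPf ->] := hcomm cij.
  by move: nij; rewrite /nbr /adj (negPf cij)/= => ->; rewrite opprK.
- move=> i j nij c; split; first exact: measurable_cst.
  by move=> b; exists `|s_out (rest_sig x) i j c ord0|.
Qed.

End Rest.

(** * Strictly convex functions and their derivatives *)

Section Convexity.
Context {R : realType}.
Variable f : R -> R.
Hypotheses (df : forall x, derivable f x 1) (cf : strictly_convex f).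

Lemma convex_tangent_le x y : x != y -> derive1 f x * (y - x) <= f y - f x.
Proof.
move=> xy; have d0 : 0 < `|y - x| by rewrite normr_gt0 subr_eq0 eq_sym.
apply/ler_addgt0Pr => e e0.
have e'0 : 0 < e / `|y - x| by rewrite divr_gt0.
have : (fun h => h^-1 *: (f (h + x) - f x)) @ 0^' --> derive1 f x.
  have := @df x; rewrite /derivable.
  rewrite (_ : (fun h => _) = (fun h => h^-1 *: (f (h + x) - f x)))//.
  by apply/funext => h; rewrite /= [h *: 1]mulr1.
move=> /cvgrPdist_le /(_ _ e'0) [r /= r0 hr].
(* Short enough for the difference quotient to be within [e / |y - x|] of the derivative, and below
   1 for the convexity inequality. *)
pose t := Num.min (1 / 2) (r / (2 * `|y - x|)).
have t0 : 0 < t by rewrite lt_min !divr_gt0// mulr_gt0.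
have t1 : t < 1 by rewrite gt_min; apply/orP; left; lra.
have tr : t * `|y - x| < r.
  have : t <= r / (2 * `|y - x|) by rewrite ge_min lexx orbT.
  rewrite ler_pdivlMr ?mulr_gt0//; nra.
have hn : t * (y - x) != 0 by apply: mulf_neq0; [rewrite lt0r_neq0|rewrite subr_eq0 eq_sym].
have := hr (t * (y - x)); rewrite /= sub0r normrN normrM (gtr0_norm t0) => /(_ tr hn).
have := cf (x := y) (y := x) (t := t); rewrite eq_sym => /(_ xy t0 t1).
have -> : t * y + (1 - t) * x = t * (y - x) + x by ring.
set F := f (t * (y - x) + x) => h1.
have -> : (t * (y - x))^-1 *: (F - f x) = (F - f x) / (t * (y - x)) by rewrite -[LHS]/(_ * _) mulrC.
set s := (F - f x) / _ => h2.
have hs : s * (y - x) * t = F - f x.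
  by rewrite /s -mulrA [(y - x) * t]mulrC divfK.
have h3 : s * (y - x) <= f y - f x by rewrite -(ler_pM2r t0) hs; lra.
have h4 : (derive1 f x - s) * (y - x) <= e.
  apply: (le_trans (ler_norm _)); rewrite normrM.
  by rewrite -ler_pdivlMr.
by lra.
Qed.

Lemma convex_tangent x y : f x + derive1 f x * (y - x) <= f y.
Proof.
have [->|xy] := eqVneq x y; first by rewrite subrr mulr0 addr0.
by have := convex_tangent_le xy; lra.
Qed.

(** Strictness is gained at the midpoint, where the tangent inequality is compared with strict
    convexity. *)
Lemma convex_tangent_lt x y : x != y -> f x + derive1 f x * (y - x) < f y.
Proof.
move=> xy; have h := @cf x y (1 / 2) xy; have := h ltac:(lra) ltac:(lra).
have := convex_tangent x (1 / 2 * x + (1 - 1 / 2) * y).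
have -> : 1 / 2 * x + (1 - 1 / 2) * y - x = (y - x) / 2 by field.
by lra.
Qed.

Lemma derive1_incr x y : x < y -> derive1 f x < derive1 f y.
Proof.
move=> xy; have := convex_tangent_lt (negbT (lt_eqF xy)).
have := convex_tangent_lt (negbT (gt_eqF xy)).
move=> h1 h2; rewrite ltNge; apply/negP => h; nra.
Qed.

Lemma derive1_mono x y : 0 <= (x - y) * (derive1 f x - derive1 f y).
Proof.
have [xy|xy|->] := ltgtP x y; last by rewrite subrr mul0r.
  by have := derive1_incr xy; nra.
by have := derive1_incr xy; nra.
Qed.

(** Monotonicity of the derivative reduces all far points to the two points y + e and y - e. This is
    the margin that [barbalat] asks for in the case of p^M, obtained without strong convexity. *)
Lemma derive1_gap y (e : R) : 0 < e -> exists2 m, 0 < m &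
  forall x, e <= `|x - y| -> m <= (x - y) * (derive1 f x - derive1 f y).
Proof.
move=> e0.
pose m1 := derive1 f (y + e) - derive1 f y.
pose m2 := derive1 f y - derive1 f (y - e).
have m10 : 0 < m1 by rewrite subr_gt0; apply: derive1_incr; rewrite ltrDl.
have m20 : 0 < m2 by rewrite subr_gt0; apply: derive1_incr; rewrite gtrBl.
exists (e * Num.min m1 m2); first by rewrite mulr_gt0// lt_min m10.
have mono a b : a <= b -> derive1 f a <= derive1 f b.
  by rewrite le_eqVlt => /predU1P[->//|/derive1_incr/ltW].
move=> x; have [h|h] := leP 0 (x - y).
  rewrite ger0_norm// => ex.
  have hm : m1 <= derive1 f x - derive1 f y by rewrite lerB//; apply: mono; lra.
  have : Num.min m1 m2 <= m1 by rewrite ge_min lexx.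
  by move: (Num.min m1 m2) => k; nra.
rewrite ltr0_norm// => ex.
have hm : m2 <= derive1 f y - derive1 f x by rewrite lerB//; apply: mono; lra.
have : Num.min m1 m2 <= m2 by rewrite ge_min lexx orbT.
by move: (Num.min m1 m2) => k; nra.
Qed.

End Convexity.

(** * States at rest solve OGR-2 *)

Section Optimality.
Context {R : realType} {n q m : nat}.
Variable g : grid R n q m.
Hypothesis hnet : network_ok g.

Lemma area_connected (f : 'I_n -> R) :
  (forall i j, nbr_in_area g i j -> f i = f j) ->
  forall i j, area g i = area g j -> f i = f j.
Proof.
move=> hf; have [_ [_ _ hm] hgate _ _] := hnet.
(* There are as many components as areas, each inside one area and none empty. *)
pose e := adj (comm g :\: inter_comm g)%SET.
have eE i j : e i j = nbr_in_area g i j.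
  rewrite /e /adj /nbr_in_area /nbr /adj !inE/= [area g j == _]eq_sym.
  by case: (area g i == area g j); case: ((i, j) \in comm g); case: ((j, i) \in comm g).
have eC : connect_sym e.
  by apply: sym_connect_sym => i j; rewrite !eE nbr_in_areaC.
have ec (A : Type) (h : 'I_n -> A) : (forall i j, nbr_in_area g i j -> h i = h j) ->
    forall i j, connect e i j -> h i = h j.
  move=> hh i j /connectP[p pp ->]; elim: p i pp => [//|k p IH] i /= /andP[ik pp].
  by rewrite -(IH _ pp); apply: hh; rewrite -eE.
have area_root i : area g (fingraph.root e i) = area g i.
  apply/esym/(ec _ (area g)); last exact: connect_root.
  by move=> k l /andP[_ /eqP].
have inj_area : {in fingraph.roots e &, injective (area g)}.
  apply/image_injP; rewrite eqn_leq leq_image_card/=.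
  have -> : #|fingraph.roots e| = m by rewrite -hm; apply: eq_card => i; rewrite !inE andbT.
  rewrite -[X in (X <= _)%N](card_ord m); apply: subset_leq_card.
  apply/fintype.subsetP => k _; rewrite -(hgate k) -area_root. apply: fintype.image_f.
  exact: roots_root.
move=> i j ij.
have rij : fingraph.root e i = fingraph.root e j.
  by apply: inj_area; rewrite ?area_root//; apply: roots_root.
by apply: ec hf _ _ _; rewrite -(root_connect eC) rij.
Qed.

Let hcomm : simple_oriented (comm g).
Proof. by have [_ []] := hnet. Qed.

Let alphaC i j : nbr g i j -> alpha g i j = alpha g j i.
Proof. by move=> nij; have [_ _ _ _ h] := hnet; have [] := h _ _ nij. Qed.

(** The entry of [Dhat] is zero on a line with both or none of its ends in area [k], so the sum may
    be extended to all lines and regrouped by bus. *)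
Lemma tie_sum (p : 'I_q -> R) k : \sum_(l in tie_lines g k) Dhat g k l * p l =
  \sum_(j | area g j == k) (- \sum_(l | src g l == j) p l + \sum_(l | dst g l == j) p l).
Proof.
have [[_ sl _] _ _ _ _] := hnet.
have DE l : Dhat g k l = (area g (dst g l) == k)%:R - (area g (src g l) == k)%:R.
  have [sd _] : src g l != dst g l /\ (dst g l, src g l) \notin lines g.
    by apply: sl; apply/imsetP; exists l => //; rewrite /src /dst; case: (line g l).
  rewrite mxE (bigD1 (src g l))//= (bigD1 (dst g l)) /=; last by rewrite eq_sym.
  rewrite big1 => [|j /andP[j1 j2]]; last first.
    by rewrite !mxE [src g l == j]eq_sym (negPf j1) [dst g l == j]eq_sym (negPf j2) mulr0.
  rewrite !mxE eqxx (negPf sd) eqxx.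
  by case: eqP => _; case: eqP => _ /=; ring.
rewrite big_mkcond/= (eq_bigr (fun l => Dhat g k l * p l)); last first.
  move=> l _; rewrite !inE; case: ifPn => //; rewrite negbK => /eqP h.
  by rewrite DE h subrr mul0r.
have e (f : 'I_q -> 'I_n) : \sum_(j | area g j == k) \sum_(l | f l == j) p l =
    \sum_l (area g (f l) == k)%:R * p l.
  rewrite (exchange_big_dep xpredT)//=; apply: eq_bigr => l _.
  case: (boolP (area g (f l) == k)) => h.
    rewrite mul1r (eq_bigl (fun j => j == f l)) ?big_pred1_eq// => j.
    by rewrite [f l == j]eq_sym; case: (eqVneq j (f l)) => [->|_]; rewrite ?h ?andbF.
  rewrite mul0r big_pred0// => j; rewrite [f l == j]eq_sym.
  by case: (eqVneq j (f l)) => [->|_]; rewrite ?(negPf h) ?andbF.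
rewrite big_split/= sumrN !e -sumrN -big_split/=.
by apply: eq_bigr => l _; rewrite DE; ring.
Qed.

Lemma area_balance (x : phys R n q) k :
  (forall j, - pL g j + pM x j
    - \sum_(l | src g l == j) flow g x l + \sum_(l | dst g l == j) flow g x l = 0) ->
  \sum_(j | area g j == k) (pM x j - pL g j) =
  - \sum_(l in tie_lines g k) Dhat g k l * flow g x l.
Proof.
move=> h; rewrite tie_sum -sumrN; apply: eq_bigr => j _; have := h j; lra.
Qed.

Lemma gate_sum k : \sum_(j | area g j == k) J g j * Phat g (area g j) = Phat g k.
Proof.
have [_ _ hgate _ _] := hnet.
rewrite (bigD1 (gate g k)) ?hgate//= big1 ?addr0 => [|j /andP[/eqP jk jg]].
  rewrite /J; case: ifPn => [_|/existsPn /(_ k)]; last by rewrite eqxx.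
  by rewrite ?hgate mul1r.
rewrite /J; case: ifPn => [/existsP[k' /eqP jk']|_]; last by rewrite mul0r.
by move: jg; rewrite jk' -jk jk' hgate eqxx.
Qed.

Hypothesis hA1 : assumption1 g.

(* OGR-2 does not tie [pM] to [p] bus by bus, so equal marginal costs inside each
   area would not suffice by themselves; but the optimal equilibrium given by
   [assumption1] has the same net injection in every area as [x]. *)
Theorem rest_solution (x : state R n q) : rest g x -> ogr2_solution g (pM x) (flow g x).
Proof.
move=> rx; have [hQ [x0 [u0 [ps0 gn0 w0 [[_ feas0] opt0]]]]] := hA1.
have [_ [_ cc _] _ _ _] := hnet.
have nn : forall i j, nbr g i j -> nbr g i j by [].
have na : forall i j, nbr_in_area g i j -> nbr g i j by move=> i j /andP[].
have inp := rest_input rx.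
have ep j : pM x j - pL g j = - \sum_(i | nbr g i j) alpha g i j * (zeta x i - zeta x j).
  by have := inp (k_pc, j); rewrite /cell_input/= -/(nsum g j _); lra.
have epi j : \sum_(i | nbr g i j) alpha g i j * (zeta x i - zeta x j)
   - \sum_(i | nbr_in_area g i j) alpha g i j * (vphi x i - vphi x j)
   - J g j * Phat g (area g j) = 0.
  exact: (inp (k_pi, j)).
have ephi j : \sum_(i | nbr_in_area g i j) alpha g i j * (vpi x i - vpi x j) = 0.
  exact: (inp (k_phi, j)).
(* The zeta cells see pc and pi only through their difference, which is therefore harmonic on the
   connected communication graph, hence constant. *)
have ezeta j : \sum_(i | nbr g i j) alpha g i j *
    ((pc x i - vpi x i) - (pc x j - vpi x j)) = 0.
  have := inp (k_zeta, j); rewrite /cell_input/= /nsum -sumrB; apply: etrans.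
  by apply: eq_bigr => i _; ring.
have pia := area_connected (laplacian_kernel hnet (@nbr_in_areaC _ _ _ _ g) na ephi).
have dpc i j : pc x i - vpi x i = pc x j - vpi x j.
  apply: (connected_const cc (f := fun i => pc x i - vpi x i)) => {}i {}j ij.
  by apply: (laplacian_kernel hnet (@nbrC _ _ _ _ g) nn ezeta); rewrite /nbr /adj ij.
have pca i j : area g i = area g j -> pc x i = pc x j.
  by move=> /pia h; have := dpc i j; lra.
(* Adding the pc and pi equations eliminates zeta. The Laplacian of phi runs inside areas and
   cancels in the sum over an area. *)
have sumx k : \sum_(j | area g j == k) (pM x j - pL g j) = - Phat g k.
  have h1 := laplacian_sum hnet (vphi x) (h := fun j => (area g j == k)%:R)
    (@nbr_in_areaC _ _ _ _ g) na.
  have {}h1 : \sum_j (area g j == k)%:R *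
     \sum_(i | nbr_in_area g i j) alpha g i j * (vphi x i - vphi x j) = 0.
    by apply: h1 => i j /andP[_ /eqP ->].
  have mk (F : 'I_n -> R) : \sum_(j | area g j == k) F j = \sum_j (area g j == k)%:R * F j.
    by rewrite big_mkcond/=; apply: eq_bigr => j _; case: ifP; rewrite ?mul1r ?mul0r.
  have h2 : \sum_j ((area g j == k)%:R * (pM x j - pL g j)
      + ((area g j == k)%:R * (J g j * Phat g (area g j)) + (area g j == k)%:R *
        \sum_(i | nbr_in_area g i j) alpha g i j * (vphi x i - vphi x j))) = 0.
    by apply: big1 => j _; rewrite ep; have := epi j; case: (area g j == k); rewrite /= ?mul1r ?mul0r; lra.
  have := gate_sum k; rewrite (mk (fun j => J g j * Phat g (area g j))) => h3.
  rewrite (mk (fun j => pM x j - pL g j)).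
  by move: h2; rewrite !big_split/= h1 h3 addr0 => h2; lra.
have sumT (F : 'I_n -> R) : \sum_j F j = \sum_k \sum_(j | area g j == k) F j.
  exact: (partition_big (area g) xpredT).
have totx : \sum_(j in gen g) pM x j = \sum_j pL g j.
  rewrite big_mkcond/= (eq_bigr (pM x)); last first.
    by move=> j _; case: ifPn => // /(rest_load rx) ->.
  apply/eqP; rewrite -subr_eq0 -sumrB (eq_bigr (fun j => - (- \sum_(l | src g l == j) flow g x l
      + \sum_(l | dst g l == j) flow g x l))).
    by rewrite sumrN flow_balance oppr0.
  by move=> j _; have := rest_flow rx j; lra.
split.
  split=> // k; rewrite -[RHS]opprK -sumx (area_balance _ (rest_flow rx)) opprK.
  by [].
have bal0 j : - pL g j + pM x0 j - \sum_(l | src g l == j) flow g x0 l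
    + \sum_(l | dst g l == j) flow g x0 l = 0.
  have [_ gG lG] := ps0; have [_ gL] := gn0.
  have [jG|jG] := boolP (j \in gen g).
    by have /solves_cst := gG j jG; rewrite w0 mulr0 subr0.
  by have := lG j jG 0 (lexx 0); rewrite w0 (gL j jG 0 (lexx 0)); lra.
have sum0 k : \sum_(j | area g j == k) (pM x0 j - pL g j) = - Phat g k.
  by rewrite area_balance// feas0.
move=> pM' p' /opt0; apply: le_trans.
(* [pc] acts as a price common to each area, and the two states have equal net injections area by
   area. *)
have key : \sum_j pc x j * (pM x0 j - pM x j) = 0.
  rewrite sumT big1// => k _.
  have [_ _ hgate _ _] := hnet.
  rewrite (eq_bigr (fun j => pc x (gate g k) * ((pM x0 j - pL g j) - (pM x j - pL g j)))).
    by rewrite -mulr_sumr sumrB sum0 sumx subrr mulr0.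
  by move=> j /eqP jk; rewrite (pca j (gate g k)) ?hgate//; ring.
suff : \sum_j pc x j * (pM x0 j - pM x j) <=
    \sum_(j in gen g) (Q g j (pM x0 j) - Q g j (pM x j)).
  by rewrite key sumrB subr_ge0.
rewrite (eq_bigr (fun j => if j \in gen g then pc x j * (pM x0 j - pM x j) else 0)); last first.
  move=> j _; case: ifPn => // jG; have [_ gL] := gn0.
  by rewrite (rest_load rx)// (gL j jG 0 (lexx 0)) subrr mulr0.
rewrite -big_mkcond; apply: ler_sum => j jG; have [d1 _ sc] := hQ _ jG.
have := convex_tangent d1 sc (pM x j) (pM x0 j); rewrite (rest_gen rx jG); lra.
Qed.

End Optimality.

(** * The closed loop: regularity and Lyapunov function *)

Section Trig.
Context {R : realType}.
Implicit Types a b k : R.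

Lemma MVT_all (f df : R -> R) a b : (forall x : R, is_derive x 1 f (df x)) ->
  exists2 c, (a <= c <= b) || (b <= c <= a) & f b - f a = df c * (b - a).
Proof.
move=> h.
have cf (x : R) : {for x, continuous f}.
  by apply: differentiable_continuous; apply/derivable1_diffP; have [] := h x.
have main u v : u <= v -> exists2 c, u <= c <= v & f v - f u = df c * (v - u).
  move=> uv; have [c] := @MVT_segment R f df u v uv (fun x _ => h x)
    (continuous_subspaceT cf).
  by rewrite in_itv/= => ? ?; exists c.
have [ab|/ltW ba] := leP a b.
  by have [c cab e] := main _ _ ab; exists c => //; rewrite cab.
have [c cab e] := main _ _ ba; exists c; first by rewrite cab orbT.
by rewrite -[LHS]opprB e; ring.
Qed.

Lemma sin_lip a b : `|sin b - sin a| <= `|b - a|.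
Proof.
have [c _ ->] := @MVT_all sin cos a b (fun x => is_derive_sin x).
by rewrite normrM ler_piMl// ler_norml cos_geN1 cos_le1.
Qed.

(** The quadratic remainder in the form that [prim_chain] asks for; it also bounds the initial angle
    potential from above. *)
Lemma cos_quad a b : `|cos a - cos b - sin a * (b - a)| <= (b - a) ^+ 2.
Proof.
have [c hc e] := @MVT_all cos (fun x => - sin x) a b (fun x => is_derive_cos x).
rewrite -[cos a - cos b]opprB e.
rewrite (_ : - _ - _ = (sin c - sin a) * (b - a)); last by ring.
rewrite normrM -[leRHS](real_normK (num_real _)) expr2.
apply: ler_wpM2r => //; apply: (le_trans (sin_lip _ _)).
by case/orP: hc => /andP[h1 h2]; [rewrite !ger0_norm|rewrite !ler0_norm]; lra.
Qed.

Lemma cos_ge_of_norm a k : `|a| <= k -> k <= pi / 2 -> cos k <= cos a.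
Proof.
move=> ak kpi; rewrite -[cos a]cos_norm.
have p0 := @pi_gt0 R.
have a0 := normr_ge0 a.
by rewrite leNgt ltr_cos ?in_itv/= -?leNgt//; apply/andP; split; lra.
Qed.

Lemma sin_monotone a b k : `|a| <= k -> `|b| <= k -> k <= pi / 2 ->
  cos k * (b - a) ^+ 2 <= (b - a) * (sin b - sin a).
Proof.
move=> ak bk kpi.
have [c hc ->] := @MVT_all sin cos a b (fun x => is_derive_sin x).
have ck : `|c| <= k.
  move: ak bk; rewrite !ler_norml => /andP[? ?] /andP[? ?].
  by case/orP: hc => /andP[? ?]; apply/andP; split; lra.
have := cos_ge_of_norm ck kpi => h.
rewrite [leRHS](_ : _ = cos c * (b - a) ^+ 2); last by ring.
by apply: ler_wpM2r => //; exact: sqr_ge0.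
Qed.

Lemma potential_ge a b k : `|a| <= k -> `|b| <= k -> k <= pi / 2 ->
  cos k / 2 * (b - a) ^+ 2 <= cos a - cos b - sin a * (b - a).
Proof.
move=> ak bk kpi.
(* This difference vanishes at [a], and by [sin_monotone] its derivative has the sign of x - a. *)
pose f x := cos a - cos x - sin a * (x - a) - cos k / 2 * (x - a) ^+ 2.
have df (x : R) : is_derive x 1 f (sin x - sin a - cos k * (x - a)).
  rewrite /f; apply: is_derive_eq.
  by rewrite -![_ *: _]/(_ * _); field.
have [c hc] := @MVT_all f _ a b df.
rewrite /f !subrr !mulr0 expr0n/= mulr0 !subr0.
set c2 := (sin c - sin a - _) * (b - a) => e.
have ck : `|c| <= k.
  move: ak bk; rewrite !ler_norml => /andP[? ?] /andP[? ?].
  by case/orP: hc => /andP[? ?]; apply/andP; split; lra.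
suff : 0 <= c2 by lra.
have := sin_monotone ak ck kpi; rewrite /c2.
case/orP: hc => /andP[h1 h2] h.
  have [->|ac] := eqVneq a c; first by rewrite !subrr mulr0 subr0 mul0r.
  have p : 0 < c - a by rewrite subr_gt0 lt_neqAle ac.
  apply: mulr_ge0; last by lra.
  by rewrite subr_ge0 -(ler_pM2l p); lra.
have [->|ac] := eqVneq a c; first by rewrite !subrr mulr0 subr0 mul0r.
have p : 0 < a - c by rewrite subr_gt0 lt_neqAle eq_sym ac.
apply: mulr_le0; last by lra.
by rewrite subr_le0 -(ler_pM2l p); lra.
Qed.

End Trig.

(** * Functions bounded on bounded time intervals *)

Section LocallyBounded.
Context {R : realType}.
Implicit Types f h : R -> R.

Lemma reg_locbdd f : reg 0 f -> locbdd f.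
Proof. by case. Qed.

Lemma locbdd_ext f h : (forall t, 0 <= t -> f t = h t) -> locbdd f -> locbdd h.
Proof. by move=> e bf b; have [C hC] := bf b; exists C => t t0 tb; rewrite -e// hC. Qed.

Lemma locbdd_cst (k : R) : locbdd (fun=> k).
Proof. by move=> b; exists `|k|. Qed.

Lemma locbddD f h : locbdd f -> locbdd h -> locbdd (fun t => f t + h t).
Proof.
move=> bf bh b; have [C hC] := bf b; have [D hD] := bh b; exists (C + D) => t t0 tb.
by apply: (le_trans (ler_normD _ _)); rewrite lerD ?hC ?hD.
Qed.

Lemma locbddZ k f : locbdd f -> locbdd (fun t => k * f t).
Proof.
move=> bf b; have [C hC] := bf b; exists (`|k| * C) => t t0 tb.
by rewrite normrM ler_wpM2l// hC.
Qed.

Lemma locbddN f : locbdd f -> locbdd (fun t => - f t).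
Proof. by move=> /(locbddZ (-1)); apply: locbdd_ext => t _; rewrite mulN1r. Qed.

Lemma locbddB f h : locbdd f -> locbdd h -> locbdd (fun t => f t - h t).
Proof. by move=> bf /locbddN; exact: locbddD. Qed.

Lemma locbdd_sum (J : finType) (P : pred J) (F : J -> R -> R) :
  (forall i, P i -> locbdd (F i)) -> locbdd (fun t => \sum_(i | P i) F i t).
Proof.
move=> bF; rewrite -fct_sumE.
by apply: (big_ind (@locbdd R)) => [||//]; [exact: locbdd_cst|move=> *; exact: locbddD].
Qed.

Lemma locbdd_cont f (phi : R -> R) : continuous phi -> locbdd f ->
  locbdd (fun t => phi (f t)).
Proof.
move=> cp bf b; have [C hC] := bf b.
have /compact_bounded[M [_ hM]] : compact (phi @` `[- C, C]).
  apply: continuous_compact; last exact: segment_compact.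
  exact: continuous_subspaceT.
exists (M + 1) => t t0 tb; apply: hM; first by rewrite ltrDl.
by exists (f t) => //=; rewrite in_itv/= -ler_norml hC.
Qed.

End LocallyBounded.

(** * Regularity of trajectories and the network of deviations *)

Section Trajectory.
Context {R : realType} {n q m : nat}.
Variables (g : grid R n q m) (T : 'I_n -> 'I_n -> R) (w : R -> signals R n q).
Hypotheses (hnet : network_ok g) (hT : forall i j, nbr g i j -> 0 <= T i j)
  (hQ : forall j, j \in gen g -> continuous (derive1 (Q g j)))
  (sw : solution g T w).

Let hcomm : simple_oriented (comm g).
Proof. by have [_ []] := hnet. Qed.

(** Start of a bootstrap. Each [solves] bounds its own variable whatever its right-hand side; the
    algebraic relations then bound load frequencies and received signals, so all right-hand sides
    are locally bounded and [solves_prim] applies. *)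
Lemma angle_locbdd l : locbdd (fun t => angle (w t) l).
Proof. by have [[[hA _ _] _ _] _ _ _] := sw; exact: solves_locbdd (hA l). Qed.

Lemma flow_locbdd l : locbdd (fun t => flow g (w t) l).
Proof. by apply: locbddZ; apply: locbdd_cont (angle_locbdd l); exact: continuous_sin. Qed.

Lemma omega_locbdd j : locbdd (fun t => omega (w t) j).
Proof.
have [[[_ hG hL] _ _] _ _ _] := sw; have [_ _ _ [hp hLam _ _] _] := hnet.
have [jG|jG] := boolP (j \in gen g).
  have [Mp _ _ _] := hp _ jG.
  have := locbddZ (M g j)^-1 (solves_locbdd (hG j jG)).
  by apply: locbdd_ext => t _; rewrite mulKf ?gt_eqF.
have b : locbdd (fun t => (Lam g j)^-1 * (- pL g j - \sum_(l | src g l == j) flow g (w t) l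
   + \sum_(l | dst g l == j) flow g (w t) l)).
  apply: locbddZ; apply: locbddD; first apply: locbddB.
  - exact: locbdd_cst.
  - by apply: locbdd_sum => l _; exact: flow_locbdd.
  - by apply: locbdd_sum => l _; exact: flow_locbdd.
apply: locbdd_ext b => t t0; have Lp := hLam j.
apply: (mulfI (lt0r_neq0 Lp)); rewrite mulVKf ?gt_eqF//.
by have := hL j jG t t0; lra.
Qed.

Lemma pM_locbdd j : locbdd (fun t => pM (w t) j).
Proof.
have [[_ [hG hL] _] _ _ _] := sw; have [_ _ _ [hp _ _ _] _] := hnet.
have [jG|jG] := boolP (j \in gen g).
  have [_ tp _ _] := hp _ jG.
  have := locbddZ (tau g j)^-1 (solves_locbdd (hG j jG)).
  by apply: locbdd_ext => t _; rewrite mulKf ?gt_eqF.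
by apply: locbdd_ext (locbdd_cst 0) => t t0; rewrite hL.
Qed.

Lemma output_locbdd s : locbdd (fun t => output (w t) s).
Proof.
by have [[_ _ /controllerP/(_ s)[_ h]] _ _ _] := sw; exact: solves_locbdd h.
Qed.

Lemma inner_locbdd s : locbdd (fun t => inner (w t) s).
Proof.
by have [[_ _ /controllerP/(_ s)[h _]] _ _ _] := sw; exact: solves_locbdd h.
Qed.

Lemma wave_reg c i j : nbr g i j ->
  reg (- T i j) (fun t => wave1 g (w t) c i j) /\
  reg (- T i j) (fun t => wave2 g (w t) c i j).
Proof.
move=> nij; have [_ _ _ rw] := sw.
by split; apply: regZ; exact: rw.
Qed.

Lemma rcv_locbdd c i j : active g (c, (i, j)) ->
  locbdd (fun t => rcv1 c (rs (w t) i j)) /\ locbdd (fun t => rcv2 c (rs (w t) i j)).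
Proof.
move=> aij; have nij : nbr g i j by case/andP: aij.
have [_ sc tr _] := sw; have [r1 r2] := wave_reg c nij.
have [{}r1 {}r2] := (reg_locbdd (reg_delay r1), reg_locbdd (reg_delay r2)).
split.
  apply: locbdd_ext (locbddB (locbddN r2) (output_locbdd (endA c, j))) => t t0.
  by have [-> _ _ _] := wave_eqs hcomm sc tr aij t0.
apply: locbdd_ext (locbddD r1 (output_locbdd (endB c, j))) => t t0.
by have [_ -> _ _] := wave_eqs hcomm sc tr aij t0.
Qed.

Lemma cell_input_locbdd s : locbdd (fun t => cell_input g (w t) s).
Proof.
have h0 i j : nbr g i j -> locbdd (fun t => r_p (rs (w t) i j)) /\
    locbdd (fun t => r_zeta (rs (w t) i j)).
  by move=> nij; apply: (@rcv_locbdd (@Ordinal 3 0 isT)); rewrite /active/= nij.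
have h1 i j : nbr g i j -> locbdd (fun t => r_zeta1 (rs (w t) i j)) /\
    locbdd (fun t => r_pi1 (rs (w t) i j)).
  by move=> nij; apply: (@rcv_locbdd (@Ordinal 3 1 isT)); rewrite /active/= nij.
have h2 i j : nbr g i j && (area g i == area g j) ->
    locbdd (fun t => r_pi2 (rs (w t) i j)) /\ locbdd (fun t => r_phi2 (rs (w t) i j)).
  by move=> nij; apply: (@rcv_locbdd (@Ordinal 3 2 isT)); rewrite /active/= nij.
have o (k : 'I_4) j := output_locbdd (k, j).
have bn (F : 'I_n -> R -> R) (G : R -> R) j : (forall i, nbr g i j -> locbdd (F i)) ->
    locbdd G -> locbdd (fun t => nsum g j (fun i => F i t - G t)).
  move=> hF hG; apply: locbdd_sum => i nij; apply: locbddZ; apply: locbddB => //.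
  exact: hF.
have ba (F : 'I_n -> R -> R) (G : R -> R) j :
    (forall i, nbr g i j && (area g i == area g j) -> locbdd (F i)) ->
    locbdd G -> locbdd (fun t => asum g j (fun i => F i t - G t)).
  move=> hF hG; apply: locbdd_sum => i nij; apply: locbddZ; apply: locbddB => //.
  exact: hF.
case: s => [[[|[|[|[|//]]]] kp] j]; rewrite /cell_input/=.
- apply: locbddB.
  + by apply: bn => [i nij|]; [have [] := h0 _ _ nij|exact: (o k_pc j)].
  + by apply: bn => [i nij|]; [have [] := h1 _ _ nij|exact: (o k_pi j)].
- apply: locbddB; first apply: locbddN; first apply: locbddB.
  + exact: pM_locbdd.
  + exact: locbdd_cst.
  + by apply: bn => [i nij|]; [have [] := h0 _ _ nij|exact: (o k_zeta j)].
- apply: locbddB; last exact: locbdd_cst.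
  apply: locbddB.
  + by apply: bn => [i nij|]; [have [] := h1 _ _ nij|exact: (o k_zeta j)].
  + by apply: ba => [i nij|]; [have [] := h2 _ _ nij|exact: (o k_phi j)].
- apply: ba => [i nij|]; first by have [] := h2 _ _ nij.
  exact: (o k_pi j).
Qed.

Lemma inner_prim s : prim (fun t => inner (w t) s)
  (fun t => - inner (w t) s + cell_input g (w t) s).
Proof.
have [[_ _ /controllerP/(_ s)[h _]] _ _ _] := sw; apply: (solves_prim h).
by apply: locbddD (cell_input_locbdd s); exact: locbddN (inner_locbdd s).
Qed.

Lemma output_prim s : prim (fun t => output (w t) s)
  (fun t => - inner (w t) s + 2 * cell_input g (w t) s).
Proof.
have [[_ _ /controllerP/(_ s)[_ h]] _ _ _] := sw; apply: (solves_prim h).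
apply: locbddD; first exact: locbddN (inner_locbdd s).
exact: locbddZ (cell_input_locbdd s).
Qed.

Lemma cell_input_reg s : reg 0 (fun t => cell_input g (w t) s).
Proof.
have [r1 _] := inner_prim s; have := regD r1 (prim_reg (inner_prim s)).
by apply: reg_ext => t _; ring.
Qed.

Lemma angle_prim l : prim (fun t => angle (w t) l)
  (fun t => omega (w t) (src g l) - omega (w t) (dst g l)).
Proof.
have [[[hA _ _] _ _] _ _ _] := sw; apply: (solves_prim (hA l)).
by apply: locbddB; exact: omega_locbdd.
Qed.

Lemma omega_prim j : j \in gen g -> prim (fun t => M g j * omega (w t) j)
  (fun t => - pL g j + pM (w t) j - Lam g j * omega (w t) j
     - \sum_(l | src g l == j) flow g (w t) l + \sum_(l | dst g l == j) flow g (w t) l).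
Proof.
move=> jG; have [[[_ hG _] _ _] _ _ _] := sw; apply: (solves_prim (hG j jG)).
apply: locbddD; last by apply: locbdd_sum => l _; exact: flow_locbdd.
apply: locbddB; last by apply: locbdd_sum => l _; exact: flow_locbdd.
apply: locbddB; last exact: locbddZ (omega_locbdd j).
by apply: locbddD; [exact: locbdd_cst|exact: pM_locbdd].
Qed.

Lemma pM_prim j : j \in gen g -> prim (fun t => tau g j * pM (w t) j)
  (fun t => kg g j * kc g j *
     (pc (w t) j - omega (w t) j - derive1 (Q g j) (pM (w t) j))).
Proof.
move=> jG; have [[_ [hG _] _] _ _ _] := sw; have [_ _ _ [hp _ _ _] _] := hnet.
have [_ _ kp _] := hp _ jG.
have e t : - pM (w t) j + kg g j * gen_input g (w t) j = kg g j * kc g j *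
     (pc (w t) j - omega (w t) j - derive1 (Q g j) (pM (w t) j)).
  have h : kg g j * (pM (w t) j / kg g j) = pM (w t) j by rewrite mulrC divfK ?gt_eqF.
  by rewrite /gen_input; move: h; set X := pM (w t) j / _ => h; lra.
have sp := solves_ext (fun _ => erefl) e (hG j jG).
apply: (solves_prim sp); apply: locbddZ; apply: locbddB; first apply: locbddB.
- exact: (output_locbdd (k_pc, j)).
- exact: omega_locbdd.
- by apply: locbdd_cont (pM_locbdd j); exact: hQ.
Qed.

Lemma omega_reg j : reg 0 (fun t => omega (w t) j).
Proof.
have [[[_ hG hL] _ _] _ _ _] := sw; have [_ _ _ [hp hLam _ _] _] := hnet.
have [jG|jG] := boolP (j \in gen g).
  have [Mp _ _ _] := hp _ jG.
  have := regZ (M g j)^-1 (prim_reg (omega_prim jG)).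
  by apply: reg_ext => t _; rewrite mulKf ?gt_eqF.
have rf l : reg 0 (fun t => flow g (w t) l).
  by apply: regZ; apply: reg_cont (prim_reg (angle_prim l)); exact: continuous_sin.
have b : reg 0 (fun t => (Lam g j)^-1 * (- pL g j - \sum_(l | src g l == j) flow g (w t) l
   + \sum_(l | dst g l == j) flow g (w t) l)).
  apply: regZ; apply: regD; first apply: regB.
  - exact: reg_cst.
  - by apply: reg_sum => l _; exact: rf.
  - by apply: reg_sum => l _; exact: rf.
apply: reg_ext b => t t0; have Lp := hLam j.
apply: (mulfI (lt0r_neq0 Lp)); rewrite mulVKf ?gt_eqF//.
by have := hL j jG t t0; lra.
Qed.

Lemma pM_reg j : reg 0 (fun t => pM (w t) j).
Proof.
have [[_ [hG hL] _] _ _ _] := sw; have [_ _ _ [hp _ _ _] _] := hnet.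
have [jG|jG] := boolP (j \in gen g).
  have [_ tp _ _] := hp _ jG.
  have := regZ (tau g j)^-1 (prim_reg (pM_prim jG)).
  by apply: reg_ext => t _; rewrite mulKf ?gt_eqF.
by apply: reg_ext (reg_cst 0 0) => t t0; rewrite hL.
Qed.

Variable ws : signals R n q.
Hypothesis hws : equilibrium g T ws.

Let dx (s : 'I_4 * 'I_n) t := output (w t) s - output ws s.
Let drho (s : 'I_4 * 'I_n) t := inner (w t) s.
Let du (s : 'I_4 * 'I_n) t := cell_input g (w t) s.
Let dd (s : 'I_4 * 'I_n) t := load_input g (w t) s - load_input g ws s.
Let dP (l : 'I_3 * ('I_n * 'I_n)) t :=
  wave1 g (w t) l.1 l.2.1 l.2.2 - wave1 g ws l.1 l.2.1 l.2.2.
Let dQ (l : 'I_3 * ('I_n * 'I_n)) t :=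
  wave2 g (w t) l.1 l.2.2 l.2.1 - wave2 g ws l.1 l.2.2 l.2.1.

(** The controller is affine, so subtracting an equilibrium removes the constants and leaves the
    deviation of p^M as outside input. The rho variables vanish at the equilibrium, hence [drho] has
    nothing to subtract. *)
Lemma deviation_network : network (active g) (@lA n) (@lB n) (@lA' n) (@lB' n)
  (lweight g) (fun l => T l.2.1 l.2.2) (fun l => T l.2.2 l.2.1) dx drho du dd dP dQ.
Proof.
have rws := equilibrium_rest hcomm hnet hws.
have alphaP i j : nbr g i j -> alpha g i j = alpha g j i /\ 0 < alpha g i j.
  by have [_ _ _ _ h] := hnet; exact: h.
have aC i j : nbr g i j -> alpha g i j = alpha g j i by move=> /alphaP[].
have [_ sc tr _] := sw; have [_ sc' tr' _] := hws.
have inp s : cell_input g ws s = 0.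
  have [[_ _ ct] _ _ _] := hws.
  have [/solves_cst h1 /solves_cst h2] := (controllerP g (fun=> ws)).1 ct s.
  by lra.
split.
- by move=> l /andP[/alphaP[]].
- exact: inner_prim.
- move=> s; have := primB (output_prim s) (prim_cst (output ws s)).
  by apply: prim_ext => t t0 //; rewrite subr0.
- exact: cell_input_reg.
- move=> [[[|[|[|[|//]]]] kp] j]; rewrite /dd /load_input/=.
  + exact: regB (reg_cst _ _) (reg_cst _ _).
  + by apply: regB (reg_cst _ _); apply: regN; apply: regB (pM_reg j) (reg_cst _ _).
  + exact: regB (reg_cst _ _) (reg_cst _ _).
  + exact: regB (reg_cst _ _) (reg_cst _ _).
- move=> [c [i j]] /= aij; have aji : active g (c, (j, i)) by rewrite activeC.
  have nij : nbr g i j by case/andP: aij.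
  have nji : nbr g j i by rewrite nbrC.
  have [r1 _] := wave_reg c nij; have [_ r2] := wave_reg c nji.
  split => /=; [exact: hT|exact: hT| | | | | |].
  + exact: regB r1 (reg_cst _ _).
  + exact: regB r2 (reg_cst _ _).
  + exact: regB (prim_reg (output_prim _)) (reg_cst _ _).
  + exact: regB (prim_reg (output_prim _)) (reg_cst _ _).
  + move=> t t0; have [_ _ h _] := wave_eqs hcomm sc tr aji t0.
    have [_ _ h' _] := wave_eqs hcomm sc' tr' aji t0.
    by rewrite /dP /dQ /dx/= h h' /lA/=; ring.
  + move=> t t0; have [_ _ _ h] := wave_eqs hcomm sc tr aij t0.
    have [_ _ _ h'] := wave_eqs hcomm sc' tr' aij t0.
    by rewrite /dP /dQ /dx/= h h' /lB/=; ring.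
(* Symmetrized in [y] and [z], the term of a link from i to j is a difference h i - h j, and the two
   orientations of a line cancel. *)
- move=> y z; apply/eqP; rewrite -subr_eq0 opprK; apply/eqP.
  rewrite /localform -big_split/=.
  rewrite (eq_bigr (fun l => (fun c i j => alpha g i j *
    ((y (endA c, i) * z (endB c, i) + z (endA c, i) * y (endB c, i)) * 1
     - (y (endA c, j) * z (endB c, j) + z (endA c, j) * y (endB c, j)) * 1))
     l.1 l.2.1 l.2.2)); last first.
    by move=> l _; rewrite /lweight /lA /lB /lA' /lB'; ring.
  rewrite (sum_links g (fun c i j => alpha g i j *
    ((y (endA c, i) * z (endB c, i) + z (endA c, i) * y (endB c, i)) * 1
     - (y (endA c, j) * z (endB c, j) + z (endA c, j) * y (endB c, j)) * 1))).
  have e0 (e : rel 'I_n) (h : 'I_n -> R) : (forall i j, e i j = e j i) ->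
      (forall i j, e i j -> nbr g i j) ->
      \sum_i \sum_(j | e i j) alpha g i j * (h i * 1 - h j * 1) = 0.
    move=> eC en; rewrite (edge_sum aC h h (fun _ _ => 1) (fun _ _ => 1) eC en).
    by rewrite subrr.
  rewrite !(e0 _ (fun i => y (_, i) * z (_, i) + z (_, i) * y (_, i))) ?addr0//.
  + exact: nbr_in_areaC.
  + by move=> i j /andP[].
  + exact: nbrC.
  + exact: nbrC.
- move=> y t t0; have h := cell_input_power aC (w t) y.
  have h' := cell_input_power aC ws y.
  have {}h' : \sum_s y s * cell_input g ws s = 0.
    by apply: big1 => s _; rewrite inp mulr0.
  rewrite -[LHS]subr0 -[X in _ - X]h' /du h.
  rewrite (cell_input_power aC ws y) opprD addrACA -!sumrB; congr (_ + _); last first.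
    by apply: eq_bigr => s _; rewrite /dd; ring.
  apply: eq_bigr => -[c [i j]] aij; have aji : active g (c, (j, i)) by rewrite activeC.
  have [a1 _ _ _] := wave_eqs hcomm sc tr aji t0.
  have [_ a2 _ _] := wave_eqs hcomm sc tr aij t0.
  have [b1 _ _ _] := wave_eqs hcomm sc' tr' aji t0.
  have [_ b2 _ _] := wave_eqs hcomm sc' tr' aij t0.
  rewrite /recvA /recvB /dP /dQ /dx /lA /lB /lA' /lB' /= a1 a2 b1 b2; ring.
Qed.

End Trajectory.

(** * The Lyapunov function and its dissipation *)

Section Lyapunov.
Context {R : realType} {n q m : nat}.
Variables (g : grid R n q m) (T : 'I_n -> 'I_n -> R).
Hypotheses (hnet : network_ok g) (hT : forall i j, nbr g i j -> 0 <= T i j)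
  (hQ : forall j, j \in gen g -> [/\ forall x, derivable (Q g j) x 1,
     continuous (derive1 (Q g j)) & strictly_convex (Q g j)]).
Variables (ws : signals R n q).
Hypothesis hws : equilibrium g T ws.

Let hcomm : simple_oriented (comm g).
Proof. by have [_ []] := hnet. Qed.

Let hpos j : j \in gen g -> [/\ 0 < M g j, 0 < tau g j, 0 < kg g j & 0 < kc g j].
Proof. by have [_ _ _ [h _ _ _] _] := hnet; exact: h. Qed.

Let hLam j : 0 < Lam g j.
Proof. by have [_ _ _ [_ h _ _] _] := hnet; exact: h. Qed.

Let Yl l := Y g (src g l) (dst g l).

Let hY l : 0 < Yl l.
Proof. by have [_ _ _ [_ _ _ h] _] := hnet; exact: h. Qed.

Let rws : rest g ws := equilibrium_rest hcomm hnet hws.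

(** Bregman distance of the pendulum energy - Y cos, hence of zero value and zero slope at the
    equilibrium. *)
Definition angle_potential (x : phys R n q) l : R :=
  Yl l * (cos (angle ws l) - cos (angle x l)
          - sin (angle ws l) * (angle x l - angle ws l)).

(** The squares are taken of [M * omega] and [tau] times the deviation of p^M because these are the
    differentiated quantities. Dividing by [kg * kc] gives the pc port unit gain, to match the
    controller. *)
Definition power_energy (x : phys R n q) : R :=
  \sum_(j in gen g) (M g j * omega x j) ^+ 2 / 2 / M g j
  + \sum_(j in gen g)
      (tau g j * (pM x j - pM ws j)) ^+ 2 / 2 / (tau g j * (kg g j * kc g j))
  + \sum_l angle_potential x l.

Variable w : R -> signals R n q.

Definition comm_energy : R -> R :=
  net_energy (active g) (lweight g) (fun l => T l.2.1 l.2.2) (fun l => T l.2.2 l.2.1)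
    (fun s t => output (w t) s - output ws s) (fun s t => inner (w t) s)
    (fun l t => wave1 g (w t) l.1 l.2.1 l.2.2 - wave1 g ws l.1 l.2.1 l.2.2)
    (fun l t => wave2 g (w t) l.1 l.2.2 l.2.1 - wave2 g ws l.1 l.2.2 l.2.1).

Definition lyapunov t : R := power_energy (w t) + comm_energy t.

Definition dissipation t : R :=
  \sum_j Lam g j * omega (w t) j ^+ 2
  + \sum_(j in gen g) (pM (w t) j - pM ws j) *
      (derive1 (Q g j) (pM (w t) j) - derive1 (Q g j) (pM ws j))
  + \sum_s inner (w t) s ^+ 2.

Hypothesis sw : solution g T w.

Let nw := deviation_network hnet hT (fun j jG => let: And3 _ h _ := hQ jG in h) sw hws.

Let fl l t := flow g (w t) l - flow g ws l.
Let netflow j t := - \sum_(l | src g l == j) fl l t + \sum_(l | dst g l == j) fl l t.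
Let dp j t := pM (w t) j - pM ws j.
Let dq j t := derive1 (Q g j) (pM (w t) j) - derive1 (Q g j) (pM ws j).
Let dpc j t := pc (w t) j - pc ws j.

Lemma netflowE j t : netflow j t =
  - \sum_(l | src g l == j) flow g (w t) l + \sum_(l | dst g l == j) flow g (w t) l
  - (- \sum_(l | src g l == j) flow g ws l + \sum_(l | dst g l == j) flow g ws l).
Proof. by rewrite /netflow /fl !sumrB; ring. Qed.

Lemma omega_dev_prim j : j \in gen g -> prim (fun t => M g j * omega (w t) j)
  (fun t => dp j t - Lam g j * omega (w t) j + netflow j t).
Proof.
move=> jG; apply: prim_ext (omega_prim hnet sw jG) => // t t0.
by rewrite netflowE /dp; have := rest_flow rws j; lra.
Qed.

Lemma load_balance j t : j \notin gen g -> 0 <= t ->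
  dp j t = 0 /\ Lam g j * omega (w t) j = netflow j t.
Proof.
move=> jG t0; have [[[_ _ hL] [_ gL] _] _ _ _] := sw.
have e : dp j t = 0 by rewrite /dp gL// (rest_load rws) ?subrr.
split=> //; rewrite netflowE.
have := hL j jG t t0; have := rest_flow rws j; rewrite (rest_load rws)//; lra.
Qed.

Lemma pM_dev_prim j : j \in gen g -> prim (fun t => tau g j * dp j t)
  (fun t => kg g j * kc g j * (dpc j t - omega (w t) j - dq j t)).
Proof.
move=> jG; have [_ hc _] := hQ jG.
have hc' : forall j, j \in gen g -> continuous (derive1 (Q g j)).
  by move=> k /hQ[].
have := primB (pM_prim hnet hc' sw jG) (prim_cst (tau g j * pM ws j)).
apply: prim_ext => t t0; first by rewrite /dp mulrBr.
by rewrite subr0 /dpc /dq (rest_gen rws jG); ring.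
Qed.

Lemma potential_prim l : prim (fun t => angle_potential (w t) l)
  (fun t => fl l t * (omega (w t) (src g l) - omega (w t) (dst g l))).
Proof.
have Y0 := hY l; rewrite /angle_potential /fl /flow -!/(Yl l).
apply: (@prim_chain R (fun t => angle (w t) l) _
  (fun x => Yl l * (cos (angle ws l) - cos x - sin (angle ws l) * (x - angle ws l)))
  (fun x => Yl l * sin x - Yl l * sin (angle ws l)) (Yl l)
  (angle_prim hnet sw l) (ltW Y0)) => a b.
  rewrite (_ : _ - _ - _ = Yl l * (cos a - cos b - sin a * (b - a))); last by ring.
  by rewrite normrM (gtr0_norm Y0) ler_pM2l// cos_quad.
rewrite (_ : _ - _ = Yl l * (sin b - sin a)); last by ring.
by rewrite normrM (gtr0_norm Y0) ler_pM2l// sin_lip.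
Qed.

Lemma netflow_power (f : 'I_q -> R) (v : 'I_n -> R) :
  \sum_l f l * (v (src g l) - v (dst g l)) =
  - \sum_j v j * (- \sum_(l | src g l == j) f l + \sum_(l | dst g l == j) f l).
Proof.
have e (h : 'I_q -> 'I_n) : \sum_j v j * \sum_(l | h l == j) f l = \sum_l f l * v (h l).
  transitivity (\sum_j \sum_(l | h l == j) f l * v (h l)).
    apply: eq_bigr => j _; rewrite mulr_sumr; apply: eq_bigr => l /eqP ->.
    by rewrite mulrC.
  rewrite (exchange_big_dep xpredT)//=; apply: eq_bigr => l _.
  by rewrite (eq_bigl (fun j => j == h l)) ?big_pred1_eq// => j; rewrite eq_sym.
rewrite (eq_bigr (fun j => v j * (\sum_(l | dst g l == j) f l)
   - v j * \sum_(l | src g l == j) f l)); last by move=> j _; ring.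
by rewrite sumrB !e -sumrB -sumrN; apply: eq_bigr => l _; ring.
Qed.

(** The product of [dp] and [omega] occurs with opposite signs in the swing and generator equations.
    The power of the net flows cancels the rate of the potential, at load buses through the
    algebraic balance. *)
Lemma power_energy_prim : prim (fun t => power_energy (w t))
  (fun t => - \sum_j Lam g j * omega (w t) j ^+ 2 + \sum_j dp j t * dpc j t
            - \sum_(j in gen g) dp j t * dq j t).
Proof.
have p1 : prim (fun t => \sum_(j in gen g) (M g j * omega (w t) j) ^+ 2 / 2 / M g j)
  (fun t => \sum_(j in gen g) omega (w t) j *
     (dp j t - Lam g j * omega (w t) j + netflow j t)).
  apply: prim_sum => j jG; have [Mp _ _ _] := hpos jG.
  apply: prim_ext (primZ (M g j)^-1 (prim_sqr (omega_dev_prim jG))) => t t0.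
    by rewrite mulrC.
  by rewrite !mulrA mulVf ?gt_eqF// mul1r.
have p2 : prim (fun t => \sum_(j in gen g)
      (tau g j * dp j t) ^+ 2 / 2 / (tau g j * (kg g j * kc g j)))
  (fun t => \sum_(j in gen g) dp j t * (dpc j t - omega (w t) j - dq j t)).
  apply: prim_sum => j jG; have [_ tp kp cp] := hpos jG.
  apply: prim_ext (primZ (tau g j * (kg g j * kc g j))^-1 (prim_sqr (pM_dev_prim jG))) => t t0.
    by rewrite mulrC.
  by field; rewrite !gt_eqF.
have p3 := prim_sum (P := xpredT) (fun l _ => potential_prim l).
apply: prim_ext (primD (primD p1 p2) p3) => // t t0.
rewrite (netflow_power (fl ^~ t) (omega (w t))) -/(netflow _ t).
have mk (F : 'I_n -> R) : \sum_(j in gen g) F j = \sum_j (j \in gen g)%:R * F j.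
  by rewrite big_mkcond/=; apply: eq_bigr => j _; case: ifP; rewrite ?mul1r ?mul0r.
rewrite !mk -!sumrN -!big_split/=; apply: eq_bigr => j _.
rewrite -/(netflow j t); have [jG|jG] := boolP (j \in gen g); first by rewrite /=; ring.
by have [-> <-] := load_balance jG t0; rewrite /=; ring.
Qed.

(** The power side gains the sum of [dp * dpc]. The controller is fed [- dp] at its pc cells and
    gains the opposite. *)
Lemma lyapunov_prim : prim lyapunov (fun t => - dissipation t).
Proof.
apply: prim_ext (primD power_energy_prim (net_energy_prim nw)) => // t t0.
have -> : \sum_s (output (w t) s - output ws s) * (load_input g (w t) s - load_input g ws s)
    = - \sum_j dp j t * dpc j t.
  rewrite sum_cells /load_input/= !subrr.
  have z (F : 'I_n -> R) : \sum_j F j * 0 = 0 by apply: big1 => j _; rewrite mulr0.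
  rewrite !z !add0r addr0 [X in _ + X]big1 ?addr0 => [|j _]; last first.
    by rewrite subrr mulr0.
  by rewrite -sumrN; apply: eq_bigr => j _; rewrite /dp /dpc /output/=; ring.
by rewrite /dissipation; ring.
Qed.

Lemma dissipation_ge0 t : 0 <= dissipation t.
Proof.
apply: addr_ge0; first apply: addr_ge0; apply: sumr_ge0 => j jG.
- by rewrite mulr_ge0 ?sqr_ge0// ltW.
- by have [h1 _ h3] := hQ jG; exact: derive1_mono.
- exact: sqr_ge0.
Qed.

Lemma lyapunov_le t : 0 <= t -> lyapunov t <= lyapunov 0.
Proof.
move=> t0; have [rd h] := lyapunov_prim; rewrite h// gerDl.
rewrite (@itg_ext _ _ (fun s => -1 * dissipation s)); last by move=> *; rewrite mulN1r.
have rd' : reg 0 dissipation by apply: reg_ext (regN rd) => s _; rewrite opprK.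
rewrite (itgZ _ _ rd')// mulN1r oppr_le0; apply: itg_ge0 => s _ _.
exact: dissipation_ge0.
Qed.

Lemma dissipation_reg : reg 0 dissipation.
Proof.
by have [rd _] := lyapunov_prim; apply: reg_ext (regN rd) => s _; rewrite opprK.
Qed.

Lemma itg_dissipation t : 0 <= t -> itg dissipation 0 t = lyapunov 0 - lyapunov t.
Proof.
move=> t0; have [_ h] := lyapunov_prim; rewrite (h t)//.
by rewrite (itgN _ dissipation_reg)//; ring.
Qed.

Lemma comm_energy_ge0 t : 0 <= comm_energy t.
Proof. exact: net_energy_ge0 nw t. Qed.

End Lyapunov.

(** * Convergence *)

Section Trapped.
Context {R : realType} {n q m : nat}.
Variables (g : grid R n q m) (T : 'I_n -> 'I_n -> R).
Hypotheses (hnet : network_ok g) (hT : forall i j, nbr g i j -> 0 <= T i j)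
  (hQ : forall j, j \in gen g -> [/\ forall x, derivable (Q g j) x 1,
     continuous (derive1 (Q g j)) & strictly_convex (Q g j)]).
Variables (ws : signals R n q).
Hypothesis hws : equilibrium g T ws.

Let hcomm : simple_oriented (comm g).
Proof. by have [_ []] := hnet. Qed.

Let hpos j : j \in gen g -> [/\ 0 < M g j, 0 < tau g j, 0 < kg g j & 0 < kc g j].
Proof. by have [_ _ _ [h _ _ _] _] := hnet; exact: h. Qed.

Let hLam j : 0 < Lam g j.
Proof. by have [_ _ _ [_ h _ _] _] := hnet; exact: h. Qed.

Let Yl l := Y g (src g l) (dst g l).

Let hY l : 0 < Yl l.
Proof. by have [_ _ _ [_ _ _ h] _] := hnet; exact: h. Qed.

Let rws : rest g ws := equilibrium_rest hcomm hnet hws.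

Variables (r k y0 : R).
Hypotheses (r0 : 0 < r) (k0 : 0 <= k) (kpi : k < pi / 2) (y00 : 0 < y0)
  (hk : forall l, `|angle ws l| + r <= k) (hy : forall l, y0 <= Yl l).

Lemma cosk_gt0 : 0 < cos k.
Proof.
apply: cos_gt0_pihalf; rewrite kpi andbT (lt_le_trans _ k0)//.
by rewrite oppr_lt0 divr_gt0// pi_gt0.
Qed.

Lemma near_le (x : phys R n q) l : `|angle x l - angle ws l| <= r -> `|angle x l| <= k.
Proof.
have := ler_normD (angle x l - angle ws l) (angle ws l); rewrite subrK.
by have := hk l; lra.
Qed.

Lemma angle_potential_ge (x : phys R n q) l : `|angle x l - angle ws l| <= r ->
  y0 * (cos k / 2) * (angle x l - angle ws l) ^+ 2 <= angle_potential g ws x l.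
Proof.
move=> h; have h1 : `|angle ws l| <= k by have := hk l; have := r0; lra.
have := potential_ge h1 (near_le h) (ltW kpi); rewrite /angle_potential.
have := sqr_ge0 (angle x l - angle ws l); have := cosk_gt0; have := hy l.
set s := _ ^+ 2; set p := _ - _ - _; rewrite -/(Yl l) => yl ck s0 hp.
apply: (@le_trans _ _ (y0 * p)); first by rewrite -mulrA ler_pM2l.
apply: ler_wpM2r => //; apply: le_trans hp; rewrite mulr_ge0//; lra.
Qed.

Variable w : R -> signals R n q.
Hypothesis sw : solution g T w.

Let spread t := \sum_l (angle (w t) l - angle ws l) ^+ 2.

Hypotheses (hV : lyapunov g T ws w 0 < y0 * (cos k / 2) * r ^+ 2)
  (h0 : spread 0 < r ^+ 2).

Lemma gen_energy_ge0 t :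
  0 <= \sum_(j in gen g) (M g j * omega (w t) j) ^+ 2 / 2 / M g j /\
  0 <= \sum_(j in gen g)
      (tau g j * (pM (w t) j - pM ws j)) ^+ 2 / 2 / (tau g j * (kg g j * kc g j)).
Proof.
split; apply: sumr_ge0 => j jG; have [Mp tp kp cp] := hpos jG.
  by rewrite !divr_ge0 ?sqr_ge0// ltW.
by rewrite !divr_ge0 ?sqr_ge0// ltW// !mulr_gt0.
Qed.

Lemma spread_le_r t l : spread t <= r ^+ 2 -> `|angle (w t) l - angle ws l| <= r.
Proof.
move=> h; rewrite -(@ler_pXn2r _ 2)// ?nnegrE ?(ltW r0)//.
rewrite real_normK ?num_real//; apply: le_trans h.
rewrite /spread (bigD1 l)//= lerDl; apply: sumr_ge0 => i _; exact: sqr_ge0.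
Qed.

(* On the sphere [spread = r ^ 2] the potential alone exceeds the initial value of
   the Lyapunov function. *)
Lemma trapped t : 0 <= t -> spread t < r ^+ 2.
Proof.
move=> t0; rewrite ltNge; apply/negP => ht.
have pS : prim spread (fun s => \sum_l 2 * ((angle (w s) l - angle ws l) *
    (omega (w s) (src g l) - omega (w s) (dst g l)))).
  apply: prim_sum => l _.
  have p := primB (angle_prim hnet sw l) (prim_cst (angle ws l)).
  by apply: prim_ext (primZ 2 (prim_sqr p)) => s s0; [field|rewrite subr0].
have cS := loclip_continuous (fun B => prim_lip B pS).
have cS' : {within `[0, t], continuous (fun s => spread (Num.max 0 s))}.
  exact: continuous_subspaceT.
have [] := @IVT R (fun s => spread (Num.max 0 s)) 0 t (r ^+ 2) t0 cS'.
  by rewrite maxxx (max_r t0) ge_min le_max ht (ltW h0) orbT.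
move=> c; rewrite in_itv/= => /andP[c0 ct]; rewrite max_r// => ec.
have := lyapunov_le hnet hT hQ hws sw c0; rewrite leNgt => /negP; apply.
apply: (lt_le_trans hV); rewrite /lyapunov /power_energy -/(comm_energy _ _ _ _ _).
have [e1 e2] := gen_energy_ge0 c.
have e3 := comm_energy_ge0 hnet hT hQ hws sw c.
have e4 : y0 * (cos k / 2) * r ^+ 2 <= \sum_l angle_potential g ws (w c) l.
  rewrite -ec mulr_sumr; apply: ler_sum => l _; apply: angle_potential_ge.
  by apply: spread_le_r; rewrite ec.
lra.
Qed.

Lemma angle_near t l : 0 <= t -> `|angle (w t) l - angle ws l| <= r.
Proof. by move=> t0; apply: spread_le_r; exact: ltW (trapped t0). Qed.

Let V0 := lyapunov g T ws w 0.

Lemma energies_le t : 0 <= t -> [/\ comm_energy g T ws w t <= V0,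
  \sum_(j in gen g) (M g j * omega (w t) j) ^+ 2 / 2 / M g j <= V0,
  \sum_(j in gen g)
      (tau g j * (pM (w t) j - pM ws j)) ^+ 2 / 2 / (tau g j * (kg g j * kc g j)) <= V0
  & 0 <= lyapunov g T ws w t].
Proof.
move=> t0; have := lyapunov_le hnet hT hQ hws sw t0; rewrite -/V0.
rewrite /lyapunov /power_energy.
have [e1 e2] := gen_energy_ge0 t.
have e3 := comm_energy_ge0 hnet hT hQ hws sw t.
have e4 : 0 <= \sum_l angle_potential g ws (w t) l.
  apply: sumr_ge0 => l _; apply: le_trans (angle_potential_ge (angle_near l t0)).
  apply: mulr_ge0 (sqr_ge0 _); apply: mulr_ge0; first exact: ltW.
  by rewrite divr_ge0// ltW// cosk_gt0.
by move=> h; split; lra.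
Qed.

Let fl l t := flow g (w t) l - flow g ws l.
Let netflow j t := - \sum_(l | src g l == j) fl l t + \sum_(l | dst g l == j) fl l t.
Let dp j t := pM (w t) j - pM ws j.
Let dq j t := derive1 (Q g j) (pM (w t) j) - derive1 (Q g j) (pM ws j).
Let dpc j t := pc (w t) j - pc ws j.

Definition bdd (f : R -> R) := exists C : R, forall t, 0 <= t -> `|f t| <= C.

Lemma bddD f h : bdd f -> bdd h -> bdd (fun t => f t + h t).
Proof.
move=> [C hC] [D hD]; exists (C + D) => t t0.
by apply: (le_trans (ler_normD _ _)); rewrite lerD ?hC ?hD.
Qed.

Lemma bddZ c f : bdd f -> bdd (fun t => c * f t).
Proof.
by move=> [C hC]; exists (`|c| * C) => t t0; rewrite normrM ler_wpM2l ?hC.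
Qed.

Lemma bddB f h : bdd f -> bdd h -> bdd (fun t => f t - h t).
Proof.
move=> bf /(bddZ (-1)) bh; have [C hC] := bddD bf bh; exists C => t t0.
by have := hC t t0; rewrite mulN1r.
Qed.

Lemma bdd_sum (J : finType) (P : pred J) (F : J -> R -> R) :
  (forall i, P i -> bdd (F i)) -> bdd (fun t => \sum_(i | P i) F i t).
Proof.
move=> bF; rewrite -fct_sumE.
apply: (big_ind bdd) => [||//]; last by move=> *; exact: bddD.
by exists 0 => t _; rewrite normr0.
Qed.

Lemma bdd_cont f (phi : R -> R) : continuous phi -> bdd f -> bdd (fun t => phi (f t)).
Proof.
move=> cp [C hC].
have /compact_bounded[B [_ hB]] : compact (phi @` `[- C, C]).
  apply: continuous_compact; last exact: segment_compact.
  exact: continuous_subspaceT.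
exists (B + 1) => t t0; apply: hB; first by rewrite ltrDl.
by exists (f t) => //=; rewrite in_itv/= -ler_norml hC.
Qed.

Lemma bdd_sqr f (C : R) : (forall t, 0 <= t -> f t ^+ 2 <= C) -> bdd f.
Proof.
move=> hC; exists ((1 + C) / 2) => t t0; apply: (le_trans (norm_le_sqr _)).
by have := hC t t0; lra.
Qed.

Lemma prim_bdd_unicont F f : prim F f -> bdd f -> unicont F.
Proof. by move=> pF [C hC]; exact: prim_unicont pF hC. Qed.

Lemma fl_lip l s t : `|fl l s - fl l t| <= Yl l * `|angle (w s) l - angle (w t) l|.
Proof.
rewrite /fl /flow -!/(Yl l).
rewrite (_ : _ - _ - _ = Yl l * (sin (angle (w s) l) - sin (angle (w t) l))); last by ring.
by rewrite normrM (gtr0_norm (hY l)) ler_pM2l// sin_lip.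
Qed.

Lemma fl_bdd l : bdd (fl l).
Proof.
exists (Yl l * r) => t t0; rewrite /fl /flow -!/(Yl l) -mulrBr normrM (gtr0_norm (hY l)).
by rewrite ler_pM2l//; apply: (le_trans (sin_lip _ _)); exact: angle_near.
Qed.

Lemma netflow_bdd j : bdd (netflow j).
Proof.
have h : bdd (fun t => -1 * \sum_(l | src g l == j) fl l t + \sum_(l | dst g l == j) fl l t).
  by apply: bddD; [apply: bddZ|]; apply: bdd_sum => l _; exact: fl_bdd.
by have [C hC] := h; exists C => t t0; have := hC t t0; rewrite mulN1r.
Qed.

Lemma omega_bdd j : bdd (fun t => omega (w t) j).
Proof.
have [jG|jG] := boolP (j \in gen g).
  have [Mp _ _ _] := hpos jG.
  apply: (@bdd_sqr _ (2 * V0 / M g j)) => t t0; rewrite ler_pdivlMr//.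
  have [_ h _ _] := energies_le t0.
  have : (M g j * omega (w t) j) ^+ 2 / 2 / M g j <= V0.
    apply: le_trans h; rewrite (bigD1 j)//= lerDl; apply: sumr_ge0 => i /andP[iG _].
    by have [Mi _ _ _] := hpos iG; rewrite !divr_ge0 ?sqr_ge0// ltW.
  rewrite (_ : _ / 2 / _ = omega (w t) j ^+ 2 * M g j / 2); last by field; rewrite gt_eqF.
  by lra.
have [C hC] := netflow_bdd j; exists (C / Lam g j) => t t0; rewrite ler_pdivlMr//.
have [_ h] := load_balance hnet hws sw jG t0.
have := hC t t0; rewrite /netflow /fl -h normrM (gtr0_norm (hLam j)); lra.
Qed.

Lemma dp_bdd j : bdd (dp j).
Proof.
have [jG|jG] := boolP (j \in gen g); last first.
  exists 0 => t t0; have [h _] := load_balance hnet hws sw jG t0.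
  by rewrite /dp h normr0.
have [Mp tp kp cp] := hpos jG.
have kk : 0 < kg g j * kc g j by rewrite mulr_gt0.
apply: (@bdd_sqr _ (2 * V0 * (kg g j * kc g j) / tau g j)) => t t0; rewrite ler_pdivlMr//.
have [_ _ h _] := energies_le t0.
have : (tau g j * dp j t) ^+ 2 / 2 / (tau g j * (kg g j * kc g j)) <= V0.
  apply: le_trans h; rewrite (bigD1 j)//= lerDl; apply: sumr_ge0 => i /andP[iG _].
  have [_ ti ki ci] := hpos iG; rewrite !divr_ge0 ?sqr_ge0// ltW// !mulr_gt0//.
rewrite (_ : _ / 2 / _ = dp j t ^+ 2 * tau g j / (2 * (kg g j * kc g j))).
  by rewrite ler_pdivrMr ?mulr_gt0// => h'; lra.
by field; rewrite !gt_eqF.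
Qed.

Let nw := deviation_network hnet hT (fun j jG => let: And3 _ h _ := hQ jG in h) sw hws.

Let hE t : 0 <= t -> comm_energy g T ws w t <= V0.
Proof. by move=> t0; have [] := energies_le t0. Qed.

Lemma dpc_bdd j : bdd (dpc j).
Proof. by exists (1 + 2 * V0) => t t0; exact: (x_bounded nw hE (k_pc, j)). Qed.

Lemma dq_bdd j : j \in gen g -> bdd (dq j).
Proof.
move=> jG; have [_ cq _] := hQ jG.
have h : bdd (fun t => pM (w t) j).
  have [C hC] := dp_bdd j; exists (C + `|pM ws j|) => t t0.
  by rewrite -[pM (w t) j](subrK (pM ws j)); apply: (le_trans (ler_normD _ _)); rewrite lerD2r hC.
apply: bddB; first exact: bdd_cont.
by exists `|derive1 (Q g j) (pM ws j)|.
Qed.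

Lemma angle_dev_unicont l : unicont (fun t => angle (w t) l).
Proof.
apply: prim_bdd_unicont (angle_prim hnet sw l) _.
by apply: bddB; exact: omega_bdd.
Qed.

Lemma fl_unicont l : unicont (fl l).
Proof.
move=> e e0; have d0 : 0 < e / Yl l by rewrite divr_gt0.
have [d dd hd] := angle_dev_unicont l d0; exists d => // s t s0 st td.
apply: (le_trans (fl_lip l t s)); rewrite mulrC -ler_pdivlMr//; exact: hd.
Qed.

Lemma omega_unicont j : unicont (fun t => omega (w t) j).
Proof.
have [jG|jG] := boolP (j \in gen g).
  have [Mp _ _ _] := hpos jG.
  have h : unicont (fun t => M g j * omega (w t) j).
    apply: prim_bdd_unicont (omega_dev_prim hnet hws sw jG) _.
    apply: bddD; last exact: netflow_bdd.
    by apply: bddB; [exact: dp_bdd|apply: bddZ; exact: omega_bdd].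
  by apply: unicont_ext (unicontZ (M g j)^-1 h) => t _; rewrite mulKf// gt_eqF.
have h : unicont (fun t => (Lam g j)^-1 * (-1 * (\sum_(l | src g l == j) fl l t) +
    \sum_(l | dst g l == j) fl l t)).
  apply: unicontZ; apply: unicontD; first apply: unicontZ.
    by apply: unicont_sum => l _; exact: fl_unicont.
  by apply: unicont_sum => l _; exact: fl_unicont.
apply: unicont_ext h => t t0; have [_ e] := load_balance hnet hws sw jG t0.
by rewrite mulN1r -e mulKf// gt_eqF.
Qed.

Lemma dp_unicont j : j \in gen g -> unicont (dp j).
Proof.
move=> jG; have [_ tp _ _] := hpos jG.
have h : unicont (fun t => tau g j * dp j t).
  apply: prim_bdd_unicont (pM_dev_prim hnet hQ hws sw jG) _.
  apply: bddZ; apply: bddB; last exact: dq_bdd.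
  by apply: bddB; [exact: dpc_bdd|exact: omega_bdd].
by apply: unicont_ext (unicontZ (tau g j)^-1 h) => t _; rewrite mulKf// gt_eqF.
Qed.

Let psi := dissipation g ws w.

Lemma psi_barbalat f : unicont f ->
  (forall e, 0 < e -> exists2 m, 0 < m & forall t, 0 <= t -> e <= `|f t| -> m <= psi t) ->
  tends f 0.
Proof.
apply: (@barbalat R f psi V0).
- exact: (dissipation_reg hnet hT hQ hws sw).
- by move=> t _; exact: (dissipation_ge0 hnet hQ).
- move=> t t0; rewrite (itg_dissipation hnet hT hQ hws sw)//.
  by have [_ _ _] := energies_le t0; rewrite -/V0; lra.
Qed.

Lemma psi_ge t : [/\ forall j, Lam g j * omega (w t) j ^+ 2 <= psi t,
  forall j, j \in gen g -> dp j t * dq j t <= psi t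
  & forall s, inner (w t) s ^+ 2 <= psi t].
Proof.
have e1 j : 0 <= Lam g j * omega (w t) j ^+ 2 by rewrite mulr_ge0 ?sqr_ge0// ltW.
have e2 j : j \in gen g -> 0 <= dp j t * dq j t.
  by move=> jG; have [h1 _ h3] := hQ jG; exact: derive1_mono.
have e3 s : 0 <= inner (w t) s ^+ 2 by exact: sqr_ge0.
have s1 : 0 <= \sum_j Lam g j * omega (w t) j ^+ 2 by apply: sumr_ge0.
have s2 : 0 <= \sum_(j in gen g) dp j t * dq j t by apply: sumr_ge0.
have s3 : 0 <= \sum_s inner (w t) s ^+ 2 by apply: sumr_ge0.
have t1 j : Lam g j * omega (w t) j ^+ 2 <= \sum_j Lam g j * omega (w t) j ^+ 2.
  by rewrite [leRHS](bigD1 j)//= lerDl sumr_ge0.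
have t2 j : j \in gen g -> dp j t * dq j t <= \sum_(j in gen g) dp j t * dq j t.
  by move=> jG; rewrite [leRHS](bigD1 j)//= lerDl sumr_ge0// => i /andP[/e2].
have t3 s : inner (w t) s ^+ 2 <= \sum_s inner (w t) s ^+ 2.
  by rewrite [leRHS](bigD1 s)//= lerDl sumr_ge0.
rewrite /psi /dissipation -/(dp _ _).
split=> [j|j jG|s].
- by have := t1 j; lra.
- by have := t2 j jG; lra.
- by have := t3 s; lra.
Qed.

Lemma omega_tends0 j : tends (fun t => omega (w t) j) 0.
Proof.
apply: psi_barbalat (omega_unicont j) _ => e e0.
exists (Lam g j * e ^+ 2); first by rewrite mulr_gt0// exprn_gt0.
move=> t t0 h; have [hp _ _] := psi_ge t; apply: le_trans (hp j).
rewrite ler_pM2l// -[leRHS]real_normK ?num_real//.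
by rewrite lerXn2r ?nnegrE// ltW.
Qed.

Lemma dp_tends0 j : tends (dp j) 0.
Proof.
have [jG|jG] := boolP (j \in gen g); last first.
  apply: tends_ext (tends_cst 0) => t t0.
  by have [h _] := load_balance hnet hws sw jG t0; rewrite /dp h.
apply: psi_barbalat (dp_unicont jG) _ => e e0.
have [h1 _ h3] := hQ jG; have [mm m0 hm] := derive1_gap h1 h3 (pM ws j) e0.
exists mm => // t t0 /hm h; have [_ hp _] := psi_ge t.
exact: le_trans (hp j jG).
Qed.

Let dd (s : 'I_4 * 'I_n) t := load_input g (w t) s - load_input g ws s.

Lemma ddE s t : dd s t = if s.1 == k_pc then - dp s.2 t else 0.
Proof.
rewrite /dd /load_input /dp; case: s => [[[|[|[|[|//]]]] kp] j]/=; rewrite ?subrr//.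
by ring.
Qed.

Lemma dd_unicont s : unicont (fun t => itg (dd s) 0 t).
Proof.
have [C hC] := dp_bdd s.2.
apply: (@prim_unicont _ _ (dd s) `|C|).
  split; last by move=> t t0; rewrite itgxx add0r.
  exact: d_reg nw s.
move=> t t0; rewrite ddE; case: ifP => _; last by rewrite normr0.
by rewrite normrN; apply: (le_trans (hC t t0)); exact: ler_norm.
Qed.

Lemma inner_tends0 s : tends (fun t => inner (w t) s) 0.
Proof.
apply: psi_barbalat (rho_unicont nw hE s dd_unicont) _ => e e0.
exists (e ^+ 2); first by rewrite exprn_gt0.
move=> t t0 h; have [_ _ hp] := psi_ge t; apply: le_trans (hp s).
rewrite -[leRHS]real_normK ?num_real//.
by rewrite lerXn2r ?nnegrE// ltW.
Qed.

Lemma dq_tends0 j : j \in gen g -> tends (dq j) 0.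
Proof.
move=> jG; have [_ cq _] := hQ jG.
have h : tends (fun t => pM (w t) j) (pM ws j) by apply: tends_shift; exact: dp_tends0.
have := tendsB (tends_cont (cq (pM ws j)) h) (tends_cst (derive1 (Q g j) (pM ws j))).
by rewrite subrr.
Qed.

Lemma dpc_slow j : slow (dpc j).
Proof. exact: x_slow nw inner_tends0 (k_pc, j). Qed.

(** The deviation of p^M converges, hence is slow, and its derivative is slow too, so this
    derivative tends to 0; the other terms in it already do. *)
Lemma dpc_tends0 j : j \in gen g -> tends (dpc j) 0.
Proof.
move=> jG; have [_ _ kp cp] := hpos jG.
have kk : 0 < kg g j * kc g j by rewrite mulr_gt0.
have sF : slow (fun t => tau g j * dp j t) by apply: slowZ; exact: tends_slow (dp_tends0 j).
have sf : slow (fun t => kg g j * kc g j * (dpc j t - omega (w t) j - dq j t)).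
  apply: slowZ; apply: slowB; last exact: tends_slow (dq_tends0 jG).
  by apply: slowB; [exact: dpc_slow|exact: tends_slow (omega_tends0 j)].
have h := prim_slow_tends0 (pM_dev_prim hnet hQ hws sw jG) sF sf.
have := tendsD (tendsZ (kg g j * kc g j)^-1 h) (tendsD (omega_tends0 j) (dq_tends0 jG)).
rewrite mulr0 !addr0; apply: tends_ext => t t0.
by rewrite mulKf ?gt_eqF// /dpc /dq; ring.
Qed.

Lemma outputs_converge : exists xinf : 'I_4 * 'I_n -> R,
  [/\ forall s, tends (fun t => output (w t) s - output ws s) (xinf s),
      forall y, coupling (active g) (@lA n) (@lB n) (@lA' n) (@lB' n) (lweight g) y xinf = 0
    & forall j, j \in gen g -> xinf (k_pc, j) = 0].
Proof.
(* The cells that the deviation of p^M can enter are those whose output is already known to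
   settle. *)
pose pin (s : 'I_4 * 'I_n) := (s.1 == k_pc) && (s.2 \in gen g).
have d0 s : tends (dd s) 0.
  apply: (@tends_ext _ (fun t => if s.1 == k_pc then - 1 * dp s.2 t else 0)).
    by move=> t _; rewrite ddE mulN1r.
  case: (s.1 == k_pc); last exact: tends_cst.
  by have := tendsZ (-1) (dp_tends0 s.2); rewrite mulr0.
have xp s : pin s -> tends (fun t => output (w t) s - output ws s) 0.
  by case: s => [k' j] /andP[/= /eqP -> jG]; exact: dpc_tends0.
have dp0 s : ~~ pin s -> forall t, 0 <= t -> dd s t = 0.
  rewrite /pin negb_and => h t t0; rewrite ddE; case: ifP h => //= _ jG.
  by have [h _] := load_balance hnet hws sw jG t0; rewrite /dp h oppr0.
have [xinf [h1 h2]] := network_converges nw hE inner_tends0 d0 xp dp0.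
exists xinf; split=> // j jG; apply: (tends_uniq (h1 (k_pc, j))).
exact: dpc_tends0.
Qed.

Lemma angle_slow l : slow (fun t => angle (w t) l).
Proof.
apply: prim_tends0_slow (angle_prim hnet sw l) _.
by have := tendsB (omega_tends0 (src g l)) (omega_tends0 (dst g l)); rewrite subrr.
Qed.

Lemma fl_slow l : slow (fl l).
Proof.
have := slow_lip (phi := fun x => Yl l * sin x - flow g ws l) (K := Yl l) _ (angle_slow l).
apply=> a b; rewrite (_ : _ - _ = Yl l * (sin b - sin a)); last by ring.
by rewrite normrM (gtr0_norm (hY l)) ler_pM2l// sin_lip.
Qed.

(** At generators the swing equation is treated as in [dpc_tends0]; at loads the net flow is the
    damping times [omega]. *)
Lemma netflow_tends0 j : tends (netflow j) 0.
Proof.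
have [jG|jG] := boolP (j \in gen g); last first.
  have := tendsZ (Lam g j) (omega_tends0 j); rewrite mulr0; apply: tends_ext => t t0.
  by have [_ h] := load_balance hnet hws sw jG t0.
have so := tends_slow (omega_tends0 j).
have sn : slow (netflow j).
  have h : slow (fun t => -1 * (\sum_(l | src g l == j) fl l t) + \sum_(l | dst g l == j) fl l t).
    apply: slowD; first apply: slowZ; by apply: slow_sum => l _; exact: fl_slow.
  by apply: slow_ext h => t _; rewrite mulN1r.
have h := prim_slow_tends0 (omega_dev_prim hnet hws sw jG) (slowZ _ so)
  (slowD (slowB (tends_slow (dp_tends0 j)) (slowZ (Lam g j) so)) sn).
have := tendsB h (tendsB (dp_tends0 j) (tendsZ (Lam g j) (omega_tends0 j))).
rewrite mulr0 !subr0; apply: tends_ext => t t0.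
by rewrite /netflow /dp /fl; ring.
Qed.

(* The displacement of the angles lies in the image of the transposed incidence
   operator; paired with the displacement of the flows it only sees net flows. *)
Lemma angle_converges l : exists a, tends (fun t => angle (w t) l) a.
Proof.
pose B : 'M[R]_(n, q) := \matrix_(j, l) ((src g l == j)%:R - (dst g l == j)%:R).
pose Da s t : 'rV[R]_q := \row_l (angle (w s) l - angle (w t) l).
have DaB t s : 0 <= t -> t <= s -> (Da s t <= B)%MS.
  move=> t0 ts; apply/submxP; exists (\row_j itg (fun r => omega (w r) j) t s).
  apply/rowP => i; rewrite !mxE (prim_itg (angle_prim hnet sw i) t0 ts).
  rewrite (itgB _ (omega_reg hnet sw _) (omega_reg hnet sw _))//.
  under eq_bigr do rewrite !mxE mulrBr.
  have pick (a : 'I_n) (F : 'I_n -> R) : \sum_j F j * (a == j)%:R = F a.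
    rewrite (bigD1 a)//= eqxx mulr1 big1 ?addr0// => j ja.
    by rewrite eq_sym (negPf ja) mulr0.
  by rewrite sumrB !pick.
pose K := \sum_j \sum_i 2 * r * `|pinvmx B i j|.
have K0 : 0 <= K.
  by apply: sumr_ge0 => j _; apply: sumr_ge0 => i _; rewrite !mulr_ge0// ltW.
apply: tends_cauchy => e e0.
have c0 : 0 < y0 * cos k by rewrite mulr_gt0// cosk_gt0.
have d0 : 0 < y0 * cos k * e ^+ 2 / (2 * (K + 1)).
  by rewrite divr_gt0 ?mulr_gt0 ?exprn_gt0// ?ltr_wpDl// cosk_gt0.
apply: evW (ev_fwd (ev_all (fun j => @netflow_tends0 j _ d0))) => t t0 h s ts.
have s0 : 0 <= s by exact: le_trans ts.
set d := _ / _ in d0 h.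
(* Nodal potentials of the angle displacement. The integral of [omega] used above is another choice,
   but it has no bound uniform in time, while the pseudo-inverse is bounded through the
   displacement. *)
pose c : 'rV[R]_n := Da s t *m pinvmx B.
have ec i : angle (w s) i - angle (w t) i = c 0 (src g i) - c 0 (dst g i).
  have := mulmxKpV (DaB _ _ t0 ts); rewrite -/c => /rowP/(_ i); rewrite [RHS]mxE => <-.
  rewrite mxE; under eq_bigr do rewrite [B _ _]mxE mulrBr.
  have pick (a : 'I_n) (F : 'I_n -> R) : \sum_j F j * (a == j)%:R = F a.
    rewrite (bigD1 a)//= eqxx mulr1 big1 ?addr0// => j ja.
    by rewrite eq_sym (negPf ja) mulr0.
  by rewrite sumrB !pick.
have cb j : `|c 0 j| <= \sum_i 2 * r * `|pinvmx B i j|.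
  rewrite mxE; apply: (le_trans (ler_norm_sum _ _ _)); apply: ler_sum => i _.
  rewrite normrM mxE ler_wpM2r//.
  have := angle_near i s0; have := angle_near i t0.
  have := ler_normB (angle (w s) i - angle ws i) (angle (w t) i - angle ws i).
  rewrite (_ : _ - _ - _ = angle (w s) i - angle (w t) i); last by ring.
  by lra.
have main : \sum_i (fl i s - fl i t) * (angle (w s) i - angle (w t) i) <= K * (2 * d).
  rewrite (eq_bigr (fun i => (fl i s - fl i t) * (c 0 (src g i) - c 0 (dst g i)))); last first.
    by move=> i _; rewrite ec.
  rewrite (netflow_power g (fun i => fl i s - fl i t) (fun j => c 0 j)).
  apply: (le_trans (ler_norm _)); rewrite normrN.
  apply: (le_trans (ler_norm_sum _ _ _)); rewrite mulr_suml; apply: ler_sum => j _.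
  rewrite normrM; apply: ler_pM => //.
  rewrite (_ : _ + _ = netflow j s - netflow j t); last by rewrite /netflow !sumrB; ring.
  have := h s ts j; have := h t (lexx _) j; rewrite !subr0.
  by have := ler_normB (netflow j s) (netflow j t); lra.
have term i : y0 * cos k * (angle (w s) i - angle (w t) i) ^+ 2 <=
    (fl i s - fl i t) * (angle (w s) i - angle (w t) i).
  have hs := near_le (angle_near i s0); have ht := near_le (angle_near i t0).
  have := sin_monotone ht hs (ltW kpi).
  rewrite (_ : fl i s - fl i t = Yl i * (sin (angle (w s) i) - sin (angle (w t) i))); last first.
    by rewrite /fl /flow -/(Yl i); ring.
  move: (angle (w s) i - angle (w t) i) (sin _ - sin _) => a b hab.
  have ck := cosk_gt0.
  have a0 : 0 <= cos k * a ^+ 2 by rewrite mulr_ge0 ?sqr_ge0// ltW.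
  rewrite -mulrA; apply: (@le_trans _ _ (Yl i * (cos k * a ^+ 2))).
    by rewrite ler_wpM2r.
  by rewrite -mulrA ler_pM2l// [leRHS]mulrC.
have : y0 * cos k * (angle (w s) l - angle (w t) l) ^+ 2 <= K * (2 * d).
  apply: le_trans main; rewrite (bigD1 l)//=; apply: ler_wpDr; last exact: term.
  apply: sumr_ge0 => i _; apply: le_trans (term i).
  by rewrite mulr_ge0 ?sqr_ge0// ltW.
have K1 : 0 < K + 1 by rewrite ltr_wpDl.
have : K * (2 * d) <= y0 * cos k * e ^+ 2.
  rewrite /d (_ : K * _ = (y0 * cos k * e ^+ 2) * (K / (K + 1))); last first.
    by field; rewrite gt_eqF.
  apply: ler_piMr; last by rewrite ler_pdivrMr// mul1r lerDl.
  by rewrite mulr_ge0 ?sqr_ge0// ltW.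
move=> h1 h2; have := le_trans h2 h1; rewrite ler_pM2l// => h3.
rewrite -(@ler_pXn2r _ 2)// ?nnegrE ?(ltW e0)//.
by rewrite real_normK ?num_real.
Qed.

End Trapped.

(** * Smallness of the initial energy *)

Section Initial.
Context {R : realType} {n q m : nat}.

(* The right end point is left out since waves in transit at time [0] are only
   controlled at negative times. *)
Lemma itg_le_co (c a b C : R) (f : R -> R) : reg c f -> c <= a -> a <= b ->
  (forall t, a <= t -> t < b -> f t <= C) -> itg f a b <= C * (b - a).
Proof.
move=> rf ca ab hC; rewrite -itg_cst// /itg.
have fi := reg_integrable b rf ca; have ci := reg_integrable b (reg_cst c C) ca.
have sub : (`[a, b[%classic : set R) `<=` `[a, b]%classic.
  by move=> x /=; rewrite !in_itv/= => /andP[-> /ltW].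
have fi' : (@lebesgue_measure R).-integrable `[a, b[ (EFin \o f).
  by apply: integrableS fi.
have ci' : (@lebesgue_measure R).-integrable `[a, b[ (EFin \o (fun=> C)).
  by apply: integrableS ci.
rewrite -(Rintegral_itv_bndo_bndc fi') -(Rintegral_itv_bndo_bndc ci').
apply: le_Rintegral => //.
by move=> x /=; rewrite in_itv/= => /andP[]; exact: hC.
Qed.

Variables (g : grid R n q m) (T : 'I_n -> 'I_n -> R).
Hypotheses (hnet : network_ok g) (hT : forall i j, nbr g i j -> 0 <= T i j).
Variables (ws : signals R n q) (w : R -> signals R n q).
Hypotheses (hws : equilibrium g T ws) (sw : solution g T w).

(** Linear in [e] because squares are at most [e] once e <= 1. A cell gives 4e/2 + e/2; a link gives
    its two delays times 2e, where 2 comes from the scaling of the waves, divided by 4. *)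
Definition initial_gain : R :=
  \sum_(j in gen g) M g j / 2
  + \sum_(j in gen g) tau g j / (2 * (kg g j * kc g j))
  + \sum_l 2 * Y g (src g l) (dst g l)
  + (\sum_(s : 'I_4 * 'I_n) 5 / 2
     + \sum_(l | active g l) lweight g l * ((T l.2.1 l.2.2 + T l.2.2 l.2.1) / 2)).

Let hpos j : j \in gen g -> [/\ 0 < M g j, 0 < tau g j, 0 < kg g j & 0 < kc g j].
Proof. by have [_ _ _ [h _ _ _] _] := hnet; exact: h. Qed.

Let hcomm : simple_oriented (comm g).
Proof. by have [_ []] := hnet. Qed.

Lemma initial_gain_ge0 : 0 <= initial_gain.
Proof.
have [_ _ _ [_ _ _ hY] ha] := hnet.
rewrite !addr_ge0//; apply: sumr_ge0 => i hi.
- by have [Mp _ _ _] := hpos hi; rewrite divr_ge0// ltW.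
- by have [_ tp kp cp] := hpos hi; rewrite divr_ge0 ?mulr_ge0// ltW.
- by rewrite mulr_ge0// ltW.
- by rewrite divr_ge0.
- have nij : nbr g i.2.1 i.2.2 by case/andP: hi.
  have nji : nbr g i.2.2 i.2.1 by rewrite nbrC.
  rewrite mulr_ge0 ?divr_ge0 ?addr_ge0 ?hT//; apply: ltW.
  by have [] := ha _ _ nij.
Qed.

Lemma sqr_small (x e : R) : `|x| < e -> e <= 1 -> x ^+ 2 <= e.
Proof.
move=> xe e1; rewrite -real_normK ?num_real//.
have := normr_ge0 x; nra.
Qed.

Lemma initial_energy e : 0 < e -> e <= 1 ->
  init_close g T e (initial_of (fun=> ws)) (initial_of w) ->
  lyapunov g T ws w 0 <= initial_gain * e /\
  \sum_l (angle (w 0) l - angle ws l) ^+ 2 <= q%:R * e.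
Proof.
move=> e0 e1 [[hA hB] hW].
have [_ _ _ [_ _ _ hY] ha] := hnet.
have rws := equilibrium_rest hcomm hnet hws.
have dA l : `|angle (w 0) l - angle ws l| < e by rewrite distrC; exact: hA.
have dO j : `|omega (w 0) j| < e.
  by have [h _ _] := hB j; move: h; rewrite /= (rest_omega rws) sub0r normrN.
have dM j : `|pM (w 0) j - pM ws j| < e by rewrite distrC; have [_ h _] := hB j.
have dX s : `|output (w 0) s - output ws s| < e.
  rewrite distrC; case: s => [[[|[|[|[|//]]]] kp] j]; have [_ _ [[]]] := hB j;
  rewrite /output/= => h1 h2 h3 h4 [] h5 h6 h7 h8 //.
have dI s : `|inner (w 0) s| < e.
  rewrite -normrN (_ : - inner (w 0) s = inner ws s - inner (w 0) s).
  2: by rewrite (rest_inner rws) sub0r.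
  case: s => [[[|[|[|[|//]]]] kp] j]; have [_ _ [[]]] := hB j;
  rewrite /inner/= => h1 h2 h3 h4 [] h5 h6 h7 h8 //.
have dS i j c t : nbr g i j -> - T i j <= t -> t < 0 ->
    `|Num.sqrt 2 * eps g i j * (s_out (w t) i j c 0 - s_out ws i j c 0)| ^+ 2 <= 2 * e.
  move=> nij t1 t2; rewrite !normrM.
  have -> : `|eps g i j| = 1 by rewrite /eps; case: ifP; rewrite ?normrN normr1.
  rewrite mulr1 exprMn real_normK ?num_real// sqr_sqrtr//.
  rewrite ler_pM2l// real_normK ?num_real//; apply: sqr_small => //.
  by rewrite distrC; exact: hW.
have dW i j : nbr g i j ->
    forall c, window (fun s => (wave1 g (w s) c i j - wave1 g ws c i j) ^+ 2) (T i j) 0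
      <= 2 * e * T i j /\
    window (fun s => (wave2 g (w s) c i j - wave2 g ws c i j) ^+ 2) (T i j) 0
      <= 2 * e * T i j.
  move=> nij c; have [r1 r2] := wave_reg sw c nij.
  have rr (f : R -> R) k : reg (- T i j) f -> reg (- T i j) (fun s => (f s - k) ^+ 2).
    by move=> rf; have h := regB rf (reg_cst _ k); exact: regM.
  have Tij := hT nij.
  rewrite /window; split.
    apply: (le_trans (itg_le_co (C := 2 * e) (rr _ _ r1) _ _ _)).
    - by rewrite sub0r.
    - by rewrite sub0r oppr_le0.
    - move=> t; rewrite sub0r => t1 t2; have := dS _ _ (even6 c) _ nij t1 t2.
      by rewrite mulrBr real_normK ?num_real.
    - by rewrite !sub0r opprK.
  apply: (le_trans (itg_le_co (C := 2 * e) (rr _ _ r2) _ _ _)).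
  - by rewrite sub0r.
  - by rewrite sub0r oppr_le0.
  - move=> t; rewrite sub0r => t1 t2; have := dS _ _ (odd6 c) _ nij t1 t2.
    by rewrite mulrBr real_normK ?num_real.
  - by rewrite !sub0r opprK.
split; last first.
  rewrite mulr_natl -[X in _ *+ X](card_ord q) -sumr_const.
  by apply: ler_sum => l _; exact: sqr_small.
rewrite /lyapunov /power_energy /comm_energy /net_energy /initial_gain !mulrDl !mulr_suml.
apply: lerD; first apply: lerD; first apply: lerD; last apply: lerD;
  apply: ler_sum => i hi.
- have [Mp _ _ _] := hpos hi; have := sqr_small (dO i) e1.
  rewrite (_ : _ / 2 / _ = M g i / 2 * omega (w 0) i ^+ 2); last by field; rewrite gt_eqF.
  by rewrite ler_pM2l// divr_gt0.
- have [_ tp kp cp] := hpos hi; have := sqr_small (dM i) e1.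
  rewrite (_ : _ / 2 / _ = tau g i / (2 * (kg g i * kc g i)) * (pM (w 0) i - pM ws i) ^+ 2).
    by rewrite ler_pM2l// divr_gt0// !mulr_gt0.
  by field; rewrite !gt_eqF.
- rewrite /angle_potential (_ : 2 * _ * e = Y g (src g i) (dst g i) * (2 * e)); last by ring.
  rewrite ler_pM2l//; apply: (le_trans (ler_norm _)); apply: (le_trans (cos_quad _ _)).
  by have := sqr_small (dA i) e1; lra.
- have := sqr_small (dI i) e1; have h1 := dX i; have h2 := dI i.
  have : `|(output (w 0) i - output ws i) - inner (w 0) i| < 2 * e.
    by apply: (le_lt_trans (ler_normB _ _)); lra.
  move: (_ - inner (w 0) i) => y hy.
  have : y ^+ 2 <= 4 * e.
    by rewrite -real_normK ?num_real//; have := normr_ge0 y; nra.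
  lra.
- have nij : nbr g i.2.1 i.2.2 by case/andP: hi.
  have nji : nbr g i.2.2 i.2.1 by rewrite nbrC.
  have [_ al0] := ha _ _ nij.
  rewrite -[leRHS]mulrA ler_pM2l// /link_energy.
  have [h1 _] := dW _ _ nij i.1; have [_ h2] := dW _ _ nji i.1.
  rewrite ler_pdivrMr//; apply: (le_trans (lerD h1 h2)); lra.
Qed.

End Initial.

(** * Neighbourhoods, the limit state and the conclusion *)

Section Limit.
Context {R : realType} {n q m : nat}.
Variables (g : grid R n q m) (T : 'I_n -> 'I_n -> R).

Lemma all_vars_imp (P1 P2 P3 : (state R n q -> R) -> Prop) :
  (forall v, P1 v -> P2 v -> P3 v) -> all_vars P1 -> all_vars P2 -> all_vars P3.
Proof.
move=> h [a1 b1] [a2 b2]; split=> [l|j]; first by apply: h.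
have [p1 p2 [[p3 p4 p5 p6] [p7 p8 p9 p10]]] := b1 j.
have [q1 q2 [[q3 q4 q5 q6] [q7 q8 q9 q10]]] := b2 j.
by do !split; apply: h.
Qed.

Lemma init_close_refl e z : 0 < e -> init_close g T e z z.
Proof.
by move=> e0; split=> [|*]; rewrite ?subrr ?normr0//; do !split; move=> *;
  rewrite subrr normr0.
Qed.

Lemma init_close_trans e e' z1 z2 z3 : init_close g T e z1 z2 ->
  init_close g T e' z2 z3 -> init_close g T (e + e') z1 z3.
Proof.
have tri (a b c : R) : `|a - b| < e -> `|b - c| < e' -> `|a - c| < e + e'.
  move=> h1 h2; rewrite -(subrKA b); apply: (le_lt_trans (ler_normD _ _)).
  exact: ltrD.
move=> [a1 b1] [a2 b2]; split; first by apply: all_vars_imp a1 a2 => v; exact: tri.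
by move=> i j nij c t t1 t2; apply: tri (b1 _ _ nij c t t1 t2) (b2 _ _ nij c t t1 t2).
Qed.

Hypothesis aC : forall i j, nbr g i j -> alpha g i j = alpha g j i.

Lemma rest_power (x : state R n q) (y : 'I_4 * 'I_n -> R) :
  \sum_s y s * cell_input g (rest_sig g x) s =
  coupling (active g) (@lA n) (@lB n) (@lA' n) (@lB' n) (lweight g) y (output x)
  + \sum_s y s * load_input g x s.
Proof.
rewrite (cell_input_power aC (rest_sig g x) y); congr (_ + _); apply: eq_bigr => l _.
have [-> _] := rest_sig_rcv g x l.1 l.2.2 l.2.1.
by have [_ ->] := rest_sig_rcv g x l.1 l.2.1 l.2.2.
Qed.

End Limit.

Theorem theorem2 (R : realType) (n q m : nat) (g : grid R n q m)
  (T : 'I_n -> 'I_n -> R)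
  (hnet : network_ok g)
  (hT : forall i j, nbr g i j -> 0 <= T i j)
  (hA1 : assumption1 g)
  (ws : signals R n q)
  (hws : equilibrium g T ws)
  (hA2 : forall l : 'I_q, `|angle ws l| < pi / 2) :
  exists W : set (init_cond R n q),
    [/\ init_open g T W,
        W (initial_of (fun=> ws))
      & forall w : R -> signals R n q,
          solution g T w -> W (initial_of w) ->
          exists winf : signals R n q,
            [/\ equilibrium g T winf,
                ogr2_solution g (pM winf) (flow g winf),
                forall j : 'I_n, omega winf j = 0
              & converges_to w winf]].
Proof.
have [_ [hcomm _ _] _ [_ _ _ hY] ha] := hnet.
have aC i j : nbr g i j -> alpha g i j = alpha g j i by move=> /ha[].
have [hQ _] := hA1.
have rws := equilibrium_rest hcomm hnet hws.
(* The default values, 0 here and 1 in [y0], keep [k1] below pi / 2 and [y0] positive on a grid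
   without lines. *)
pose k1 := \big[Num.max/0]_l `|angle ws l|.
have k1a l : `|angle ws l| <= k1 by apply: (le_bigmax 0 (fun l => `|angle ws l|)).
have k10 : 0 <= k1 by apply: bigmax_ge_id.
have k1pi : k1 < pi / 2.
  by apply: bigmax_lt => [|l _]; [rewrite divr_gt0// pi_gt0|exact: hA2].
pose y0 := \big[Num.min/1]_l Y g (src g l) (dst g l).
have y00 : 0 < y0 by apply: lt_bigmin => // l _; exact: hY.
have hy l : y0 <= Y g (src g l) (dst g l).
  by apply: bigmin_le.
(* Half of the gap to pi / 2: angles within [r] of the equilibrium stay where the cosine is at least
   [cos k > 0]. *)
pose r := (pi / 2 - k1) / 2; pose k := k1 + r.
have r0 : 0 < r by rewrite divr_gt0// subr_gt0.
have k0 : 0 <= k by rewrite addr_ge0// ltW.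
have kpi : k < pi / 2 by rewrite /k /r; lra.
have hk l : `|angle ws l| + r <= k by rewrite lerD2r.
have ck : 0 < cos k by apply: cosk_gt0.
pose c0 := y0 * (cos k / 2) * r ^+ 2.
have c00 : 0 < c0.
  apply: mulr_gt0; last by rewrite exprn_gt0.
  by apply: mulr_gt0; last rewrite divr_gt0.
have K0 := initial_gain_ge0 hnet hT; set K := initial_gain g T in K0.
pose delta := Num.min 1 (Num.min (c0 / (K + 1)) (r ^+ 2 / (q%:R + 1))).
have delta0 : 0 < delta.
  by rewrite !lt_min ltr01 !divr_gt0 ?exprn_gt0 ?ltr_wpDl.
(* The radius [e] strictly below [delta] makes the set open. Pointwise strict bounds by [delta]
   would not suffice, since the supremum over the waves in transit may equal [delta]. *)
exists [set z | exists2 e, 0 < e < delta & init_close g T e (initial_of (fun=> ws)) z].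
split.
- move=> z [e /andP[e0 ed] ez]; exists ((delta - e) / 2); first by rewrite divr_gt0// subr_gt0.
  move=> z' zz'; exists (e + (delta - e) / 2); last exact: init_close_trans ez zz'.
  by apply/andP; split; lra.
- exists (delta / 2); last by apply: init_close_refl; rewrite divr_gt0.
  by apply/andP; split; lra.
move=> w sw [e /andP[e0 ed] ew].
have : e < 1 /\ e < c0 / (K + 1) /\ e < r ^+ 2 / (q%:R + 1).
  by move: ed; rewrite !lt_min => /and3P[? ? ?].
move=> [e1 [eK er]].
have [hV hS] := initial_energy hnet hT hws sw e0 (ltW e1) ew.
have hV' : lyapunov g T ws w 0 < c0.
  apply: (le_lt_trans hV); move: eK; rewrite ltr_pdivlMr ?ltr_wpDl//.
  by rewrite -/K; nra.
have hS' : \sum_l (angle (w 0) l - angle ws l) ^+ 2 < r ^+ 2.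
  apply: (le_lt_trans hS); move: er; rewrite ltr_pdivlMr ?ltr_wpDl//.
  by have := ler0n R q; nra.
have [xinf [xlim xcoup xgen]] := outputs_converge hnet hT hQ hws r0 k0 kpi y00 hk hy sw hV' hS'.
have acv := angle_converges hnet hT hQ hws r0 k0 kpi y00 hk hy sw hV' hS'.
pose ainf l := projT1 (cid (acv l)).
have alim l : tends (fun t => angle (w t) l) (ainf l) by rewrite /ainf; case: (cid (acv l)).
have wlim := omega_tends0 hnet hT hQ hws r0 k0 kpi y00 hk hy sw hV' hS'.
have plim := dp_tends0 hnet hT hQ hws r0 k0 kpi y00 hk hy sw hV' hS'.
have ilim := inner_tends0 hnet hT hQ hws r0 k0 kpi y00 hk hy sw hV' hS'.
have nlim := netflow_tends0 hnet hT hQ hws r0 k0 kpi y00 hk hy sw hV' hS'.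
(* The limit shares p^M with the given equilibrium, and pc at the generators; angles and the other
   controller outputs may differ. *)
pose xl : state R n q := State (Phys ainf (fun=> 0) (pM ws))
  (fun=> 0) (fun j => zeta ws j + xinf (k_zeta, j))
  (fun=> 0) (fun j => pc ws j + xinf (k_pc, j))
  (fun=> 0) (fun j => vpi ws j + xinf (k_pi, j))
  (fun=> 0) (fun j => vphi ws j + xinf (k_phi, j)).
have oxl s : output xl s = output ws s + xinf s.
  by case: s => [[[|[|[|[|//]]]] kp] j]; rewrite /output/=; congr (_ + xinf (_, _));
    exact: val_inj.
have rxl : rest g xl.
  split=> //=.
  - by move=> j; exact: rest_load.
  - by move=> j jG; rewrite xgen// addr0; exact: rest_gen.
  - move=> j; have flim l : tends (fun t => flow g (w t) l - flow g ws l)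
        (flow g xl l - flow g ws l).
      apply: tendsB (tends_cst _); apply: tendsZ.
      by apply: tends_cont (alim l); exact: continuous_sin.
    have h : tends (fun t => -1 * \sum_(l | src g l == j) (flow g (w t) l - flow g ws l)
        + \sum_(l | dst g l == j) (flow g (w t) l - flow g ws l))
       (-1 * \sum_(l | src g l == j) (flow g xl l - flow g ws l)
        + \sum_(l | dst g l == j) (flow g xl l - flow g ws l)).
      by apply: tendsD; [apply: tendsZ|]; apply: tends_sum => l _; exact: flim.
    have h' := tends_uniq (tends_ext (fun t _ => esym (congr1 (fun z => z + _) (mulN1r _))) (nlim j)) h.
    have := rest_flow rws j; move: h'; rewrite !sumrB; lra.
  - by case=> [[[|[|[|[|//]]]] kp] j].
  (* Inputs at rest are affine in the outputs, with a constant part that depends on p^M only. The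
     displacement [xinf] is in the kernel of the coupling, so the inputs remain zero. *)
  - move=> s; have h0 := rest_power aC ws (@dirac_fun R _ s).
    have h1 := rest_power aC xl (@dirac_fun R _ s).
    have pick (F : 'I_4 * 'I_n -> R) : \sum_i dirac_fun s i * F i = F s.
      rewrite (bigD1 s)//= /dirac_fun eqxx mul1r big1 ?addr0// => i /negPf is_.
      by rewrite is_ mul0r.
    move: h0 h1; rewrite !pick (rest_input rws) => h0 ->.
    have -> : output xl = (fun i => 1 * output ws i + xinf i).
      by apply/funext => i; rewrite oxl mul1r.
    by rewrite coupling_linr xcoup mul1r addr0 h0.
exists (rest_sig g xl); split => //.
- exact: (rest_equilibrium T hcomm hnet rxl).
- exact: (rest_solution hnet hA1 rxl).
have ol s : output (w t) s @[t --> +oo] --> output xl s.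
  apply: tends_cvg; rewrite oxl addrC; have := tendsD (xlim s) (tends_cst (output ws s)).
  by apply: tends_ext => t _; rewrite subrK.
have il s : inner (w t) s @[t --> +oo] --> (0 : R) by apply: tends_cvg; exact: ilim.
split=> [l|j]; first exact: tends_cvg (alim l).
split; first exact: tends_cvg (wlim j).
  by apply: tends_cvg; apply: tends_shift; exact: plim.
split; split.
- exact: (il (k_zeta, j)).
- exact: (ol (k_zeta, j)).
- exact: (il (k_pc, j)).
- exact: (ol (k_pc, j)).
- exact: (il (k_pi, j)).
- exact: (ol (k_pi, j)).
- exact: (il (k_phi, j)).
- exact: (ol (k_phi, j)).
Qed.
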